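(* Let $\mathbf{E}$ be an Elasticity tensor on $\mathbb{R}^3$ and write it, in an orthonormal frame, as $$E_{ijkl}=\lambda\delta_{ij}\delta_{kl}+\mu(\delta_{ik}\delta_{jl}+\delta_{il}\delta_{jk})+\delta_{ij}a_{kl}+\delta_{kl}a_{ij}+\delta_{ik}b_{jl}+\delta_{jl}b_{ik}+\delta_{il}b_{jk}+\delta_{jk}b_{il}+H_{ijkl},$$ where $\lambda,\mu$ are scalars, $\mathbf{a},\mathbf{b}$ are symmetric traceless second-order tensors and $\mathbf{H}\in\mathbb{H}^4$. Then: (1) $\mathbf{E}$ is isotropic iff $\mathbf{a}=\mathbf{b}=\mathbf{d}_2=0$. (2) $\mathbf{E}$ is cubic iff $\mathbf{a}=\mathbf{b}=\mathbf{d}_2'=0$ and $\mathbf{d}_2\neq 0$. (3) $\mathbf{E}$ is transversely isotropic iff the triple $(\mathbf{d}_2,\mathbf{a},\mathbf{b})$ is transversely isotropic and $\mathbf{H}\times\mathbf{d}_2=\mathbf{H}\times\mathbf{a}=\mathbf{H}\times\mathbf{b}=0$. (4) $\mathbf{E}$ is tetragonal iff $(\mathbf{d}_2,\mathbf{a},\mathbf{b})$ is transversely isotropic, $\operatorname{tr}(\mathbf{H}\times\mathbf{d}_2)=\operatorname{tr}(\mathbf{H}\times\mathbf{a})=\operatorname{tr}(\mathbf{H}\times\mathbf{b})=0$, and at least one of $\mathbf{H}\times\mathbf{d}_2$, $\mathbf{H}\times\mathbf{a}$, $\mathbf{H}\times\mathbf{b}$ is nonzero. (5) $\mathbf{E}$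 is trigonal iff $(\mathbf{d}_2,\mathbf{a},\mathbf{b})$ is transversely isotropic, $\mathbf{d}_2\times(\mathbf{H}:\mathbf{d}_2)=\mathbf{a}\times(\mathbf{H}:\mathbf{a})=\mathbf{b}\times(\mathbf{H}:\mathbf{b})=0$, and at least one of $\operatorname{tr}(\mathbf{H}\times\mathbf{d}_2)$, $\operatorname{tr}(\mathbf{H}\times\mathbf{a})$, $\operatorname{tr}(\mathbf{H}\times\mathbf{b})$ is nonzero. (6) $\mathbf{E}$ is orthotropic iff the family $\mathcal{F}_o=\{\mathbf{d}_2,\mathbf{a},\mathbf{b},\mathbf{c}_3,\mathbf{c}_4,\mathbf{H}:\mathbf{a},\mathbf{H}:\mathbf{b},\mathbf{H}:\mathbf{a}^2,\mathbf{H}:\mathbf{b}^2\}$ is orthotropic. (7) $\mathbf{E}$ is monoclinic iff the family $\mathcal{F}_m=\mathcal{F}_o\cup\{\mathbf{H}:(\mathbf{a}\mathbf{b})^s,\mathbf{H}:(\mathbf{a}\mathbf{d}_2)^s,\mathbf{H}:(\mathbf{b}\mathbf{d}_2)^s\}$ is monoclinic. (8) $\mathbf{E}$ is triclinic iff none of the conditions in (1)–(7) holds.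
   Context: An Elasticity tensor is a fourth-order tensor $\mathbf{E}$ on $\mathbb{R}^3$ with $E_{ijkl}=E_{jikl}=E_{klij}$. $\mathbb{H}^4$ is the space of totally symmetric, traceless fourth-order tensors on $\mathbb{R}^3$. $SO(3)$ acts on $n$-th order tensors by $(g\star\mathbf{T})(x_1,\dots,x_n)=\mathbf{T}(g^{-1}x_1,\dots,g^{-1}x_n)$. The symmetry group of a tensor is $\{g\in SO(3): g\star\mathbf{T}=\mathbf{T}\}$; the symmetry group of a family of tensors is the intersection of the symmetry groups of its members; the symmetry class is the conjugacy class of the symmetry group in $SO(3)$. Names: isotropic $=[SO(3)]$, transversely isotropic $=[O(2)]$, cubic $=[\mathbb{O}]$ (orientation-preserving symmetry group of a cube, order 24), tetragonal $=[\mathbb{D}_4]$, trigonal $=[\mathbb{D}_3]$, orthotropic $=[\mathbb{D}_2]$, monoclinic $=[\mathbb{Z}_2]$, triclinic $=[\{1\}]$, where $O(2)$ is generated by the rotations about the $z$-axis and the rotation by $\pi$ about the $x$-axis, $\mathbb{Z}_n$ is the group of rotations by multiples of $2\pi/n$ about the $z$-axis, and $\mathbb{D}_n$ is generated by $\mathbb{Z}_n$ and the rotation by $\pi$ about the $x$-axis. Notation: for fourth-order tensors $(\mathbf{A}:\mathbf{B})_{ijkl}=A_{ijmn}B_{mnkl}$, $\mathbf{H}^2=\mathbf{H}:\mathbf{H}$, $\mathbf{H}^n=\mathbf{H}:\mathbf{H}^{n-1}$; for a second-order tensor $\mathbf{a}$, $(\mathbf{H}:\mathbf{a})_{ij}=H_{ijkl}a_{kl}$;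 $(\operatorname{tr}_{13}\mathbf{A})_{ij}=A_{kikj}$; $\mathbf{d}_2=\operatorname{tr}_{13}(\mathbf{H}^2)$, $\mathbf{c}_3=\mathbf{H}:\mathbf{d}_2$, $\mathbf{c}_4=\mathbf{H}:\mathbf{c}_3$. Products $\mathbf{a}\mathbf{b}$ of second-order tensors are matrix products, $(\mathbf{a}\mathbf{b})^s=\frac12(\mathbf{a}\mathbf{b}+\mathbf{b}\mathbf{a})$, $\mathbf{a}^2=\mathbf{a}\mathbf{a}$, $\mathbf{a}'=\mathbf{a}-\frac13\operatorname{tr}(\mathbf{a})\mathbf{q}$ with $\mathbf{q}$ the identity (metric) tensor. For totally symmetric tensors $\mathbf{S}^1$ of order $p$ and $\mathbf{S}^2$ of order $q$, the generalized cross product $\mathbf{S}^1\times\mathbf{S}^2$ is the totally symmetric tensor of order $p+q-1$ given by the total symmetrization of $\varepsilon_{i_1jk}S^1_{ji_2\cdots i_p}S^2_{ki_{p+1}\cdots i_{p+q-1}}$ ($\varepsilon$ the Levi-Civita tensor); $\operatorname{tr}$ of a totally symmetric tensor is the contraction of any two indices. *)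

(* Defs.v *)
From HB Require Import structures.
From Stdlib Require List.
From mathcomp Require Import all_boot all_order fingroup perm all_algebra.
From mathcomp Require Import reals trigo.
Set Implicit Arguments. Unset Strict Implicit. Unset Printing Implicit Defensive.
Import Order.TTheory GRing.Theory Num.Theory.
Local Open Scope ring_scope.

(* ---------- tensors on R^3, in components w.r.t. an orthonormal frame ---------- *)
Definition tensor (R : Type) (n : nat) := {ffun 'I_n -> 'I_3} -> R.

Definition tzero (R : realType) (n : nat) : tensor R n := fun _ => 0.
Arguments tzero : clear implicits.

Definition rotation (R : realType) (g : 'M[R]_3) : Prop :=
  g^T *m g = 1%:M /\ \det g = 1.

(* (g * T)(x_1,..,x_n) = T(g^-1 x_1, .., g^-1 x_n), in components *)
Definition act (R : realType) (n : nat) (g : 'M[R]_3) (T : tensor R n) : tensor R n :=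
  fun idx => \sum_(j : {ffun 'I_n -> 'I_3})
               (\prod_(k < n) invmx g (j k) (idx k)) * T j.

Definition family (R : Type) := list {n : nat & tensor R n}.
Definition pk (R : Type) (n : nat) (T : tensor R n) : {n : nat & tensor R n} :=
  existT _ n T.

Definition sym_group (R : realType) (F : family R) (g : 'M[R]_3) : Prop :=
  rotation g /\ forall t, List.In t F -> act g (projT2 t) = projT2 t.

Definition conj_class (R : realType) (S K : 'M[R]_3 -> Prop) : Prop :=
  exists h, rotation h /\ forall g, S g <-> K (invmx h *m g *m h).

Definition has_class (R : realType) (F : family R) (K : 'M[R]_3 -> Prop) : Prop :=
  conj_class (sym_group F) K.

Definition subgroup_SO3 (R : realType) (K : 'M[R]_3 -> Prop) : Prop :=
  [/\ forall g, K g -> rotation g, K 1%:M,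
      forall g h, K g -> K h -> K (g *m h) & forall g, K g -> K (invmx g)].

Definition generated (R : realType) (S : 'M[R]_3 -> Prop) (g : 'M[R]_3) : Prop :=
  forall K, subgroup_SO3 K -> (forall s, S s -> K s) -> K g.

Definition rotz (R : realType) (t : R) : 'M[R]_3 := \matrix_(i, j)
  match nat_of_ord i, nat_of_ord j with
  | 0, 0 => cos t | 0, 1 => - sin t | 1, 0 => sin t | 1, 1 => cos t
  | 2, 2 => 1 | _, _ => 0 end.
Definition rotx (R : realType) (t : R) : 'M[R]_3 := \matrix_(i, j)
  match nat_of_ord i, nat_of_ord j with
  | 1, 1 => cos t | 1, 2 => - sin t | 2, 1 => sin t | 2, 2 => cos t
  | 0, 0 => 1 | _, _ => 0 end.

Definition SO3 (R : realType) : 'M[R]_3 -> Prop := @rotation R.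
Definition O2 (R : realType) : 'M[R]_3 -> Prop :=
  generated (fun s => (exists t : R, s = rotz t) \/ s = rotx pi).
Definition Zn (R : realType) (n : nat) : 'M[R]_3 -> Prop :=
  fun g => exists k : int, g = rotz (k%:~R * (2 * pi / n%:R)).
Definition Dn (R : realType) (n : nat) : 'M[R]_3 -> Prop :=
  generated (fun s => Zn n s \/ s = rotx pi).
(* orientation-preserving symmetry group of the cube [-1,1]^3:
   rotations mapping the vertex set {-1,1}^3 into itself *)
Definition cubeO (R : realType) : 'M[R]_3 -> Prop :=
  fun g => rotation g /\ forall v : 'cV[R]_3,
    (forall i, v i 0 = 1 \/ v i 0 = -1) ->
    (forall i, (g *m v) i 0 = 1 \/ (g *m v) i 0 = -1).
Definition trivial_grp (R : realType) : 'M[R]_3 -> Prop := fun g => g = 1%:M.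

Definition idx4 (i j k l : 'I_3) : {ffun 'I_4 -> 'I_3} :=
  [ffun m : 'I_4 => match nat_of_ord m with 0 => i | 1 => j | 2 => k | _ => l end].
Definition get4 (R : Type) (T : tensor R 4) (i j k l : 'I_3) : R := T (idx4 i j k l).
Definition f4 (R : Type) (f : 'I_3 -> 'I_3 -> 'I_3 -> 'I_3 -> R) : tensor R 4 :=
  fun idx => f (idx (inord 0)) (idx (inord 1)) (idx (inord 2)) (idx (inord 3)).
Definition m2t (R : Type) (a : 'M[R]_3) : tensor R 2 :=
  fun idx => a (idx (inord 0)) (idx (inord 1)).

Definition delta (R : realType) (i j : 'I_3) : R := (i == j)%:R.
Arguments delta {R}.

Definition elasticity (R : realType) (E : tensor R 4) : Prop :=
  forall i j k l, get4 E i j k l = get4 E j i k l /\ get4 E i j k l = get4 E k l i j.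

Definition totally_symmetric (R : realType) (n : nat) (T : tensor R n) : Prop :=
  forall (s : 'S_n) (idx : {ffun 'I_n -> 'I_3}), T [ffun m => idx (s m)] = T idx.

Definition ttr (R : realType) (n : nat) (T : tensor R n.+2) : tensor R n :=
  fun idx => \sum_(i < 3)
    T [ffun m : 'I_(2 + n) => match split m with inl _ => i | inr m' => idx m' end].

Definition in_H4 (R : realType) (H : tensor R 4) : Prop :=
  totally_symmetric H /\ ttr (n := 2) H = tzero R 2.

Definition sym_traceless (R : realType) (a : 'M[R]_3) : Prop :=
  a^T = a /\ \tr a = 0.

Definition hmul (R : realType) (A B : tensor R 4) : tensor R 4 :=
  f4 (fun i j k l => \sum_(m < 3) \sum_(n < 3) get4 A i j m n * get4 B m n k l).
Definition tr13 (R : realType) (A : tensor R 4) : 'M[R]_3 :=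
  \matrix_(i, j) \sum_(k < 3) get4 A k i k j.
Definition contr (R : realType) (H : tensor R 4) (a : 'M[R]_3) : 'M[R]_3 :=
  \matrix_(i, j) \sum_(k < 3) \sum_(l < 3) get4 H i j k l * a k l.
Definition d2 (R : realType) (H : tensor R 4) : 'M[R]_3 := tr13 (hmul H H).
Definition c3 (R : realType) (H : tensor R 4) : 'M[R]_3 := contr H (d2 H).
Definition c4 (R : realType) (H : tensor R 4) : 'M[R]_3 := contr H (c3 H).
Definition symprod (R : realType) (a b : 'M[R]_3) : 'M[R]_3 :=
  2^-1 *: (a *m b + b *m a).
Definition dev (R : realType) (a : 'M[R]_3) : 'M[R]_3 :=
  a - (3^-1 * \tr a) *: 1%:M.

(* Levi-Civita symbol *)
Definition eps (R : realType) (i j k : 'I_3) : R :=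
  ((j%:R - i%:R) * (k%:R - i%:R) * (k%:R - j%:R)) / 2.
Arguments eps {R}.

Definition symmetrize (R : realType) (n : nat) (T : tensor R n) : tensor R n :=
  fun idx => (n`!%:R)^-1 * \sum_(s : 'S_n) T [ffun m => idx (s m)].

Definition cross (R : realType) (p q : nat) (S1 : tensor R p.+1) (S2 : tensor R q.+1)
  : tensor R (p + q).+1 :=
  symmetrize (fun idx : {ffun 'I_(p + q).+1 -> 'I_3} =>
    \sum_(j < 3) \sum_(k < 3) eps (idx ord0) j k
      * S1 [ffun m : 'I_p.+1 => if nat_of_ord m == 0%N then j else idx (inord m)]
      * S2 [ffun m : 'I_q.+1 => if nat_of_ord m == 0%N then k else idx (inord (p + m))]).

Definition crossH (R : realType) (H : tensor R 4) (a : 'M[R]_3) : tensor R 5 :=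
  cross (p := 3) (q := 1) H (m2t a).
Definition trcrossH (R : realType) (H : tensor R 4) (a : 'M[R]_3) : tensor R 3 :=
  ttr (n := 3) (crossH H a).
Definition cross2 (R : realType) (a b : 'M[R]_3) : tensor R 3 :=
  cross (p := 1) (q := 1) (m2t a) (m2t b).

Definition triple (R : realType) (H : tensor R 4) (a b : 'M[R]_3) : family R :=
  [:: pk (m2t (d2 H)); pk (m2t a); pk (m2t b)].

Definition Fo (R : realType) (H : tensor R 4) (a b : 'M[R]_3) : family R :=
  [:: pk (m2t (d2 H)); pk (m2t a); pk (m2t b); pk (m2t (c3 H)); pk (m2t (c4 H));
      pk (m2t (contr H a)); pk (m2t (contr H b));
      pk (m2t (contr H (a *m a))); pk (m2t (contr H (b *m b)))].

Definition Fm (R : realType) (H : tensor R 4) (a b : 'M[R]_3) : family R :=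
  Fo H a b ++
  [:: pk (m2t (contr H (symprod a b))); pk (m2t (contr H (symprod a (d2 H))));
      pk (m2t (contr H (symprod b (d2 H))))].

Definition cond_iso (R : realType) (H : tensor R 4) (a b : 'M[R]_3) : Prop :=
  a = 0 /\ b = 0 /\ d2 H = 0.
Definition cond_cubic (R : realType) (H : tensor R 4) (a b : 'M[R]_3) : Prop :=
  a = 0 /\ b = 0 /\ dev (d2 H) = 0 /\ d2 H <> 0.
Definition cond_transv (R : realType) (H : tensor R 4) (a b : 'M[R]_3) : Prop :=
  has_class (triple H a b) (@O2 R) /\
  crossH H (d2 H) = tzero R 5 /\ crossH H a = tzero R 5 /\ crossH H b = tzero R 5.
Definition cond_tetra (R : realType) (H : tensor R 4) (a b : 'M[R]_3) : Prop :=
  has_class (triple H a b) (@O2 R) /\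
  trcrossH H (d2 H) = tzero R 3 /\ trcrossH H a = tzero R 3 /\ trcrossH H b = tzero R 3 /\
  (crossH H (d2 H) <> tzero R 5 \/ crossH H a <> tzero R 5 \/ crossH H b <> tzero R 5).
Definition cond_trigo (R : realType) (H : tensor R 4) (a b : 'M[R]_3) : Prop :=
  has_class (triple H a b) (@O2 R) /\
  cross2 (d2 H) (contr H (d2 H)) = tzero R 3 /\ cross2 a (contr H a) = tzero R 3 /\
  cross2 b (contr H b) = tzero R 3 /\
  (trcrossH H (d2 H) <> tzero R 3 \/ trcrossH H a <> tzero R 3 \/ trcrossH H b <> tzero R 3).
Definition cond_ortho (R : realType) (H : tensor R 4) (a b : 'M[R]_3) : Prop :=
  has_class (Fo H a b) (@Dn R 2).
Definition cond_mono (R : realType) (H : tensor R 4) (a b : 'M[R]_3) : Prop :=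
  has_class (Fm H a b) (@Zn R 2).

(* Main.v *)
(** A rotation [g] fixes [E] iff it commutes with [a] and [b] and fixes [H]; call this group S.
    It is contained in the symmetry groups of [F_m], [F_o] and of the triple, in increasing
    order. Each of the seven conditions implies the corresponding class for S, one of them holds
    unless S is trivial, and the eight model groups are separated by the traces of their elements
    and two commutation properties; this gives all the equivalences at once.

    Call a unit vector n an axis of (H, a, b) if [a], [b], [d2 H] and H : nn all lie in the span
    of 1 and nn. In a frame with n along z, [H] then has only parts of weight 0, 3, 4 for the
    rotations about z, and [d2 H] being axial forbids weights 3 and 4 from occurring together: S
    is O(2), D_3 or D_4, and the cross products detect which.

    If [a = b = 0] and [d2 H] is scalar, then [H] is zero or cubic. Indeed the quartic form of [H]
    vanishes at some isotropic complex vector, which provides a frame without weight 4 part, and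
    in this frame scalarity of [d2 H] bounds the weight 3 part from below so strongly that the
    weights 1 and 2 vanish.

    When there is no axis, every half-turn r commuting with [F_o] fixes [H]. In a frame with r
    about z, the components of [H] odd in z are the coefficients of two linear equations
    satisfied by [d2 H], [c3 H], [a], [b], [a^2], [b^2]. If these components do not all vanish,
    then either the equations force a common axis, or [a = b = 0] and [c3 H] is an affine
    function of [d2 H], which has distinct eigenvalues; the positivity of |d2'|^2 excludes the
    latter. *)

Require Import Defs.
From Stdlib Require List.
From mathcomp Require Import all_boot all_order fingroup perm all_algebra.
From mathcomp Require Import boolp reals trigo complex ring lra zify.
Set Implicit Arguments. Unset Strict Implicit. Unset Printing Implicit Defensive.
Import Order.TTheory GRing.Theory Num.Theory.
Local Open Scope ring_scope.

(** No classification of the closed subgroups of SO(3) enters: each class is read off an explicit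
    normal form of [H] in a suitable frame, and the work reduces to polynomial identities in the
    nine parameters of a harmonic quartic.

    The two linear equations are the xz and yz entries of H : m, for [m] symmetric with eigenvector
    z. The unknowns are m_xx - m_zz, m_yy - m_zz and 2 m_xy, and the rows are (p, q, s) and (s, t,
    q). When the rows are independent, the solutions form a line modulo scalars, so every solution
    is an affine function of any nonscalar one; applied to a^2 and [a], this gives [a] a repeated
    eigenvalue. The rows are dependent and not both zero only when the odd part comes from the cube
    of a linear form in x and y; the axis is then orthogonal to z.

    The delicate case is a = b = 0 with distinct eigenvalues of [d2 H]. There the linear equations
    only make [c3 H] affine in [d2 H], and the contradiction comes from computing [d2 H] once more
    as a quadratic expression in [H]. *)

Notation o0 := (@Ordinal 3 0 isT).
Notation o1 := (@Ordinal 3 1 isT).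
Notation o2 := (@Ordinal 3 2 isT).

Lemma ord3P (P : 'I_3 -> Prop) : P o0 -> P o1 -> P o2 -> forall i, P i.
Proof.
move=> P0 P1 P2 [[|[|[|//]]] Hi].
- by rewrite (_ : Ordinal Hi = o0) //; apply: val_inj.
- by rewrite (_ : Ordinal Hi = o1) //; apply: val_inj.
- by rewrite (_ : Ordinal Hi = o2) //; apply: val_inj.
Qed.

Lemma sum3 (V : nmodType) (F : 'I_3 -> V) : \sum_(i < 3) F i = F o0 + F o1 + F o2.
Proof.
rewrite !big_ord_recr big_ord0 /= add0r.
by congr (F _ + F _ + F _); apply: val_inj.
Qed.

(** * Polynomial forms of tensors and polarization *)

Section MultilinearForms.
Variable R : realType.
Implicit Types (n : nat) (g : 'M[R]_3).

(** Each slot takes its own vector: the trace of a cross product feeds basis vectors to two slots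
    and the argument to the others. *)
Definition mform n (T : tensor R n) (x : 'I_n -> 'I_3 -> R) : R :=
  \sum_(j : {ffun 'I_n -> 'I_3}) T j * \prod_(k < n) x k (j k).

Lemma mform_ext n (T : tensor R n) x y :
  (forall k i, x k i = y k i) -> mform T x = mform T y.
Proof.
by move=> xy; apply: eq_bigr => j _; congr (_ * _); apply: eq_bigr => k _.
Qed.

Lemma mform_act n g (T : tensor R n) x :
  mform (act g T) x = mform T (fun k i => \sum_j invmx g i j * x k j).
Proof.
rewrite /mform /act.
under eq_bigr => j _ do rewrite mulr_suml.
rewrite exchange_big /=; apply: eq_bigr => j _.
rewrite bigA_distr_bigA mulr_sumr; apply: eq_bigr => i _.
by rewrite mulrAC mulrC big_split.
Qed.

Lemma reindex_perm n (s : 'S_n) (F : {ffun 'I_n -> 'I_3} -> R) :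
  \sum_j F j = \sum_(j : {ffun 'I_n -> 'I_3}) F [ffun m => j (s m)].
Proof.
rewrite (reindex (fun j : {ffun 'I_n -> 'I_3} => [ffun m => j (s m)] : {ffun 'I_n -> 'I_3})) //.
exists (fun j : {ffun 'I_n -> 'I_3} => [ffun m => j (s^-1 m)%g]) => j _;
  by apply/ffunP => m; rewrite !ffunE ?permK ?permKV.
Qed.

Lemma mform_symmetrize n (T : tensor R n) x :
  mform (symmetrize T) x = n`!%:R^-1 * \sum_(s : 'S_n) mform T (fun k => x (s k)).
Proof.
rewrite /mform /symmetrize.
under eq_bigr => j _ do rewrite -mulrA mulr_suml.
rewrite -mulr_sumr exchange_big /=; congr (_ * _).
apply: eq_bigr => s _.
rewrite [LHS](reindex_perm s^-1%g); apply: eq_bigr => j _.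
congr (_ * _).
  by congr (T _); apply/ffunP => m; rewrite !ffunE permK.
rewrite (reindex_inj (@perm_inj _ s)) /=; apply: eq_bigr => k _.
by rewrite ffunE permK.
Qed.

Definition form n (T : tensor R n) (x : 'I_3 -> R) : R := mform T (fun _ => x).

Lemma form_symmetrize n (T : tensor R n) x : form (symmetrize T) x = form T x.
Proof.
rewrite /form mform_symmetrize sumr_const card_Sn -[X in _ * X]mulr_natl mulrA.
by rewrite mulVf ?mul1r // pnatr_eq0 -lt0n fact_gt0.
Qed.


(** The sum over [A] factors over the points [i]: a value of [f] must belong to [A] and contributes
    1, a point outside the range contributes 1 - 1 = 0. Only the surjective, hence bijective, [f]
    survive. *)
Lemma sum_sign_cover n (f : {ffun 'I_n -> 'I_n}) :
  \sum_(A : {set 'I_n}) (\prod_i (if i \in A then 1 else -1)) *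
     \prod_k (f k \in A)%:R = (injectiveb f)%:R :> R.
Proof.
have coverE (A : {set 'I_n}) : \prod_k (f k \in A)%:R =
    \prod_i (if i \in A then 1 else (i \notin codom f)%:R) :> R.
  have [/forallP fA|/forallPn[k fkA]] := boolP [forall k, f k \in A].
    rewrite !big1 // => i _; last by rewrite fA.
    case: ifP => // /negbT iA; case: codomP => // -[k ik].
    by rewrite ik fA in iA.
  rewrite (bigD1 k) //= (negbTE fkA) mul0r (bigD1 (f k)) //= (negbTE fkA).
  by rewrite codom_f mul0r.
under eq_bigr => A _ do rewrite coverE -big_split /=.
transitivity (\prod_(i < n) (1 + - (i \notin codom f)%:R) : R).
  rewrite bigA_distr; apply: eq_bigr => A _; apply: eq_bigr => i _.
  by case: ifP; rewrite ?mulr1 ?mulN1r.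
have [/injectiveP injf|/injectivePn[i [j ij fij]]] := boolP (injectiveb f).
  rewrite big1 // => i _; rewrite (_ : i \in codom f) ?subr0 //.
  by rewrite inj_card_onto.
have [k kf] : exists k, k \notin codom f.
  apply/existsP; rewrite -negb_forall; apply: contra ij => /forallP allf.
  have /image_injP injf : #|codom f| == #|'I_n|.
    by apply/eqP/eq_card => k; rewrite allf.
  by rewrite (injf i j).
by rewrite (bigD1 k) //= kf subrr mul0r.
Qed.

(* Inclusion-exclusion over the sets A of slots: the alternating sum over A keeps
   only the slot maps f that are onto, i.e. the permutations. *)
Lemma polarization n (T : tensor R n) (idx : {ffun 'I_n -> 'I_3}) :
  \sum_(s : 'S_n) T [ffun m => idx (s m)] =
  \sum_(A : {set 'I_n}) (\prod_i (if i \in A then 1 else -1)) *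
     form T (fun i => \sum_m (m \in A)%:R * (idx m == i)%:R).
Proof.
have formA (A : {set 'I_n}) :
    form T (fun i => \sum_m (m \in A)%:R * (idx m == i)%:R) =
    \sum_(f : {ffun 'I_n -> 'I_n}) (\prod_k (f k \in A)%:R) * T [ffun m => idx (f m)].
  rewrite /form /mform.
  under eq_bigr => j _ do rewrite bigA_distr_bigA mulr_sumr.
  rewrite exchange_big /=; apply: eq_bigr => f _.
  rewrite (bigD1 [ffun m => idx (f m)]) //= [X in _ + X]big1 ?addr0 => [|j jf].
    rewrite big_split /= mulrC; congr (_ * _).
    by rewrite [X in _ * X]big1 ?mulr1 // => k _; rewrite ffunE eqxx.
  have [k kj] : exists k, idx (f k) != j k.
    apply/existsP; rewrite -negb_forall; apply: contra jf => /forallP jf.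
    by apply/eqP/ffunP => k; rewrite ffunE (eqP (jf k)).
  by rewrite (bigD1 k) //= (negbTE kj) mulr0 mul0r mulr0.
under [RHS]eq_bigr => A _ do rewrite formA mulr_sumr.
rewrite exchange_big /=.
under [RHS]eq_bigr => f _.
  under eq_bigr => A _ do rewrite mulrA.
  rewrite -mulr_suml sum_sign_cover; over.
rewrite [RHS](bigID (fun f : {ffun 'I_n -> 'I_n} => injectiveb f)) /= [RHS]addrC.
rewrite [X in _ = X + _]big1 ?add0r => [|f Uf];
  last by rewrite (negbTE Uf) mul0r.
rewrite [RHS](reindex (@pval _)) /=; last first.
  pose in_Sn := insubd (1%g : 'S_n).
  by exists in_Sn => /= f Uf; first apply: val_inj; apply: insubdK.
apply: eq_big => /= [s | s _]; rewrite ?(valP s) // mul1r.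
by congr (T _); apply/ffunP => m; rewrite !ffunE pvalE.
Qed.

(** By polarization a symmetrization is determined by its values at equal arguments, so the
    vanishing of a cross product becomes a polynomial identity in one vector. *)
Lemma form0_symmetrize n (T : tensor R n) :
  (forall x, form T x = 0) -> symmetrize T = tzero R n.
Proof.
move=> T0; apply: funext => idx; rewrite /symmetrize polarization big1 ?mulr0 //.
by move=> A _; rewrite T0 mulr0.
Qed.

Lemma symmetrize_sym n (T : tensor R n) : totally_symmetric T -> symmetrize T = T.
Proof.
move=> symT; apply: funext => idx; rewrite /symmetrize.
rewrite (eq_bigr (fun _ => T idx)) => [|s _]; last exact: symT.
rewrite sumr_const card_Sn -[X in _ * X]mulr_natl mulrA mulVf ?mul1r //.
by rewrite pnatr_eq0 -lt0n fact_gt0.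
Qed.

Lemma form_inj n (T U : tensor R n) : totally_symmetric T -> totally_symmetric U ->
  (forall x, form T x = form U x) -> T = U.
Proof.
move=> symT symU TU; rewrite -(symmetrize_sym symT) -(symmetrize_sym symU).
have: symmetrize (fun j => T j - U j) = tzero R n.
  apply: form0_symmetrize => x; have := TU x; rewrite /form /mform => TUx.
  by under eq_bigr => j _ do rewrite mulrBl; rewrite sumrB TUx subrr.
move/(congr1 (fun V : tensor R n => V)) => /funeqP eqTU.
apply: funext => idx; have := eqTU idx; rewrite /symmetrize /tzero sumrB mulrBr.
by move/eqP; rewrite subr_eq0 => /eqP.
Qed.

Lemma act_sym n g (T : tensor R n) : totally_symmetric T -> totally_symmetric (act g T).
Proof.
move=> symT s idx; rewrite /act (reindex_perm s); apply: eq_bigr => j _.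
rewrite symT; congr (_ * _); rewrite [RHS](reindex_inj (@perm_inj _ s)) /=.
by apply: eq_bigr => k _; rewrite !ffunE.
Qed.

Lemma perm_eq_tensor n (T : tensor R n) (i j : {ffun 'I_n -> 'I_3}) :
  totally_symmetric T -> perm_eq (codom i) (codom j) -> T i = T j.
Proof.
move=> symT eqij.
have cE (k : {ffun 'I_n -> 'I_3}) : codom k = [tuple k m | m < n].
  by rewrite codomE; apply: eq_map.
move: eqij; rewrite !cE => /tuple_permP[s es].
rewrite -(symT s j); congr (T _); apply/ffunP => m; rewrite ffunE.
have := congr1 (fun u => nth (i m) u m) es.
by rewrite /= !nth_mktuple tnth_mktuple.
Qed.

End MultilinearForms.

(** * Components in low orders and the nine parameters of a harmonic quartic *)

Section Components.
Variable R : realType.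
Implicit Types (g : 'M[R]_3) (H T : tensor R 4).

Lemma sum_ffunS n (F : {ffun 'I_n.+1 -> 'I_3} -> R) :
  \sum_j F j = \sum_(i < 3) \sum_(j : {ffun 'I_n -> 'I_3})
     F [ffun m => oapp j i (unlift ord0 m)].
Proof.
rewrite pair_bigA /= (reindex (fun p : 'I_3 * {ffun 'I_n -> 'I_3} =>
  [ffun m => oapp p.2 p.1 (unlift ord0 m)] : {ffun 'I_n.+1 -> 'I_3})) //.
exists (fun j : {ffun 'I_n.+1 -> 'I_3} =>
          (j ord0, [ffun m => j (lift ord0 m)])) => [[i j] _|j _] /=.
  congr pair; first by rewrite ffunE unlift_none.
  by apply/ffunP => m; rewrite !ffunE liftK.
by apply/ffunP => m; rewrite ffunE; case: unliftP => [m' ->|->] //=; rewrite ffunE.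
Qed.

Lemma sum_ffun0 (F : {ffun 'I_0 -> 'I_3} -> R) (j0 : {ffun 'I_0 -> 'I_3}) :
  \sum_j F j = F j0.
Proof.
rewrite (bigD1 j0) //= big1 ?addr0 // => j /eqP []; apply/ffunP => -[m Hm].
by have := Hm; rewrite ltn0.
Qed.

Definition idx2 (i j : 'I_3) : {ffun 'I_2 -> 'I_3} :=
  [ffun m : 'I_2 => match nat_of_ord m with 0 => i | _ => j end].
Definition idx3 (i j k : 'I_3) : {ffun 'I_3 -> 'I_3} :=
  [ffun m : 'I_3 => match nat_of_ord m with 0 => i | 1 => j | _ => k end].
Definition idx5 (i j k l m : 'I_3) : {ffun 'I_5 -> 'I_3} :=
  [ffun r : 'I_5 => match nat_of_ord r with
     0 => i | 1 => j | 2 => k | 3 => l | _ => m end].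


Lemma sum_ffun2 (F : {ffun 'I_2 -> 'I_3} -> R) :
  \sum_j F j = \sum_a \sum_b F (idx2 a b).
Proof.
rewrite sum_ffunS; apply: eq_bigr => a _; rewrite sum_ffunS; apply: eq_bigr => b _.
rewrite (sum_ffun0 _ [ffun=> ord0]); congr F; apply/ffunP => -[[|[|//]] Hm];
  rewrite !ffunE; case: unliftP => [m|] /(congr1 val) //= em; rewrite ffunE.
by case: unliftP => [[]|].
Qed.

Lemma sum_ffun3 (F : {ffun 'I_3 -> 'I_3} -> R) :
  \sum_j F j = \sum_a \sum_b \sum_c F (idx3 a b c).
Proof.
rewrite sum_ffunS; apply: eq_bigr => a _; rewrite sum_ffun2.
apply: eq_bigr => b _; apply: eq_bigr => c _; congr F.
apply/ffunP => -[[|[|[|//]]] Hm];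
  rewrite !ffunE; case: unliftP => [m|] /(congr1 val) //= em;
  by rewrite ffunE; move: em; rewrite /bump add1n => -[<-].
Qed.

Lemma sum_ffun4 (F : {ffun 'I_4 -> 'I_3} -> R) :
  \sum_j F j = \sum_a \sum_b \sum_c \sum_d F (idx4 a b c d).
Proof.
rewrite sum_ffunS; apply: eq_bigr => a _; rewrite sum_ffun3.
apply: eq_bigr => b _; apply: eq_bigr => c _; apply: eq_bigr => d _; congr F.
apply/ffunP => -[[|[|[|[|//]]]] Hm];
  rewrite !ffunE; case: unliftP => [m|] /(congr1 val) //= em;
  by rewrite ffunE; move: em; rewrite /bump add1n => -[<-].
Qed.

Lemma sum_ffun5 (F : {ffun 'I_5 -> 'I_3} -> R) :
  \sum_j F j = \sum_a \sum_b \sum_c \sum_d \sum_e F (idx5 a b c d e).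
Proof.
rewrite sum_ffunS; apply: eq_bigr => a _; rewrite sum_ffun4.
apply: eq_bigr => b _; apply: eq_bigr => c _; apply: eq_bigr => d _.
apply: eq_bigr => e _; congr F.
apply/ffunP => -[[|[|[|[|[|//]]]]] Hm];
  rewrite !ffunE; case: unliftP => [m|] /(congr1 val) //= em;
  by rewrite ffunE; move: em; rewrite /bump add1n => -[<-].
Qed.

Lemma tensor4P (T U : tensor R 4) :
  (forall i j k l, get4 T i j k l = get4 U i j k l) -> T = U.
Proof.
move=> TU; apply: funext => idx.
rewrite (_ : idx = idx4 (idx (inord 0)) (idx (inord 1)) (idx (inord 2)) (idx (inord 3))).
  exact: TU.
apply/ffunP => -[[|[|[|[|//]]]] Hm]; rewrite ffunE /=;
  by congr (idx _); apply: val_inj; rewrite /= inordK.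
Qed.

Lemma get4_act g T i j k l : get4 (act g T) i j k l =
  \sum_a \sum_b \sum_c \sum_d
     (invmx g a i * invmx g b j * invmx g c k * invmx g d l) * get4 T a b c d.
Proof.
rewrite /get4 /act sum_ffun4; do 4 apply: eq_bigr => ? _.
by rewrite !big_ord_recr big_ord0 /= mul1r !ffunE.
Qed.

Lemma form4E T x : form T x =
  \sum_a \sum_b \sum_c \sum_d get4 T a b c d * (x a * x b * x c * x d).
Proof.
rewrite /form /mform sum_ffun4; do 4 apply: eq_bigr => ? _.
by rewrite !big_ord_recr big_ord0 /= mul1r !ffunE.
Qed.

Lemma get4_perm H (i j k l i' j' k' l' : 'I_3) : totally_symmetric H ->
  perm_eq [:: i; j; k; l] [:: i'; j'; k'; l'] -> get4 H i j k l = get4 H i' j' k' l'.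
Proof.
move=> symH eqs; apply: perm_eq_tensor => //.
have cE a b c d : codom (idx4 a b c d) = [:: a; b; c; d].
  by rewrite codomE enum_ordSl /= !enum_ordSl /= enum_ord0 /= !ffunE.
by rewrite !cE.
Qed.

(* A harmonic quartic has nine free components; the monomial of i, j, k, l is read off
   the weight 0, 1, 5 of the indices x, y, z. *)
Definition h9 (A B C X Y p q s t : R) (i j k l : 'I_3) : R :=
  let w (i : 'I_3) := match nat_of_ord i with 0 => 0 | 1 => 1 | _ => 5 end%N in
  match (w i + w j + w k + w l)%N with
  | 0 => B + C | 1 => X | 2 => - C | 3 => Y | 4 => A + C
  | 5 => p | 6 => s | 7 => q | 8 => t
  | 10 => - B | 11 => - (X + Y) | 12 => - A
  | 15 => - (p + q) | 16 => - (s + t) | _ => A + B end.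

Lemma trace4 H : ttr (n := 2) H = tzero R 2 <->
  forall k l, \sum_i get4 H i i k l = 0.
Proof.
have ttrE idx k l : idx = idx2 k l -> ttr (n := 2) H idx = \sum_i get4 H i i k l.
  move=> ->; apply: eq_bigr => i _; congr H; apply/ffunP => m; rewrite !ffunE.
  case: splitP => -[[|[|//]] Hr] em; rewrite ?ffunE em //=.
split=> [tr0 k l|tr0]; first by rewrite -(@ttrE (idx2 k l)) // tr0.
apply: funext => idx; rewrite (@ttrE _ (idx (inord 0)) (idx (inord 1))) ?tr0 //.
apply/ffunP => -[[|[|//]] Hm]; rewrite ffunE /=;
  by congr (idx _); apply: val_inj; rewrite /= inordK.
Qed.

(** Of the fifteen components of a totally symmetric quartic, the six trace equations [t00] to [t12]
    eliminate six. The parameters [A], [B], [C] are minus the components H_yyzz, H_xxzz, H_xxyy. *)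
Lemma harmonic_h9 H : in_H4 H -> get4 H =
  h9 (- get4 H o1 o1 o2 o2) (- get4 H o0 o0 o2 o2) (- get4 H o0 o0 o1 o1)
     (get4 H o0 o0 o0 o1) (get4 H o0 o1 o1 o1) (get4 H o0 o0 o0 o2)
     (get4 H o0 o1 o1 o2) (get4 H o0 o0 o1 o2) (get4 H o1 o1 o1 o2).
Proof.
move=> [symH /trace4 trH].
have P i j k l i' j' k' l' : perm_eq [:: i; j; k; l] [:: i'; j'; k'; l'] ->
    get4 H i j k l = get4 H i' j' k' l' by apply: get4_perm.
have t00 : get4 H o0 o0 o0 o0 = - get4 H o0 o0 o2 o2 - get4 H o0 o0 o1 o1.
  have := trH o0 o0; rewrite sum3 (P o1 o1 o0 o0 o0 o0 o1 o1) //.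
  by rewrite (P o2 o2 o0 o0 o0 o0 o2 o2) // => e; lra.
have t11 : get4 H o1 o1 o1 o1 = - get4 H o1 o1 o2 o2 - get4 H o0 o0 o1 o1.
  have := trH o1 o1; rewrite sum3 (P o2 o2 o1 o1 o1 o1 o2 o2) // => e; lra.
have t22 : get4 H o2 o2 o2 o2 = - get4 H o1 o1 o2 o2 - get4 H o0 o0 o2 o2.
  have := trH o2 o2; rewrite sum3 => e; lra.
have t01 : get4 H o0 o1 o2 o2 = - (get4 H o0 o0 o0 o1 + get4 H o0 o1 o1 o1).
  have := trH o0 o1; rewrite sum3 (P o1 o1 o0 o1 o0 o1 o1 o1) //.
  by rewrite (P o2 o2 o0 o1 o0 o1 o2 o2) // => e; lra.
have t02 : get4 H o0 o2 o2 o2 = - (get4 H o0 o0 o0 o2 + get4 H o0 o1 o1 o2).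
  have := trH o0 o2; rewrite sum3 (P o1 o1 o0 o2 o0 o1 o1 o2) //.
  by rewrite (P o2 o2 o0 o2 o0 o2 o2 o2) // => e; lra.
have t12 : get4 H o1 o2 o2 o2 = - (get4 H o0 o0 o1 o2 + get4 H o1 o1 o1 o2).
  have := trH o1 o2; rewrite sum3 (P o2 o2 o1 o2 o1 o2 o2 o2) // => e; lra.
apply: funext; apply: ord3P; apply: funext; apply: ord3P; apply: funext; apply: ord3P;
  apply: funext; apply: ord3P; rewrite /h9 /= ?opprK //;
  first [ by apply: P | by rewrite -t01; apply: P | by rewrite -t02; apply: P
        | by rewrite -t12; apply: P | by rewrite -?t00 -?t11 -?t22; apply: P ].
Qed.

Lemma harmonic_param H : in_H4 H ->
  exists A B C X Y p q s t, get4 H = h9 A B C X Y p q s t.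
Proof. by move=> hH; do 9 eexists; apply: harmonic_h9. Qed.

End Components.

(** * Rotations, and covariance of the contractions under a change of frame *)

Section Frames.
Variable R : realType.
Implicit Types (g h m : 'M[R]_3) (H T : tensor R 4).

Lemma rotation_mulVm g : rotation g -> g^T *m g = 1%:M.
Proof. by case. Qed.

Lemma rotation_mulmV g : rotation g -> g *m g^T = 1%:M.
Proof. by case=> /mulmx1C. Qed.

Lemma rotation_unit g : rotation g -> g \in unitmx.
Proof. by case=> _ dg; rewrite unitmxE dg unitr1. Qed.

Lemma rotation_inv g : rotation g -> invmx g = g^T.
Proof.
move=> rg; rewrite -[LHS]mul1mx -(rotation_mulVm rg) -mulmxA mulmxV ?mulmx1 //.
exact: rotation_unit.
Qed.

Lemma rotation1 : rotation (1%:M : 'M[R]_3).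
Proof. by split; rewrite ?trmx1 ?mulmx1 ?det1. Qed.

Lemma rotation_tr g : rotation g -> rotation g^T.
Proof. by move=> rg; split; rewrite ?trmxK ?det_tr ?rotation_mulmV //; case: rg. Qed.

Lemma rotation_mul g h : rotation g -> rotation h -> rotation (g *m h).
Proof.
move=> rg rh; split; last by rewrite det_mulmx; case: rg => _ ->; case: rh => _ ->; rewrite mulr1.
by rewrite trmx_mul -mulmxA (mulmxA g^T) rotation_mulVm // mul1mx rotation_mulVm.
Qed.

Lemma act_mul n g h (T : tensor R n) : rotation g -> rotation h ->
  act g (act h T) = act (g *m h) T.
Proof.
move=> rg rh; apply: funext => idx; rewrite /act.
under eq_bigr => j _ do rewrite mulr_sumr.
rewrite exchange_big /=; apply: eq_bigr => i _.
under eq_bigr => j _ do rewrite mulrA -big_split.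
rewrite -mulr_suml -(bigA_distr_bigA (fun k j => invmx g j (idx k) * invmx h (i k) j)).
congr (_ * _); apply: eq_bigr => k _.
rewrite (rotation_inv (rotation_mul rg rh)) trmx_mul mxE; apply: eq_bigr => j _.
by rewrite !rotation_inv // mulrC.
Qed.

Lemma act1 n (T : tensor R n) : act 1%:M T = T.
Proof.
apply: funext => idx; rewrite /act (bigD1 idx) //= [X in _ + X]big1 ?addr0.
  by rewrite big1 ?mul1r // => k _; rewrite invmx1 mxE eqxx.
move=> j jidx; have [k kj] : exists k, j k != idx k.
  apply/existsP; rewrite -negb_forall; apply: contra jidx => /forallP jidx.
  by apply/eqP/ffunP => k; rewrite (eqP (jidx k)).
by rewrite (bigD1 k) //= invmx1 mxE (negbTE kj) !mul0r.
Qed.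

Lemma act_conj_fix n g h (T : tensor R n) : rotation g -> rotation h ->
  act (h^T *m g *m h) (act h^T T) = act h^T T <-> act g T = T.
Proof.
move=> rg rh; have rt := rotation_tr rh.
rewrite act_mul //; last by do !apply: rotation_mul.
rewrite -mulmxA rotation_mulmV // mulmx1 -act_mul //; split=> [|->//].
move/(congr1 (act h)); by rewrite !(act_mul _ rh rt) rotation_mulmV // !act1.
Qed.

(** The matrix [m] in the orthonormal frame of the columns of [h]; a tensor [T] becomes [act h^T T]
    in that frame. *)
Definition frm h m : 'M[R]_3 := h^T *m m *m h.

Lemma frmK h m : rotation h -> frm h^T (frm h m) = m.
Proof.
move=> rh; rewrite /frm trmxK !mulmxA rotation_mulmV // mul1mx.
by rewrite -mulmxA rotation_mulmV // mulmx1.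
Qed.

Lemma frm_mul h m1 m2 : rotation h -> frm h (m1 *m m2) = frm h m1 *m frm h m2.
Proof.
move=> rh; rewrite /frm !mulmxA; congr (_ *m _); rewrite -!mulmxA; congr (_ *m (_ *m _)).
by rewrite mulmxA rotation_mulmV // mul1mx.
Qed.

Lemma frmD h m1 m2 : frm h (m1 + m2) = frm h m1 + frm h m2.
Proof. by rewrite /frm mulmxDr mulmxDl. Qed.

Lemma frmZ h c m : frm h (c *: m) = c *: frm h m.
Proof. by rewrite /frm -scalemxAr -scalemxAl. Qed.

Lemma frm1 h : rotation h -> frm h 1%:M = 1%:M.
Proof. by move=> rh; rewrite /frm mulmx1 rotation_mulVm. Qed.

Lemma frm_inj h : rotation h -> injective (frm h).
Proof. by move=> rh m1 m2 /(congr1 (frm h^T)); rewrite !frmK. Qed.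

Lemma frm_tr h m : (frm h m)^T = frm h m^T.
Proof. by rewrite /frm !trmx_mul trmxK mulmxA. Qed.

Lemma frm_trace h m : rotation h -> \tr (frm h m) = \tr m.
Proof. by move=> rh; rewrite /frm mxtrace_mulC mulmxA rotation_mulmV // mul1mx. Qed.

Lemma frm_comm h g m : rotation h ->
  (frm h g *m frm h m = frm h m *m frm h g) <-> (g *m m = m *m g).
Proof. by move=> rh; rewrite -!frm_mul //; split=> [/frm_inj->|->]. Qed.

Lemma frm_rotation h g : rotation h -> rotation g -> rotation (frm h g).
Proof. by move=> rh rg; do !apply: rotation_mul => //; apply: rotation_tr. Qed.

Lemma sym_traceless_frm h m : rotation h -> sym_traceless m -> sym_traceless (frm h m).
Proof. by move=> rh [sm tm]; split; rewrite ?frm_tr ?sm ?frm_trace. Qed.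

Lemma get4_frame h T i j k l : rotation h -> get4 (act h^T T) i j k l =
  \sum_a \sum_b \sum_c \sum_d (h a i * h b j * h c k * h d l) * get4 T a b c d.
Proof.
by move=> rh; rewrite get4_act (rotation_inv (rotation_tr rh)) trmxK.
Qed.

Definition slice T i j : 'M[R]_3 := \matrix_(k, l) get4 T i j k l.
Definition mdot m1 m2 : R := \tr (m1 *m m2^T).

Lemma mdotE m1 m2 : mdot m1 m2 = \sum_i \sum_j m1 i j * m2 i j.
Proof.
by apply: eq_bigr => i _; rewrite mxE; apply: eq_bigr => j _; rewrite mxE.
Qed.

Lemma mdot_frm h m1 m2 : rotation h -> mdot (frm h m1) (frm h m2) = mdot m1 m2.
Proof. by move=> rh; rewrite /mdot frm_tr -frm_mul // frm_trace. Qed.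

Lemma mdotDl m1 m2 m : mdot (m1 + m2) m = mdot m1 m + mdot m2 m.
Proof. by rewrite /mdot mulmxDl mxtraceD. Qed.

Lemma mdotZl c m1 m : mdot (c *: m1) m = c * mdot m1 m.
Proof. by rewrite /mdot -scalemxAl mxtraceZ. Qed.

Lemma mdot_suml (F : 'I_3 -> 'M[R]_3) m : mdot (\sum_i F i) m = \sum_i mdot (F i) m.
Proof. by rewrite !sum3 !mdotDl. Qed.

Lemma mdotC m1 m2 : mdot m1 m2 = mdot m2 m1.
Proof. by rewrite /mdot -mxtrace_tr trmx_mul trmxK. Qed.

Lemma slice_frame h T i j : rotation h -> slice (act h^T T) i j =
  \sum_a \sum_b (h a i * h b j) *: frm h (slice T a b).
Proof.
move=> rh; apply/matrixP => k l; rewrite mxE get4_frame // summxE.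
apply: eq_bigr => a _; rewrite summxE; apply: eq_bigr => b _.
rewrite !mxE mulr_sumr exchange_big /=; apply: eq_bigr => d _.
rewrite !mxE mulr_suml mulr_sumr; apply: eq_bigr => c _; rewrite !mxE; ring.
Qed.

Lemma contrE T m : contr T m = \matrix_(i, j) mdot (slice T i j) m.
Proof.
apply/matrixP => i j; rewrite !mxE mdotE.
by apply: eq_bigr => k _; apply: eq_bigr => l _; rewrite mxE.
Qed.

Lemma contr_frame h T m : rotation h ->
  contr (act h^T T) (frm h m) = frm h (contr T m).
Proof.
move=> rh; apply/matrixP => i j; rewrite !contrE mxE slice_frame // mdot_suml.
rewrite /frm mxE.
under [RHS]eq_bigr => l _ do rewrite mxE mulr_suml.
rewrite [RHS]exchange_big /=; apply: eq_bigr => a _; rewrite mdot_suml.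
apply: eq_bigr => b _; rewrite mdotZl -/(frm h m) mdot_frm // !mxE; ring.
Qed.

(** Total symmetry turns the contraction into the sum of the H_kiab H_kjab, a Gram form in which
    symmetry and covariance of [d2] are visible. *)
Lemma d2E T i j : totally_symmetric T ->
  d2 T i j = \sum_k mdot (slice T k i) (slice T k j).
Proof.
move=> sT; rewrite mxE; apply: eq_bigr => k _; rewrite mdotE /get4 /hmul /f4.
apply: eq_bigr => a _; apply: eq_bigr => b _; rewrite !ffunE !inordK //= !mxE.
congr (_ * _); apply: get4_perm => //.
by apply/seq.permP => c /=; lia.
Qed.

Lemma d2_frame h T : totally_symmetric T -> rotation h ->
  d2 (act h^T T) = frm h (d2 T).
Proof.
move=> sT rh; apply/matrixP => i j; rewrite d2E; last exact: act_sym.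
have mdot_suml' (F : 'I_3 -> 'M[R]_3) m : mdot m (\sum_i F i) = \sum_i mdot m (F i).
  by rewrite mdotC mdot_suml; apply: eq_bigr => k _; rewrite mdotC.
have hh a c : \sum_k h a k * h c k = (a == c)%:R.
  have /matrixP/(_ a c) := rotation_mulmV rh; rewrite !mxE => <-.
  by apply: eq_bigr => k _; rewrite mxE.
transitivity (\sum_k \sum_a \sum_b \sum_c \sum_d (h a k * h c k) *
   (h b i * h d j * mdot (slice T a b) (slice T c d))).
  apply: eq_bigr => k _; rewrite !slice_frame // mdot_suml; apply: eq_bigr => a _.
  rewrite mdot_suml; apply: eq_bigr => b _; rewrite mdot_suml'.
  apply: eq_bigr => c _; rewrite mdot_suml'; apply: eq_bigr => d _.
  by rewrite mdotZl mdotC mdotZl mdot_frm // mdotC; ring.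
rewrite exchange_big /=.
transitivity (\sum_a \sum_b \sum_d h b i * h d j * mdot (slice T a b) (slice T a d)).
  apply: eq_bigr => a _; rewrite exchange_big /=; apply: eq_bigr => b _.
  rewrite exchange_big /= (bigD1 a) //= [X in _ + X]big1 ?addr0 => [|c ca].
    rewrite exchange_big /=; apply: eq_bigr => d _.
    by rewrite -mulr_suml hh eqxx mul1r.
  rewrite exchange_big /= big1 // => d _.
  by rewrite -mulr_suml hh eq_sym (negbTE ca) mul0r.
rewrite /frm mxE.
under [RHS]eq_bigr => d _ do rewrite mxE mulr_suml.
rewrite [RHS]exchange_big [LHS]exchange_big /=; apply: eq_bigr => b _.
rewrite [LHS]exchange_big /=; apply: eq_bigr => d _.
by rewrite d2E // mulr_sumr mulr_suml; apply: eq_bigr => a _; rewrite [h^T _ _]mxE; ring.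
Qed.

Lemma in_H4_frame h T : rotation h -> in_H4 T -> in_H4 (act h^T T).
Proof.
move=> rh [sT /trace4 tT]; split; first exact: act_sym.
have hh a c : \sum_k h a k * h c k = (a == c)%:R.
  have /matrixP/(_ a c) := rotation_mulmV rh; rewrite !mxE => <-.
  by apply: eq_bigr => k _; rewrite mxE.
apply/trace4 => k l.
transitivity (\sum_c \sum_d h c k * h d l * \sum_a get4 T a a c d); last first.
  by rewrite big1 // => c _; rewrite big1 // => d _; rewrite tT mulr0.
transitivity (\sum_a \sum_b \sum_c \sum_d (\sum_i h a i * h b i) *
    (h c k * h d l * get4 T a b c d)).
  under eq_bigr => i _ do rewrite get4_frame //.
  rewrite exchange_big; apply: eq_bigr => a _ /=.
  rewrite exchange_big; apply: eq_bigr => b _ /=.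
  rewrite exchange_big; apply: eq_bigr => c _ /=.
  rewrite exchange_big; apply: eq_bigr => d _ /=.
  by rewrite mulr_suml; apply: eq_bigr => i _; ring.
under eq_bigr => a _ do under eq_bigr => b _ do
  under eq_bigr => c _ do under eq_bigr => d _ do rewrite hh.
by rewrite !sum3 /=; ring.
Qed.

End Frames.

(** * Families of symmetric matrices; [contr] and [d2] in the nine parameters *)

Section Families.
Variable R : realType.
Implicit Types (g h m a b : 'M[R]_3) (E H T : tensor R 4).

Lemma m2t_inj : injective (@m2t R).
Proof.
move=> m1 m2 /funeqP e; apply/matrixP => i j; have := e (idx2 i j).
by rewrite /m2t !ffunE !inordK.
Qed.

Lemma act_m2t g m : rotation g -> act g (m2t m) = m2t (frm g^T m).
Proof.
move=> rg; apply: funext => idx; rewrite /act sum_ffun2 /m2t /frm trmxK mxE.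
under [RHS]eq_bigr => l _ do rewrite mxE mulr_suml.
rewrite [RHS]exchange_big /=; apply: eq_bigr => a _; apply: eq_bigr => b _.
rewrite !big_ord_recr big_ord0 /= mul1r !ffunE !inordK //= rotation_inv // !mxE.
have -> : widen_ord (leqnSn 1) ord_max = inord 0 :> 'I_2.
  by apply: val_inj; rewrite /= inordK.
have -> : ord_max = inord 1 :> 'I_2 by apply: val_inj; rewrite /= inordK.
by rewrite mulrAC.
Qed.

Lemma frm_fix g m : rotation g -> frm g^T m = m <-> g *m m = m *m g.
Proof.
move=> rg; rewrite /frm trmxK; split=> [{2}<-|->].
  by rewrite -!mulmxA rotation_mulVm // mulmx1.
by rewrite -mulmxA rotation_mulmV // mulmx1.
Qed.

Lemma act_m2t_fix g m : rotation g -> act g (m2t m) = m2t m <-> g *m m = m *m g.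
Proof.
move=> rg; rewrite act_m2t // -frm_fix //.
by split=> [/m2t_inj|->].
Qed.

Definition symM (L : seq 'M[R]_3) g : Prop :=
  rotation g /\ forall m, List.In m L -> g *m m = m *m g.

Definition famM (L : seq 'M[R]_3) : Defs.family R := List.map (fun m => pk (m2t m)) L.

Lemma sym_group_famM L g : sym_group (famM L) g <-> symM L g.
Proof.
split=> -[rg fixL]; split=> // t.
  by move=> tL; apply/act_m2t_fix => //; apply: (fixL (pk (m2t t))); apply: (List.in_map (fun m => pk (m2t m))).
by move=> /List.in_map_iff[m [<- mL]]; apply/act_m2t_fix => //; apply: fixL.
Qed.

Definition Ltri H a b := [:: d2 H; a; b].
Definition Lo H a b := [:: d2 H; a; b; c3 H; c4 H; contr H a; contr H b;
   contr H (a *m a); contr H (b *m b)].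
Definition Lm H a b := Lo H a b ++ [:: contr H (symprod a b);
   contr H (symprod a (d2 H)); contr H (symprod b (d2 H))].

Lemma tripleE H a b : triple H a b = famM (Ltri H a b). Proof. by []. Qed.
Lemma FoE H a b : Fo H a b = famM (Lo H a b). Proof. by []. Qed.
Lemma FmE H a b : Fm H a b = famM (Lm H a b). Proof. by []. Qed.

Lemma contrD T m1 m2 : contr T (m1 + m2) = contr T m1 + contr T m2.
Proof. by apply/matrixP => i j; rewrite !contrE !mxE !(mdotC (slice _ _ _)) mdotDl. Qed.

Lemma contrZ T c m : contr T (c *: m) = c *: contr T m.
Proof. by apply/matrixP => i j; rewrite !contrE !mxE !(mdotC (slice _ _ _)) mdotZl. Qed.

Lemma contr_tr T m : totally_symmetric T -> (contr T m)^T = contr T m.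
Proof.
move=> sT; apply/matrixP => i j; rewrite !mxE; apply: eq_bigr => k _.
apply: eq_bigr => l _; congr (_ * _); apply: get4_perm => //.
by apply/seq.permP => c /=; lia.
Qed.

Lemma d2_tr T : totally_symmetric T -> (d2 T)^T = d2 T.
Proof.
move=> sT; apply/matrixP => i j; rewrite mxE !d2E //.
by apply: eq_bigr => k _; rewrite mdotC.
Qed.

Lemma tr_entry m i j : m^T = m -> m i j = m j i.
Proof. by move=> sm; rewrite -{1}sm mxE. Qed.

Lemma contr_h9 H A B C X Y p q s t m : get4 H = h9 A B C X Y p q s t -> m^T = m ->
  (contr H m o0 o0 = (B + C) * m o0 o0 - C * m o1 o1 - B * m o2 o2
      + 2 * (X * m o0 o1 + p * m o0 o2 + s * m o1 o2)) *
  (contr H m o1 o1 = - C * m o0 o0 + (A + C) * m o1 o1 - A * m o2 o2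
      + 2 * (Y * m o0 o1 + q * m o0 o2 + t * m o1 o2)) *
  (contr H m o2 o2 = - B * m o0 o0 - A * m o1 o1 + (A + B) * m o2 o2
      - 2 * ((X + Y) * m o0 o1 + (p + q) * m o0 o2 + (s + t) * m o1 o2)) *
  (contr H m o0 o1 = X * m o0 o0 + Y * m o1 o1 - (X + Y) * m o2 o2
      + 2 * (- C * m o0 o1 + s * m o0 o2 + q * m o1 o2)) *
  (contr H m o0 o2 = p * m o0 o0 + q * m o1 o1 - (p + q) * m o2 o2
      + 2 * (s * m o0 o1 - B * m o0 o2 - (X + Y) * m o1 o2)) *
  (contr H m o1 o2 = s * m o0 o0 + t * m o1 o1 - (s + t) * m o2 o2
      + 2 * (q * m o0 o1 - (X + Y) * m o0 o2 - A * m o1 o2)).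
Proof.
move=> hH sm; have e10 := tr_entry o1 o0 sm; have e20 := tr_entry o2 o0 sm.
have e21 := tr_entry o2 o1 sm.
by do !split; rewrite mxE !sum3 hH /h9 /= ?e10 ?e20 ?e21; ring.
Qed.

Lemma d2_h9 H A B C X Y p q s t : get4 H = h9 A B C X Y p q s t ->
  totally_symmetric H ->
  (d2 H o0 o0 = (B + C) ^+ 2 + Y ^+ 2 + (p + q) ^+ 2 + 6 * s ^+ 2 + 3 * (X ^+ 2
     + p ^+ 2 + C ^+ 2 + q ^+ 2 + B ^+ 2 + (X + Y) ^+ 2)) *
  (d2 H o1 o1 = X ^+ 2 + (A + C) ^+ 2 + (s + t) ^+ 2 + 6 * q ^+ 2 + 3 * (C ^+ 2
     + s ^+ 2 + Y ^+ 2 + t ^+ 2 + (X + Y) ^+ 2 + A ^+ 2)) *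
  (d2 H o2 o2 = p ^+ 2 + t ^+ 2 + (A + B) ^+ 2 + 6 * (X + Y) ^+ 2 + 3 * (s ^+ 2
     + B ^+ 2 + q ^+ 2 + A ^+ 2 + (p + q) ^+ 2 + (s + t) ^+ 2)) *
  (d2 H o0 o1 = (B + C) * X + Y * (A + C) + (p + q) * (s + t) + 6 * s * q
     + 3 * (p * s + q * t - C * (X + Y) + (A + B) * (X + Y))) *
  (d2 H o0 o2 = p * (C - A) + q * (2 * B - 4 * A - 3 * C) + 3 * t * X
     + Y * (4 * t - 3 * s)) *
  (d2 H o1 o2 = t * (C - B) + s * (2 * A - 4 * B - 3 * C) + 3 * p * Y
     + X * (4 * p - 3 * q)).
Proof.
by move=> hH sH; do !split; rewrite d2E // sum3 !mdotE !sum3 !mxE hH /h9 /=; ring.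
Qed.

Lemma quad_sum_delta (u v w z : 'I_3 -> R) m :
  (\sum_a \sum_b \sum_c \sum_d (u a * v b * w c * z d) * (delta a b * m c d) =
    (\sum_a u a * v a) * \sum_c \sum_d w c * m c d * z d) *
  (\sum_a \sum_b \sum_c \sum_d (u a * v b * w c * z d) * (delta c d * m a b) =
    (\sum_a w a * z a) * \sum_c \sum_d u c * m c d * v d) *
  (\sum_a \sum_b \sum_c \sum_d (u a * v b * w c * z d) * (delta a c * m b d) =
    (\sum_a u a * w a) * \sum_c \sum_d v c * m c d * z d) *
  (\sum_a \sum_b \sum_c \sum_d (u a * v b * w c * z d) * (delta b d * m a c) =
    (\sum_a v a * z a) * \sum_c \sum_d u c * m c d * w d) *
  (\sum_a \sum_b \sum_c \sum_d (u a * v b * w c * z d) * (delta a d * m b c) =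
    (\sum_a u a * z a) * \sum_c \sum_d v c * m c d * w d) *
  (\sum_a \sum_b \sum_c \sum_d (u a * v b * w c * z d) * (delta b c * m a d) =
    (\sum_a v a * w a) * \sum_c \sum_d u c * m c d * z d).
Proof. by do !split; rewrite !sum3 /delta /=; ring. Qed.

End Families.

(** * From the symmetries of [E] to those of [a], [b] and [H] *)

Section Elasticity.
Variable R : realType.
Implicit Types (g h m : 'M[R]_3) (E H T : tensor R 4).

(** The part of [E] other than [H]. The scalars [lam] and [mu] are absorbed as scalar matrices, so
    that only six terms of the shape delta times matrix remain. *)
Definition iso_dev (lam mu : R) (a b : 'M[R]_3) (i j k l : 'I_3) : R :=
  delta i j * (lam%:M + a) k l + delta k l * a i j
  + delta i k * (mu%:M + b) j l + delta j l * b i k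
  + delta i l * (mu%:M + b) j k + delta j k * b i l.

Lemma act_iso_dev g lam mu (a b : 'M[R]_3) i j k l : rotation g ->
  \sum_c \sum_d \sum_e \sum_f (g i c * g j d * g k e * g l f) *
    iso_dev lam mu a b c d e f =
  iso_dev lam mu (frm g^T a) (frm g^T b) i j k l.
Proof.
move=> rg.
have gg x y : \sum_z g x z * g y z = delta x y.
  have /matrixP/(_ x y) := rotation_mulmV rg; rewrite !mxE /delta => <-.
  by apply: eq_bigr => z _; rewrite mxE.
have frmE m x y : \sum_z \sum_w g x z * m z w * g y w = frm g^T m x y.
  rewrite /frm trmxK mxE exchange_big; apply: eq_bigr => w _ /=.
  by rewrite mxE mulr_suml; apply: eq_bigr => z _; rewrite !mxE.
have scalE c m : c%:M + frm g^T m = frm g^T (c%:M + m).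
  by rewrite frmD -scalemx1 frmZ frm1 //; apply: rotation_tr.
rewrite /iso_dev !scalE -!frmE -!gg.
have qs := quad_sum_delta (g i) (g j) (g k) (g l).
rewrite -!qs.
rewrite -!big_split /=; apply: eq_bigr => c _; rewrite -!big_split /=.
apply: eq_bigr => d _; rewrite -!big_split /=; apply: eq_bigr => e _.
by rewrite -!big_split /=; apply: eq_bigr => f _; rewrite -!mulrDr.
Qed.

(** The two traces kill [G] and [G'] and leave 3a + 4b and 2a + 5b up to common scalar terms, a
    system of determinant 7. *)
Lemma iso_dev_inj lam mu (a b a' b' : 'M[R]_3) (G G' : 'I_3 -> 'I_3 -> 'I_3 -> 'I_3 -> R) :
  \tr a = 0 -> \tr b = 0 -> \tr a' = 0 -> \tr b' = 0 ->
  a^T = a -> b^T = b -> a'^T = a' -> b'^T = b' ->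
  (forall k l, \sum_i G i i k l = 0) -> (forall k l, \sum_i G' i i k l = 0) ->
  (forall k l, \sum_i G i k i l = 0) -> (forall k l, \sum_i G' i k i l = 0) ->
  (forall i j k l, iso_dev lam mu a b i j k l + G i j k l =
                   iso_dev lam mu a' b' i j k l + G' i j k l) ->
  a = a' /\ b = b'.
Proof.
rewrite /mxtrace !sum3 => ta tb ta' tb' sa sb sa' sb' G1 G1' G2 G2' eqs.
have ab k l : 3 * a k l + 4 * b k l = 3 * a' k l + 4 * b' k l /\
              2 * a k l + 5 * b k l = 2 * a' k l + 5 * b' k l.
  have s1 : \sum_i (iso_dev lam mu a b i i k l + G i i k l) =
            \sum_i (iso_dev lam mu a' b' i i k l + G' i i k l).
    by apply: eq_bigr => i _.
  have s2 : \sum_i (iso_dev lam mu a b i k i l + G i k i l) =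
            \sum_i (iso_dev lam mu a' b' i k i l + G' i k i l).
    by apply: eq_bigr => i _.
  move: s1 s2; rewrite !big_split /= !G1 !G1' !G2 !G2' !addr0 !sum3.
  rewrite /iso_dev /delta !mxE.
  have [[e10 e20 e21] [f10 f20 f21]] :
      [/\ b o1 o0 = b o0 o1, b o2 o0 = b o0 o2 & b o2 o1 = b o1 o2] /\
      [/\ b' o1 o0 = b' o0 o1, b' o2 o0 = b' o0 o2 & b' o2 o1 = b' o1 o2].
    by do !split; apply: tr_entry.
  have [[k10 k20 k21] [l10 l20 l21]] :
      [/\ a o1 o0 = a o0 o1, a o2 o0 = a o0 o2 & a o2 o1 = a o1 o2] /\
      [/\ a' o1 o0 = a' o0 o1, a' o2 o0 = a' o0 o2 & a' o2 o1 = a' o1 o2].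
    by do !split; apply: tr_entry.
  clear G G' eqs G1 G1' G2 G2' sa sb sa' sb'.
  move: k l; apply: ord3P; apply: ord3P; rewrite /= ?mulr1n ?mulr0n
    ?(mul0r, mul1r, add0r, addr0) ?(e10, e20, e21, f10, f20, f21)
    ?(k10, k20, k21, l10, l20, l21);
  clear e10 e20 e21 f10 f20 f21 k10 k20 k21 l10 l20 l21 => s1 s2; split; lra.
by split; apply/matrixP => i j; have [] := ab i j => ? ?; lra.
Qed.

(** Acting by [g] keeps [lam] and [mu] and transforms [a], [b], [H] separately, and the
    decomposition is unique by [iso_dev_inj]. *)
Lemma elasticity_sym g E H lam mu (a b : 'M[R]_3) : rotation g ->
  sym_traceless a -> sym_traceless b -> in_H4 H ->
  (forall i j k l, get4 E i j k l =
     lam * delta i j * delta k l + mu * (delta i k * delta j l + delta i l * delta j k)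
     + delta i j * a k l + delta k l * a i j
     + delta i k * b j l + delta j l * b i k + delta i l * b j k + delta j k * b i l
     + get4 H i j k l) ->
  act g E = E <-> [/\ g *m a = a *m g, g *m b = b *m g & act g H = H].
Proof.
move=> rg [sa ta] [sb tb] hH defE; have rt := rotation_tr rg.
have {}defE i j k l : get4 E i j k l = iso_dev lam mu a b i j k l + get4 H i j k l.
  by rewrite defE /iso_dev !mxE /delta -!(mulr_natr lam) -!(mulr_natr mu); ring.
have actE i j k l : get4 (act g E) i j k l =
    iso_dev lam mu (frm g^T a) (frm g^T b) i j k l + get4 (act g H) i j k l.
  rewrite -act_iso_dev // !get4_act (rotation_inv rg).
  rewrite -big_split /=; apply: eq_bigr => c _. rewrite -big_split /=.
  apply: eq_bigr => d _; rewrite -!big_split /=; apply: eq_bigr => e _.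
  rewrite -!big_split /=; apply: eq_bigr => f _.
  by rewrite defE !mxE mulrDr.
split=> [fixE|[ga gb gH]]; last first.
  by apply: tensor4P => i j k l; rewrite actE defE gH !(frm_fix _ rg).2.
have trs (U : tensor R 4) : in_H4 U -> (forall k l, \sum_i get4 U i i k l = 0) /\
                        (forall k l, \sum_i get4 U i k i l = 0).
  move=> [sU /trace4 tU]; split=> // k l; rewrite -[RHS](tU k l); apply: eq_bigr => i _.
  by apply: get4_perm => //; apply/seq.permP => c /=; lia.
have hH' : in_H4 (act g H) by have := in_H4_frame rt hH; rewrite trmxK.
have [t1 t2] := trs _ hH; have [t1' t2'] := trs _ hH'.
have [ea eb] : a = frm g^T a /\ b = frm g^T b.
  apply: (@iso_dev_inj lam mu _ _ _ _ (get4 H) (get4 (act g H)));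
    rewrite ?frm_trace ?frm_tr ?sa ?sb // => i j k l.
  by rewrite -actE -defE fixE.
split; rewrite -?frm_fix //.
apply: tensor4P => i j k l; have := actE i j k l.
by rewrite fixE defE -ea -eb => /addrI.
Qed.

End Elasticity.

(** * Algebraic estimates *)

Section Algebra.
Variable R : realType.

Lemma sum_sqr_eq0 (x y : R) : x ^+ 2 + y ^+ 2 = 0 -> x = 0 /\ y = 0.
Proof.
by move/eqP; rewrite paddr_eq0 ?sqr_ge0 // !expf_eq0 /= => /andP[/eqP-> /eqP->].
Qed.

(* The hypotheses express isotropy of d2 for a harmonic quartic without weight 4 about the
   z-axis, in terms of its (rescaled) weight 0, 1, 2, 3 parts c, (P, S), (v1, v2), (U, V):
   the last one makes (U, V) so large that the weight 1 and 2 parts must vanish. *)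
Lemma weights12_vanish (c P S v1 v2 U V : R) :
  4 * c * P + v1 * (5 * U - 9 * P) + v2 * (9 * S - 5 * V) = 0 ->
  4 * c * S + v1 * (5 * V + 9 * S) + v2 * (9 * P + 5 * U) = 0 ->
  3 * c * v1 + 10 * (P ^+ 2 - S ^+ 2) + 6 * (P * U + S * V) = 0 ->
  - 3 * c * v2 + 20 * P * S + 6 * (P * V - S * U) = 0 ->
  U ^+ 2 + V ^+ 2 = 2 * c ^+ 2 + 17 * (P ^+ 2 + S ^+ 2) + (v1 ^+ 2 + v2 ^+ 2) ->
  [/\ P = 0, S = 0, v1 = 0 & v2 = 0].
Proof.
move=> h1 h2 h3 h4 h0.
set x := P ^+ 2 + S ^+ 2 in h0; set y := v1 ^+ 2 + v2 ^+ 2 in h0.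
set z := U ^+ 2 + V ^+ 2 in h0.
have x0 : 0 <= x by rewrite addr_ge0 ?sqr_ge0.
have y0 : 0 <= y by rewrite addr_ge0 ?sqr_ge0.
have c0 : 0 <= c ^+ 2 by rewrite sqr_ge0.
have sq2 (f1 f2 g1 g2 : R) :
    (f1 + g1) ^+ 2 + (f2 + g2) ^+ 2 <= 2 * (f1 ^+ 2 + f2 ^+ 2) + 2 * (g1 ^+ 2 + g2 ^+ 2).
  rewrite -subr_ge0 (_ : _ - _ = (f1 - g1) ^+ 2 + (f2 - g2) ^+ 2); last by ring.
  by rewrite addr_ge0 ?sqr_ge0.
(* The first two hypotheses are the real and imaginary parts of one complex equation, the next two
   of another. In each, the product with (U, V) is isolated and the squared modulus of the rest is
   bounded by [sq2]. *)
have b1 : 25 * (y * z) <= 32 * (c ^+ 2 * x) + 162 * (x * y).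
  have := sq2 (- 4 * c * P) (- 4 * c * S) (9 * (v1 * P - v2 * S)) (- 9 * (v1 * S + v2 * P)).
  have -> : - 4 * c * P + 9 * (v1 * P - v2 * S) = 5 * (v1 * U - v2 * V) by lra.
  have -> : - 4 * c * S + - 9 * (v1 * S + v2 * P) = 5 * (v1 * V + v2 * U) by lra.
  by congr (_ <= _); rewrite /x /y /z; ring.
have b2 : 36 * (x * z) <= 18 * (c ^+ 2 * y) + 200 * x ^+ 2.
  have := sq2 (- 3 * c * v1) (3 * c * v2) (- 10 * (P ^+ 2 - S ^+ 2)) (- 20 * P * S).
  have -> : - 3 * c * v1 + - 10 * (P ^+ 2 - S ^+ 2) = 6 * (P * U + S * V) by lra.
  have -> : 3 * c * v2 + - 20 * P * S = 6 * (P * V - S * U) by lra.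
  by congr (_ <= _); rewrite /x /y /z; ring.
have xy0 := mulr_ge0 x0 y0; have cx0 := mulr_ge0 c0 x0; have cy0 := mulr_ge0 c0 y0.
have xx0 := mulr_ge0 x0 x0; have yy0 := mulr_ge0 y0 y0.
move: b1 b2; rewrite h0 -/x -/y.
have -> : y * (2 * c ^+ 2 + 17 * x + y) =
  2 * (c ^+ 2 * y) + 17 * (x * y) + y * y by ring.
have -> : x * (2 * c ^+ 2 + 17 * x + y) =
  2 * (c ^+ 2 * x) + 17 * (x * x) + x * y by ring.
rewrite (expr2 x) => b1 b2.
(* In the sum of [b1] and [b2], collected on the left, x^2, y^2, xy, c^2 x and c^2 y have the
   positive coefficients 412, 25, 299, 40 and 32. *)
have x2 : x * x = 0 by clear h1 h2 h3 h4 h0; lra.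
have y2 : y * y = 0 by clear h1 h2 h3 h4 h0; lra.
have /sum_sqr_eq0[-> ->] : x = 0 by apply/eqP; move/eqP: x2; rewrite mulf_eq0 orbb.
have /sum_sqr_eq0[-> ->] // : y = 0 by apply/eqP; move/eqP: y2; rewrite mulf_eq0 orbb.
Qed.

Section DistinctEigenvalues.
Variables (d1 d2 ka k l la nu : R).
Let d3 := - (d1 + d2).
Let e1 := d2 - d3.
Let e2 := d3 - d1.
Let e3 := d1 - d2.
Let n := d1 ^+ 2 + d2 ^+ 2 + d3 ^+ 2.
Let al := la - 3 * nu.
Let be d := 2 * al * d ^+ 2 + n * (8 * nu - la) / 2.
Let N := n * (d1 * d2 * d3) * al * (4 * la + 18 * nu)
  + ka ^+ 2 * d3 * (10 * n - 24 * d3 ^+ 2) + k ^+ 2 * d2 * (10 * n - 24 * d2 ^+ 2)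
  + l ^+ 2 * d1 * (10 * n - 24 * d1 ^+ 2).

(* Here d is the deviator of d2 H in an eigenframe and e the differences of its entries; if
   c3 H is affine in d2 H, then H_iijj = la d_i d_j + nu e_i e_j off the diagonal, and H_12ii,
   H_13ii, H_23ii are ka, k, l times e_i. The value of N is |d|^2. *)
Lemma eigen_norm0 : e1 != 0 -> e2 != 0 -> e3 != 0 ->
  l * be d1 = 2 * ka * k * e1 -> k * be d2 = 2 * ka * l * e2 ->
  ka * be d3 = 2 * k * l * e3 ->
  4 * (ka ^+ 2 + k ^+ 2 + l ^+ 2) = n * al * (la + 2 * nu) ->
  [/\ ka = 0, k = 0 & l = 0] \/ N = 0.
Proof.
move=> e1n e2n e3n h1 h2 h3 hS.
(* If one of [ka], [k], [l] vanishes, so does another, since each equation has two of them on its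
   right. A single nonzero one makes its value of [be] vanish, and [hS] turns [N] into a multiple of
   that value. *)
have [ka0|kan] := eqVneq ka 0.
  have [k0|kn] := eqVneq k 0.
    have [l0|ln] := eqVneq l 0; first by left.
    have b0 : be d1 = 0 by apply/(mulfI ln); rewrite h1 ka0; ring.
    right; rewrite (_ : N = - n * al * d1 * be d1); first by rewrite b0 mulr0.
    have -> : N = n * (d1 * d2 * d3) * al * (4 * la + 18 * nu)
      + (4 * (ka ^+ 2 + k ^+ 2 + l ^+ 2)) / 4 * d1 * (10 * n - 24 * d1 ^+ 2).
      by rewrite /N ka0 k0; field.
    by rewrite hS /be /al /n /d3; field.
  have l0 : l = 0.
    have /eqP := h3; rewrite ka0 mul0r eq_sym !mulf_eq0 pnatr_eq0 (negbTE kn) (negbTE e3n).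
    by rewrite /= orbF => /eqP.
  have b0 : be d2 = 0 by apply/(mulfI kn); rewrite h2 ka0; ring.
  right; rewrite (_ : N = - n * al * d2 * be d2); first by rewrite b0 mulr0.
  have -> : N = n * (d1 * d2 * d3) * al * (4 * la + 18 * nu)
    + (4 * (ka ^+ 2 + k ^+ 2 + l ^+ 2)) / 4 * d2 * (10 * n - 24 * d2 ^+ 2).
    by rewrite /N ka0 l0; field.
  by rewrite hS /be /al /n /d3; field.
have [k0|kn] := eqVneq k 0.
  have l0 : l = 0.
    have /eqP := h2; rewrite k0 mul0r eq_sym !mulf_eq0 pnatr_eq0 (negbTE kan) (negbTE e2n).
    by rewrite /= orbF => /eqP.
  have b0 : be d3 = 0 by apply/(mulfI kan); rewrite h3 k0; ring.
  right; rewrite (_ : N = - n * al * d3 * be d3); first by rewrite b0 mulr0.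
  have -> : N = n * (d1 * d2 * d3) * al * (4 * la + 18 * nu)
    + (4 * (ka ^+ 2 + k ^+ 2 + l ^+ 2)) / 4 * d3 * (10 * n - 24 * d3 ^+ 2).
    by rewrite /N k0 l0; field.
  by rewrite hS /be /al /n /d3; field.
have [l0|ln] := eqVneq l 0.
  have /eqP := h1; rewrite l0 mul0r eq_sym !mulf_eq0 pnatr_eq0 (negbTE kan) (negbTE e1n).
  by rewrite (negbTE kn).
right.
(* With none of them zero, multiplying the equations in pairs and cancelling expresses the three
   squares through [be]; substituted into 4 e1 e2 e3 N, they make it vanish identically. *)
have q12 : be d1 * be d2 = 4 * ka ^+ 2 * (e1 * e2).
  apply: (mulfI (mulf_neq0 kn ln)).
  by transitivity ((l * be d1) * (k * be d2)); [ring | rewrite h1 h2; ring].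
have q13 : be d1 * be d3 = 4 * k ^+ 2 * (e1 * e3).
  apply: (mulfI (mulf_neq0 kan ln)).
  by transitivity ((l * be d1) * (ka * be d3)); [ring | rewrite h1 h3; ring].
have q23 : be d2 * be d3 = 4 * l ^+ 2 * (e2 * e3).
  apply: (mulfI (mulf_neq0 kan kn)).
  by transitivity ((k * be d2) * (ka * be d3)); [ring | rewrite h2 h3; ring].
have en : 4 * e1 * e2 * e3 != 0 by rewrite !mulf_neq0 // pnatr_eq0.
apply: (mulfI en); rewrite mulr0.
have -> : 4 * e1 * e2 * e3 * N =
  4 * e1 * e2 * e3 * (n * (d1 * d2 * d3) * al * (4 * la + 18 * nu))
  + e3 * (4 * ka ^+ 2 * (e1 * e2)) * d3 * (10 * n - 24 * d3 ^+ 2)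
  + e2 * (4 * k ^+ 2 * (e1 * e3)) * d2 * (10 * n - 24 * d2 ^+ 2)
  + e1 * (4 * l ^+ 2 * (e2 * e3)) * d1 * (10 * n - 24 * d1 ^+ 2) by rewrite /N; ring.
by rewrite -q12 -q13 -q23 /be /al /n /e1 /e2 /e3 /d3; field.
Qed.

End DistinctEigenvalues.

End Algebra.

(** * The case of [d2 H] with distinct eigenvalues *)

Section DistinctEigenvaluesQuartic.
Variable R : realType.
Implicit Types (H : tensor R 4).

(** [d2 H] and [c3 H] are diagonal, and the product equation makes the diagonal of [c3 H] affine in
    that of [d2 H]. This yields the equations of [eigen_norm0], whose alternative N = 0 is
    impossible: N is the squared norm of the deviator of [d2 H], nonzero for distinct
    eigenvalues. *)
Lemma contr_coaxial_diag_odd0 H A B C X Y p q s t :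
  get4 H = h9 A B C X Y p q s t -> totally_symmetric H ->
  d2 H o0 o1 = 0 -> d2 H o0 o2 = 0 -> d2 H o1 o2 = 0 ->
  c3 H o0 o1 = 0 -> c3 H o0 o2 = 0 -> c3 H o1 o2 = 0 ->
  (c3 H o0 o0 - c3 H o2 o2) * (d2 H o1 o1 - d2 H o2 o2) =
  (c3 H o1 o1 - c3 H o2 o2) * (d2 H o0 o0 - d2 H o2 o2) ->
  d2 H o0 o0 != d2 H o1 o1 -> d2 H o0 o0 != d2 H o2 o2 -> d2 H o1 o1 != d2 H o2 o2 ->
  [/\ p = 0, q = 0, s = 0 & t = 0].
Proof.
move=> hH sH D01 D02 D12; rewrite /c3.
have hd := d2_h9 hH sH; have hc := contr_h9 hH (d2_tr sH).
rewrite !hc D01 D02 D12 {hc} => c01 c02 c12 cK n01 n02 n12.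
(* The deviator of [d2 H] is d = diag([d1], [e1], [f1]). *)
have [d1 d1E] : exists d1, d1 = (2 * d2 H o0 o0 - d2 H o1 o1 - d2 H o2 o2) / 3 by eexists.
have [e1 e1E] : exists e1, e1 = (2 * d2 H o1 o1 - d2 H o0 o0 - d2 H o2 o2) / 3 by eexists.
pose f1 := - (d1 + e1).
have uE : d2 H o0 o0 - d2 H o2 o2 = d1 - f1 by rewrite /f1 d1E e1E; field.
have vE : d2 H o1 o1 - d2 H o2 o2 = e1 - f1 by rewrite /f1 d1E e1E; field.
have un : d1 - f1 != 0 by rewrite -uE subr_eq0.
have vn : e1 - f1 != 0 by rewrite -vE subr_eq0.
have wn : d1 - e1 != 0.
  rewrite (_ : d1 - e1 = d2 H o0 o0 - d2 H o1 o1) ?subr_eq0 //.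
  by rewrite d1E e1E; field.
pose n := d1 ^+ 2 + e1 ^+ 2 + f1 ^+ 2.
have nn : n != 0.
  apply: contra un; rewrite /n => /eqP n0.
  have /sum_sqr_eq0[d0 e0] : d1 ^+ 2 + e1 ^+ 2 = 0.
    by have := sqr_ge0 f1; have := sqr_ge0 d1; have := sqr_ge0 e1; lra.
  by rewrite /f1 d0 e0; apply/eqP; ring.
have XY : X * (d1 - f1) + Y * (e1 - f1) = 0 by rewrite -uE -vE -c01; ring.
have pq : p * (d1 - f1) + q * (e1 - f1) = 0 by rewrite -uE -vE -c02; ring.
have st : s * (d1 - f1) + t * (e1 - f1) = 0 by rewrite -uE -vE -c12; ring.
have solve x y : x * (d1 - f1) + y * (e1 - f1) = 0 ->
    exists c, x = c * (e1 - f1) /\ y = c * (f1 - d1).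
  move=> xy; exists (x / (e1 - f1)); split; first by rewrite divfK.
  apply: (mulIf vn); rewrite mulrAC divfK //.
  have -> : y * (e1 - f1) = (x * (d1 - f1) + y * (e1 - f1)) - x * (d1 - f1) by ring.
  by rewrite xy; ring.
have [ka [XE YE]] := solve _ _ XY; have [k [pE qE]] := solve _ _ pq.
have [l [sE tE]] := solve _ _ st.
(* Let e = diag(e1 - f1, f1 - d1, d1 - e1), which is orthogonal to d. Through its diagonal entries,
   [contr H] is a symmetric endomorphism of the plane of traceless diagonal matrices. It has the
   eigenvector d, by [K0] below, hence also e; [la] and [nu] are the eigenvalues divided by |d|^2 =
   n and |e|^2 = 3n. *)
pose la := (C * (d1 - e1) ^+ 2 + B * (d1 - f1) ^+ 2 + A * (e1 - f1) ^+ 2) / n ^+ 2.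
pose nu := (C * f1 ^+ 2 + B * e1 ^+ 2 + A * d1 ^+ 2) / n ^+ 2.
have K0 : ((2 * B + C) * (d1 - f1) + (A - C) * (e1 - f1)) * (e1 - f1) -
          ((B - C) * (d1 - f1) + (2 * A + C) * (e1 - f1)) * (d1 - f1) = 0.
  by rewrite -uE -vE; apply/eqP; rewrite subr_eq0; apply/eqP; move: cK;
    congr (_ = _); ring.
have CE : C = - (la * d1 * e1 + nu * (e1 - f1) * (f1 - d1)).
  apply/eqP; rewrite -subr_eq0; apply/eqP; apply: (mulfI (mulf_neq0 nn nn)).
  rewrite mulr0 -[RHS](mulr0 (- (d1 * (f1 - d1) + e1 * (e1 - f1)) / 3)) -K0.
  by rewrite /la /nu; move: nn; rewrite /n /f1 => nn; field.
have BE : B = - (la * d1 * f1 + nu * (e1 - f1) * (d1 - e1)).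
  apply/eqP; rewrite -subr_eq0; apply/eqP; apply: (mulfI (mulf_neq0 nn nn)).
  rewrite mulr0 -[RHS](mulr0 (- (d1 * (d1 - e1) + f1 * (e1 - f1)) / 3)) -K0.
  by rewrite /la /nu; move: nn; rewrite /n /f1 => nn; field.
have AE : A = - (la * e1 * f1 + nu * (f1 - d1) * (d1 - e1)).
  apply/eqP; rewrite -subr_eq0; apply/eqP; apply: (mulfI (mulf_neq0 nn nn)).
  rewrite mulr0 -[RHS](mulr0 (- (e1 * (d1 - e1) + f1 * (f1 - d1)) / 3)) -K0.
  by rewrite /la /nu; move: nn; rewrite /n /f1 => nn; field.
clearbody la nu; clear K0 cK c01 c02 c12 XY pq st solve.
have gn : f1 - d1 != 0 by rewrite -opprB oppr_eq0.
have two : 2 != 0 :> R by rewrite pnatr_eq0.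
(* The vanishing off-diagonal entries of [d2 H] give [h1], [h2], [h3]. Its diagonal is d up to a
   scalar, so that pairing it with e gives [hS] and pairing it with d gives [hN]. *)
have h2 : k * (2 * (la - 3 * nu) * e1 ^+ 2 + n * (8 * nu - la) / 2) =
          2 * ka * l * (f1 - d1).
  apply: (mulfI (mulf_neq0 two gn)); apply/eqP; rewrite -subr_eq0 -oppr_eq0; apply/eqP.
  by rewrite -[RHS]D02 hd AE BE CE XE YE pE qE sE tE /n /f1; field.
have h1 : l * (2 * (la - 3 * nu) * d1 ^+ 2 + n * (8 * nu - la) / 2) =
          2 * ka * k * (e1 - f1).
  apply: (mulfI (mulf_neq0 two vn)); apply/eqP; rewrite -subr_eq0 -oppr_eq0; apply/eqP.
  by rewrite -[RHS]D12 hd AE BE CE XE YE pE qE sE tE /n /f1; field.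
have h3 : ka * (2 * (la - 3 * nu) * f1 ^+ 2 + n * (8 * nu - la) / 2) =
          2 * k * l * (d1 - e1).
  apply: (mulfI (mulf_neq0 two wn)); apply/eqP; rewrite -subr_eq0 -oppr_eq0; apply/eqP.
  by rewrite -[RHS]D01 hd AE BE CE XE YE pE qE sE tE /n /f1; field.
have hS : 4 * (ka ^+ 2 + k ^+ 2 + l ^+ 2) = n * (la - 3 * nu) * (la + 2 * nu).
  apply: (mulfI (mulf_neq0 two (mulf_neq0 (mulf_neq0 vn gn) wn))).
  apply/eqP; rewrite -subr_eq0; apply/eqP.
  transitivity ((e1 - f1) * (d2 H o0 o0 - d2 H o2 o2)
      + (f1 - d1) * (d2 H o1 o1 - d2 H o2 o2)); last by rewrite uE vE; ring.
  by rewrite !hd AE BE CE XE YE pE qE sE tE /n /f1; field.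
have hN : n * (d1 * e1 * f1) * (la - 3 * nu) * (4 * la + 18 * nu)
  + ka ^+ 2 * f1 * (10 * n - 24 * f1 ^+ 2) + k ^+ 2 * e1 * (10 * n - 24 * e1 ^+ 2)
  + l ^+ 2 * d1 * (10 * n - 24 * d1 ^+ 2) = n.
  transitivity (d1 * (d2 H o0 o0 - d2 H o2 o2) + e1 * (d2 H o1 o1 - d2 H o2 o2)).
    by rewrite !hd AE BE CE XE YE pE qE sE tE /n /f1; field.
  by rewrite uE vE /n /f1; ring.
have [[_ k0 l0]|N0] := eigen_norm0 vn gn wn h1 h2 h3 hS.
  by rewrite pE qE sE tE k0 l0 !mul0r.
by move: nn; rewrite -hN; move/eqP: N0 => ->.
Qed.

End DistinctEigenvaluesQuartic.

(** * Rotations and frames *)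

Section RotationFrames.
Variable R : realType.
Implicit Types (g h m : 'M[R]_3).

Lemma mx3P m1 m2 :
  m1 o0 o0 = m2 o0 o0 -> m1 o0 o1 = m2 o0 o1 -> m1 o0 o2 = m2 o0 o2 ->
  m1 o1 o0 = m2 o1 o0 -> m1 o1 o1 = m2 o1 o1 -> m1 o1 o2 = m2 o1 o2 ->
  m1 o2 o0 = m2 o2 o0 -> m1 o2 o1 = m2 o2 o1 -> m1 o2 o2 = m2 o2 o2 -> m1 = m2.
Proof. by move=> *; apply/matrixP; apply: ord3P; apply: ord3P. Qed.

Lemma symx3P m1 m2 : m1^T = m1 -> m2^T = m2 ->
  m1 o0 o0 = m2 o0 o0 -> m1 o1 o1 = m2 o1 o1 -> m1 o2 o2 = m2 o2 o2 ->
  m1 o0 o1 = m2 o0 o1 -> m1 o0 o2 = m2 o0 o2 -> m1 o1 o2 = m2 o1 o2 -> m1 = m2.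
Proof.
move=> s1 s2 *; apply: mx3P => //; rewrite (tr_entry _ _ s1) (tr_entry _ _ s2) //.
Qed.

Lemma mulmx3 m1 m2 i j :
  (m1 *m m2) i j = m1 i o0 * m2 o0 j + m1 i o1 * m2 o1 j + m1 i o2 * m2 o2 j.
Proof. by rewrite mxE sum3. Qed.

Lemma det33 m : \det m =
  m o0 o0 * (m o1 o1 * m o2 o2 - m o1 o2 * m o2 o1)
  - m o0 o1 * (m o1 o0 * m o2 o2 - m o1 o2 * m o2 o0)
  + m o0 o2 * (m o1 o0 * m o2 o1 - m o1 o1 * m o2 o0).
Proof.
rewrite (expand_det_row _ o0) sum3 /cofactor !(expand_det_row _ ord0).
rewrite !big_ord_recl !big_ord0 /cofactor !det_mx11 !mxE.
pose f (i j : nat) := m (inord i) (inord j).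
have mE i j : m i j = f i j by rewrite /f !inord_val.
by rewrite !mE /= /bump /= !(addn0, add0n); ring.
Qed.

Lemma rotationP g :
  g o0 o0 ^+ 2 + g o1 o0 ^+ 2 + g o2 o0 ^+ 2 = 1 ->
  g o0 o1 ^+ 2 + g o1 o1 ^+ 2 + g o2 o1 ^+ 2 = 1 ->
  g o0 o2 ^+ 2 + g o1 o2 ^+ 2 + g o2 o2 ^+ 2 = 1 ->
  g o0 o0 * g o0 o1 + g o1 o0 * g o1 o1 + g o2 o0 * g o2 o1 = 0 ->
  g o0 o0 * g o0 o2 + g o1 o0 * g o1 o2 + g o2 o0 * g o2 o2 = 0 ->
  g o0 o1 * g o0 o2 + g o1 o1 * g o1 o2 + g o2 o1 * g o2 o2 = 0 ->
  \det g = 1 -> rotation g.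
Proof.
move=> e00 e11 e22 e01 e02 e12 dg; split=> //.
by apply: mx3P; rewrite mulmx3 !mxE /= ?mulr1n ?mulr0n; lra.
Qed.

Lemma frame_uv (u v : 'I_3 -> R) :
  u o0 ^+ 2 + u o1 ^+ 2 + u o2 ^+ 2 = 1 -> v o0 ^+ 2 + v o1 ^+ 2 + v o2 ^+ 2 = 1 ->
  u o0 * v o0 + u o1 * v o1 + u o2 * v o2 = 0 ->
  exists2 h, rotation h & forall i, h i o0 = u i /\ h i o1 = v i.
Proof.
move=> uu vv uv.
pose w (i : 'I_3) := match nat_of_ord i with
  | 0 => u o1 * v o2 - u o2 * v o1 | 1 => u o2 * v o0 - u o0 * v o2
  | _ => u o0 * v o1 - u o1 * v o0 end.
pose h : 'M[R]_3 := \matrix_(i, j)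
  match nat_of_ord j with 0 => u i | 1 => v i | _ => w i end.
have ww : w o0 ^+ 2 + w o1 ^+ 2 + w o2 ^+ 2 = 1.
  transitivity ((u o0 ^+ 2 + u o1 ^+ 2 + u o2 ^+ 2) * (v o0 ^+ 2 + v o1 ^+ 2 + v o2 ^+ 2)
    - (u o0 * v o0 + u o1 * v o1 + u o2 * v o2) ^+ 2); first by rewrite /w /=; ring.
  by rewrite uu vv uv expr0n /= subr0 mulr1.
exists h; last by move=> i; rewrite !mxE.
apply: rotationP; rewrite ?det33 !mxE /= //; rewrite /w /=; try ring.
by rewrite -ww /w /=; ring.
Qed.

Lemma frame_axis (n : 'I_3 -> R) : n o0 ^+ 2 + n o1 ^+ 2 + n o2 ^+ 2 = 1 ->
  exists2 h, rotation h & forall i, h i o2 = n i.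
Proof.
move=> nn; pose r2 := n o0 ^+ 2 + n o1 ^+ 2.
have [r0|rn] := eqVneq r2 0.
  have [n0 n1] := sum_sqr_eq0 r0; have n2 : n o2 ^+ 2 = 1 by rewrite -nn n0 n1; ring.
  exists (\matrix_(i, j) match nat_of_ord i, nat_of_ord j with
     0, 0 => 1 | 1, 1 => n o2 | 2, 2 => n o2 | _, _ => 0 end); last first.
    by apply: ord3P; rewrite mxE /= ?n0 ?n1.
  by apply: rotationP; rewrite ?det33 !mxE /=; lra.
pose r := Num.sqrt r2.
have r2E : r ^+ 2 = r2 by rewrite sqr_sqrtr // addr_ge0 ?sqr_ge0.
have r0 : r != 0 by move: rn; rewrite -r2E expf_eq0.
(* The first column is a horizontal unit vector orthogonal to [n], the second is the cross product
   of [n] with the first. *)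
exists (\matrix_(i, j) match nat_of_ord i, nat_of_ord j with
   0, 0 => - n o1 / r | 1, 0 => n o0 / r | 2, 0 => 0
 | 0, 1 => - n o2 * n o0 / r | 1, 1 => - n o2 * n o1 / r | 2, 1 => r
 | 0, _ => n o0 | 1, _ => n o1 | _, _ => n o2 end); last by apply: ord3P; rewrite mxE.
have n2 : n o2 ^+ 2 = 1 - r ^+ 2 by rewrite r2E /r2 -nn; ring.
have n1 : n o1 ^+ 2 = r ^+ 2 - n o0 ^+ 2 by rewrite r2E /r2; ring.
apply: rotationP; rewrite ?det33 !mxE /= //.
- transitivity ((n o0 ^+ 2 + n o1 ^+ 2) / r ^+ 2); first by field.
  by rewrite -/r2 r2E divff.
- transitivity (n o2 ^+ 2 * (n o0 ^+ 2 + n o1 ^+ 2) / r ^+ 2 + r ^+ 2); first by field.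
  by rewrite -/r2 r2E mulfK // n2 r2E; ring.
- by field.
- by field.
- transitivity (n o2 * (r ^+ 2 - (n o0 ^+ 2 + n o1 ^+ 2)) / r); first by field.
  by rewrite -/r2 r2E subrr mulr0 mul0r.
transitivity ((n o0 ^+ 2 + n o1 ^+ 2) / r ^+ 2 *
    (r ^+ 2 + n o2 ^+ 2)); last by rewrite -/r2 r2E divff // mul1r n2 r2E; ring.
by field.
Qed.

(** [rotz] with cosine and sine as free variables, which keeps all computations polynomial. *)
Definition rzm (c s : R) : 'M[R]_3 := \matrix_(i, j)
  match nat_of_ord i, nat_of_ord j with
  | 0, 0 => c | 0, 1 => - s | 1, 0 => s | 1, 1 => c
  | 2, 2 => 1 | _, _ => 0 end.

Definition diag3 (x y z : R) : 'M[R]_3 := \matrix_(i, j)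
  match nat_of_ord i, nat_of_ord j with
  | 0, 0 => x | 1, 1 => y | 2, 2 => z | _, _ => 0 end.

Lemma rzm_rotation c s : c ^+ 2 + s ^+ 2 = 1 -> rotation (rzm c s).
Proof. by move=> cs; apply: rotationP; rewrite ?det33 !mxE /=; lra. Qed.

Lemma diag3_rotation x y z : x ^+ 2 = 1 -> y ^+ 2 = 1 -> z ^+ 2 = 1 ->
  x * y * z = 1 -> rotation (diag3 x y z).
Proof.
move=> x2 y2 z2 xyz; apply: rotationP; rewrite ?det33 !mxE /=;
  rewrite ?(mulr0, mul0r, expr0n, addr0, add0r, subr0) //=; last by rewrite -xyz; ring.
Qed.

(** The z-axis is preserved, so the entry zz is 1 or -1; the sign -1 is corrected by the half-turn
    about x. *)
Lemma rotation_axis_z g : rotation g -> g o0 o2 = 0 -> g o1 o2 = 0 ->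
  exists c s, c ^+ 2 + s ^+ 2 = 1 /\
    (g = rzm c s \/ g = rzm c s *m diag3 1 (-1) (-1)).
Proof.
move=> rg g02 g12; have dg : \det g = 1 by case: rg.
have /matrixP cols := rotation_mulVm rg; have /matrixP rows := rotation_mulmV rg.
have := cols o2 o2; rewrite mulmx3 !mxE g02 g12 !mul0r !add0r /= mulr1n => g22.
have := cols o0 o2; rewrite mulmx3 !mxE g02 g12 !mulr0 !add0r /= mulr0n => g20.
have := cols o1 o2; rewrite mulmx3 !mxE g02 g12 !mulr0 !add0r /= mulr0n => g21.
have gn : g o2 o2 != 0.
  by apply/negP => /eqP g0; move: g22; rewrite g0 mul0r => /eqP; rewrite eq_sym oner_eq0.
move/eqP: g20; rewrite mulf_eq0 (negbTE gn) orbF => /eqP g20.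
move/eqP: g21; rewrite mulf_eq0 (negbTE gn) orbF => /eqP g21.
have := cols o0 o0; rewrite mulmx3 !mxE g20 !mulr0 !addr0 /= mulr1n => c00.
have := cols o0 o1; rewrite mulmx3 !mxE g20 !mul0r !addr0 /= mulr0n => c01.
have := cols o1 o1; rewrite mulmx3 !mxE g21 !mulr0 !addr0 /= mulr1n => c11.
move: dg; rewrite det33 g02 g12 g20 g21 => dg.
have d2 : (g o0 o0 * g o1 o1 - g o0 o1 * g o1 o0) * g o2 o2 = 1 by rewrite -dg; ring.
exists (g o0 o0), (g o1 o0); split; first by rewrite !expr2.
have g11 : g o1 o1 = g o0 o0 * (g o0 o0 * g o1 o1 - g o0 o1 * g o1 o0).
  transitivity ((g o0 o0 * g o0 o0 + g o1 o0 * g o1 o0) * g o1 o1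
    - g o1 o0 * (g o0 o0 * g o0 o1 + g o1 o0 * g o1 o1)); last by ring.
  by rewrite c00 c01; ring.
have g01 : g o0 o1 = - g o1 o0 * (g o0 o0 * g o1 o1 - g o0 o1 * g o1 o0).
  transitivity ((g o0 o0 * g o0 o0 + g o1 o0 * g o1 o0) * g o0 o1
    - g o0 o0 * (g o0 o0 * g o0 o1 + g o1 o0 * g o1 o1)); last by ring.
  by rewrite c00 c01; ring.
move/eqP: g22; rewrite -expr2 sqrf_eq1 => /orP[] /eqP g22; move: d2; rewrite g22 => d2.
  have {}d2 : g o0 o0 * g o1 o1 - g o0 o1 * g o1 o0 = 1 by rewrite -d2 mulr1.
  left; rewrite d2 in g11 g01.
  by apply: mx3P; rewrite !mxE /= ?g02 ?g12 ?g20 ?g21 ?g22 ?g11 ?g01 ?mulr1.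
have {}d2 : g o0 o0 * g o1 o1 - g o0 o1 * g o1 o0 = -1 by rewrite -d2; ring.
right; rewrite d2 in g11 g01.
by apply: mx3P; rewrite mulmx3 !mxE /= ?g02 ?g12 ?g20 ?g21 ?g22 ?g11 ?g01; ring.
Qed.

(** Euler's theorem: g^T - 1 = - g^T (g - 1) and the dimension is odd, so det (g - 1) is its own
    opposite. A fixed unit vector becomes the third column of the frame. *)
Lemma rotation_axis g : rotation g -> g <> 1%:M ->
  exists h c s, [/\ rotation h, c ^+ 2 + s ^+ 2 = 1 & frm h g = rzm c s].
Proof.
move=> rg g1.
have : \det (g^T - 1%:M) = 0.
  have e : g^T - 1%:M = - (g^T *m (g - 1%:M)).
    by rewrite mulmxBr mulmx1 rotation_mulVm // opprB.
  have e2 : \det (g^T - 1%:M) = - \det (g - 1%:M).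
    rewrite e -[- _]scaleN1r detZ det_mulmx det_tr.
    by case: rg => _ ->; ring.
  move: e2; rewrite -(det_tr (g - 1%:M)) linearB /= trmx1 => e2.
  by lra.
move/eqP/det0P=> [n0 n0n n0g].
have gn i : \sum_j g i j * n0 0 j = n0 0 i.
  have /matrixP/(_ 0 i) : n0 *m g^T = n0.
    by apply/eqP; rewrite -subr_eq0 -{2}[n0]mulmx1 -mulmxBr n0g.
  by rewrite mxE => e; rewrite -[RHS]e; apply: eq_bigr => j _; rewrite mxE mulrC.
pose N := n0 0 o0 ^+ 2 + n0 0 o1 ^+ 2 + n0 0 o2 ^+ 2.
have Npos : 0 < N.
  have N0 : 0 <= N by rewrite !addr_ge0 ?sqr_ge0.
  rewrite lt_neqAle N0 andbT eq_sym; apply: contra n0n => /eqP Nz.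
  have a0 := sqr_ge0 (n0 0 o0); have a1 := sqr_ge0 (n0 0 o1); have a2 := sqr_ge0 (n0 0 o2).
  have z (x : R) : x ^+ 2 = 0 -> x = 0 by move/eqP; rewrite expf_eq0 /= => /eqP.
  apply/eqP/matrixP => i j; rewrite ord1 !mxE; move: j; apply: ord3P; apply: z;
    by rewrite /N in Nz; lra.
pose r := Num.sqrt N; have rn : r != 0 by rewrite sqrtr_eq0 -ltNge.
have rE : r ^+ 2 = N by rewrite sqr_sqrtr // ltW.
have [|h rh hn] := @frame_axis (fun i => n0 0 i / r).
  rewrite !exprMn -!mulrDl -/N exprVn rE divff //; exact: lt0r_neq0.
exists h.
have hg : forall i, \sum_j g i j * h j o2 = h i o2.
  move=> i; rewrite hn -gn mulr_suml; apply: eq_bigr => j _.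
  by rewrite hn mulrA.
have fE i : frm h g i o2 = (i == o2)%:R.
  rewrite /frm -mulmxA mxE; have /matrixP/(_ i o2) := rotation_mulVm rh.
  rewrite !mxE => <-; apply: eq_bigr => j _; congr (_ * _).
  by rewrite mxE hg.
have [c [s [cs [E|E]]]] := rotation_axis_z (frm_rotation rh rg) (fE o0) (fE o1).
  by exists c, s.
by have := fE o2; rewrite E mulmx3 !mxE /=; lra.
Qed.

End RotationFrames.

(** * A frame without weight 4 part *)

Section WeightFourFrame.
Variable R : realType.
Implicit Types (h : 'M[R]_3) (H : tensor R 4).

(* The quartic evaluated at the isotropic vector (1 - T^2, i (1 + T^2), 2 T) is this
   polynomial in T; its leading coefficient is the weight 4 part about the z-axis. *)
Lemma isotropic_zero (A B C X Y p q s t : R) :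
  A + B + 8 * C != 0 \/ X != Y -> exists a b : R,
  (Poly [:: Complex (A + B + 8 * C) (4 * (X - Y));
    Complex (8 * (p - 3 * q)) (8 * (3 * s - t)); Complex (28 * (A - B)) (- 56 * (X + Y));
    Complex (- 56 * (p + q)) (- 56 * (s + t)); Complex (70 * (A + B)) 0;
    Complex (56 * (p + q)) (- 56 * (s + t)); Complex (28 * (A - B)) (56 * (X + Y));
    Complex (- 8 * (p - 3 * q)) (8 * (3 * s - t));
    Complex (A + B + 8 * C) (- 4 * (X - Y))]).[Complex a b] = 0.
Proof.
move=> nz; set cs := [:: _; _; _; _; _; _; _; _; _].
have sz : size (Poly cs) = 9%N.
  rewrite (@PolyK _ 0) //= eq_complex /= negb_and.
  case: nz => nz; apply/orP; [by left | right].
  by rewrite mulf_neq0 ?oppr_eq0 ?pnatr_eq0 ?subr_eq0.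
have /closed_rootP[[a b] /rootP Tr] : size (Poly cs) != 1%N by rewrite sz.
by exists a, b.
Qed.

(** The two conditions say that the quartic form vanishes at u + i v, where u and v are the first
    two columns of [h]. An isotropic complex vector has real and imaginary parts orthogonal and of
    equal length, so a zero of the form among such vectors gives the frame after scaling. *)
Lemma weight4_frame H : in_H4 H -> exists2 h, rotation h &
  get4 (act h^T H) o0 o0 o0 o0 - 6 * get4 (act h^T H) o0 o0 o1 o1
    + get4 (act h^T H) o1 o1 o1 o1 = 0 /\
  get4 (act h^T H) o0 o0 o0 o1 = get4 (act h^T H) o0 o1 o1 o1.
Proof.
move=> hH; have [A [B [C [X [Y [p [q [s [t hE]]]]]]]]] := harmonic_param hH.
have [w4|] := pselect (A + B + 8 * C = 0 /\ X = Y).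
  case: w4 => w4 XY; exists 1%:M; first exact: rotation1.
  by rewrite trmx1 act1 hE /h9 /= XY; split=> //; lra.
move=> nz; have {nz} : A + B + 8 * C != 0 \/ X != Y.
  have [w4|] := eqVneq (A + B + 8 * C) 0; last by left.
  by have [XY|] := eqVneq X Y; [case: nz | right].
move/(@isotropic_zero _ _ _ _ _ p q s t) => [a [b]].
rewrite horner_Poly /= /horner_rec.
pose r := (1 + a ^+ 2 + b ^+ 2)^-1.
have rn : 1 + a ^+ 2 + b ^+ 2 != 0.
  by apply: lt0r_neq0; have := sqr_ge0 a; have := sqr_ge0 b; lra.
simpc => /eqP; rewrite eq_complex /= => /andP[/eqP Re /eqP Im].
(* [u] and [v] are the real and imaginary parts of (1 - T^2, i (1 + T^2), 2 T) at the root T = a + i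
   b; both have length 1 + a^2 + b^2. *)
pose u (i : 'I_3) := match nat_of_ord i with
  0 => 1 - a ^+ 2 + b ^+ 2 | 1 => - 2 * a * b | _ => 2 * a end.
pose v (i : 'I_3) := match nat_of_ord i with
  0 => - 2 * a * b | 1 => 1 + a ^+ 2 - b ^+ 2 | _ => 2 * b end.
have [| | |h rh hE'] := @frame_uv R (fun i => u i * r) (fun i => v i * r).
- by rewrite /u /= /r; field.
- by rewrite /v /= /r; field.
- by rewrite /u /v /= /r; field.
have [h0 h1] : (forall i, h i o0 = u i * r) /\ (forall i, h i o1 = v i * r).
  by split=> i; case: (hE' i).
clearbody r.
exists h => //; split.
  rewrite -[RHS](mulr0 (r ^+ 4)) -[in RHS]Re !get4_frame // {Re Im}.
  rewrite !sum3 !h0 !h1 hE /h9 /= /u /v /=.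
  ring.
apply/eqP; rewrite -subr_eq0; apply/eqP.
rewrite -[RHS](mulr0 (r ^+ 4 / 4)) -[in RHS]Im !get4_frame // {Re Im}.
rewrite !sum3 !h0 !h1 hE /h9 /= /u /v /=.
by field.
Qed.

End WeightFourFrame.

Section AxialRotations.
Variable R : realType.
Implicit Types (h : 'M[R]_3) (H : tensor R 4).

(** The parameters [p], [s], [q], [t] transform as a binary cubic p x^3 + 3 s x^2 y + 3 q x y^2 + t
    y^3 and do not mix with the five others, which are even in z. *)
Lemma frame_z_h9 H A B C X Y p q s t c d : in_H4 H ->
  get4 H = h9 A B C X Y p q s t -> c ^+ 2 + d ^+ 2 = 1 ->
  get4 (act (rzm c d)^T H) = h9
    (B * d ^+ 2 - 2 * (X + Y) * c * d + A * c ^+ 2)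
    (B * c ^+ 2 + 2 * (X + Y) * c * d + A * d ^+ 2)
    (- (c ^+ 2 * (d ^+ 2 * (B + C) - 2 * c * d * X - c ^+ 2 * C)
        + 2 * c * d * (d ^+ 2 * X + 2 * c * d * C + c ^+ 2 * Y)
        + d ^+ 2 * (- d ^+ 2 * C - 2 * c * d * Y + c ^+ 2 * (A + C))))
    (c ^+ 3 * (- d * (B + C) + c * X) + 3 * c ^+ 2 * d * (- d * X - c * C)
      + 3 * c * d ^+ 2 * (d * C + c * Y) + d ^+ 3 * (- d * Y + c * (A + C)))
    (c * (- d ^+ 3 * (B + C) + 3 * c * d ^+ 2 * X + 3 * c ^+ 2 * d * C + c ^+ 3 * Y)
      + d * (- d ^+ 3 * X - 3 * c * d ^+ 2 * C - 3 * c ^+ 2 * d * Y + c ^+ 3 * (A + C)))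
    (p * c ^+ 3 + 3 * s * c ^+ 2 * d + 3 * q * c * d ^+ 2 + t * d ^+ 3)
    (p * c * d ^+ 2 + s * (d ^+ 3 - 2 * c ^+ 2 * d) + q * (c ^+ 3 - 2 * c * d ^+ 2)
      + t * c ^+ 2 * d)
    (- p * c ^+ 2 * d + s * (c ^+ 3 - 2 * c * d ^+ 2) + q * (2 * c ^+ 2 * d - d ^+ 3)
      + t * c * d ^+ 2)
    (- p * d ^+ 3 + 3 * s * c * d ^+ 2 - 3 * q * c ^+ 2 * d + t * c ^+ 3).
Proof.
move=> hH hE cd; have rz := rzm_rotation cd.
rewrite (harmonic_h9 (in_H4_frame rz hH)).
by congr h9; rewrite get4_frame // hE !sum3 !mxE /h9 /=; ring.
Qed.

(** The columns are the edge directions of a cube with a diagonal along z. [r2] and [r3] stand for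
    square roots of 2 and 3 of either sign; the sign of [r2] will absorb that of the weight 3
    part. *)
Definition cube_frame (r2 r3 : R) : 'M[R]_3 := \matrix_(i, j)
  match nat_of_ord i, nat_of_ord j with
  | 0, 0 => r2 * r3 / 3 | 0, _ => - (r2 * r3 / 6)
  | 1, 0 => 0 | 1, 1 => r2 / 2 | 1, _ => - (r2 / 2) | _, _ => r3 / 3 end.

Lemma cube_frame_rotation r2 r3 : r2 ^+ 2 = 2 -> r3 ^+ 2 = 3 -> rotation (cube_frame r2 r3).
Proof.
move=> e2 e3.
have e23 : r2 ^+ 2 * r3 ^+ 2 = 6 by rewrite e2 e3; ring.
by apply: rotationP; rewrite ?det33 !mxE /=; lra.
Qed.

(** Seen along a diagonal of the cube, a cubic quartic has parts of weight 0 and 3 only, in the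
    ratio 1 to 5 [r2]. *)
Lemma cube_frame_h9 H C r2 r3 : in_H4 H -> r2 ^+ 2 = 2 -> r3 ^+ 2 = 3 ->
  get4 H = h9 (- 4 * C) (- 4 * C) C 0 0 (5 * C * r2) (- 5 * C * r2) 0 0 ->
  get4 (act (cube_frame r2 r3)^T H) = h9 (6 * C) (6 * C) (6 * C) 0 0 0 0 0 0.
Proof.
move=> hH e2 e3 hE; have rK := cube_frame_rotation e2 e3.
rewrite (harmonic_h9 (in_H4_frame rK hH)).
by congr h9; rewrite get4_frame // hE !sum3 !mxE /h9 /=; field: e2 e3.
Qed.

End AxialRotations.

(** * Quartics with scalar [d2] *)

Section IsotropicD2.
Variable R : realType.
Implicit Types (h m : 'M[R]_3) (H : tensor R 4).

Lemma polar (x y : R) : exists th r, x = r * cos th /\ y = r * sin th.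
Proof.
pose r := Num.sqrt (x ^+ 2 + y ^+ 2).
have n0 : 0 <= x ^+ 2 + y ^+ 2 by rewrite addr_ge0 ?sqr_ge0.
have r2 : r ^+ 2 = x ^+ 2 + y ^+ 2 by rewrite sqr_sqrtr.
have r0 : 0 <= r by apply: sqrtr_ge0.
have [rz|rn] := eqVneq r 0.
  exists 0, 0; move: r2; rewrite rz expr0n /= => /esym/sum_sqr_eq0[-> ->].
  by rewrite !mul0r.
have xr : -1 <= x / r <= 1.
  rewrite -ler_norml normrM normfV (ger0_norm r0) ler_pdivrMr ?lt_neqAle ?r0 ?andbT 1?eq_sym //.
  rewrite mul1r -(ger0_norm r0) -ler_sqr ?nnegrE // !real_normK ?num_real // r2.
  by rewrite lerDl sqr_ge0.
have sinE : sin (acos (x / r)) = `|y| / r.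
  rewrite sin_acos // (_ : 1 - _ = (`|y| / r) ^+ 2).
    by rewrite sqrtr_sqr ger0_norm // divr_ge0.
  rewrite !expr_div_n real_normK ?num_real // (_ : y ^+ 2 = r ^+ 2 - x ^+ 2).
    by field.
  by rewrite r2; ring.
have [y0|y0] := leP 0 y.
  exists (acos (x / r)), r; rewrite acosK ?in_itv //= sinE ger0_norm //.
  by split; field.
exists (- acos (x / r)), r; rewrite cosN sinN acosK ?in_itv //= sinE ltr0_norm //.
by split; field.
Qed.

(** Here and in the next two lemmas, (c, d) is the unit vector at 1/2, 1/3 or 1/4 of the polar angle
    of (x, y). The rotation about z that it defines removes one of the two coordinates of a part of
    weight 2, 3 or 4. *)
Lemma align2 (x y : R) : exists c d, c ^+ 2 + d ^+ 2 = 1 /\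
  x * (2 * c * d) = y * (c ^+ 2 - d ^+ 2).
Proof.
have [th [r [-> ->]]] := polar x y; exists (cos (th / 2)), (sin (th / 2)).
rewrite cos2Dsin2; split=> //; have -> : th = th / 2 + th / 2 by field.
by rewrite cosD sinD -(_ : th = th / 2 + th / 2); [ring | field].
Qed.

Lemma align3 (x y : R) : exists c d, c ^+ 2 + d ^+ 2 = 1 /\
  x * (3 * c ^+ 2 * d - d ^+ 3) = y * (c ^+ 3 - 3 * c * d ^+ 2).
Proof.
have [th [r [-> ->]]] := polar x y; exists (cos (th / 3)), (sin (th / 3)).
rewrite cos2Dsin2; split=> //; set f := th / 3; have -> : th = f + (f + f) by rewrite /f; field.
by rewrite !(cosD, sinD); ring.
Qed.

Lemma align4 (x y : R) : exists c d, c ^+ 2 + d ^+ 2 = 1 /\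
  x * (4 * c ^+ 3 * d - 4 * c * d ^+ 3) = y * (c ^+ 4 - 6 * c ^+ 2 * d ^+ 2 + d ^+ 4).
Proof.
have [th [r [-> ->]]] := polar x y; exists (cos (th / 4)), (sin (th / 4)).
rewrite cos2Dsin2; split=> //; set f := th / 4.
have -> : th = (f + f) + (f + f) by rewrite /f; field.
by rewrite !(cosD, sinD); ring.
Qed.

(** Once the weights 4, 1 and 2 are gone, scalarity of [d2] fixes the size of weight 3 by p^2 + s^2
    = 50 C^2. After a rotation about z this is a cube seen along a diagonal, and [cube_frame] passes
    to its edges. If C = 0, then [H] vanishes and [c] is 0. *)
Lemma isotropic_d2_cubic H k : in_H4 H -> d2 H = k%:M ->
  exists h c, rotation h /\ get4 (act h^T H) = h9 c c c 0 0 0 0 0 0.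
Proof.
move=> hH dk; have [h1 rh1 [w4r w4i]] := weight4_frame hH.
have hH1 := in_H4_frame rh1 hH; set H1 := act h1^T H in hH1 w4r w4i.
have dk1 : d2 H1 = k%:M.
  rewrite d2_frame ?dk //; last by case: hH.
  by rewrite -scalemx1 frmZ frm1.
have [A [B [C [X [Y [p [q [s [t hE]]]]]]]]] := harmonic_param hH1.
have sH1 : totally_symmetric H1 by case: hH1.
have hd := d2_h9 hE sH1.
rewrite !hE /h9 /= in w4r w4i; have XY := w4i.
have [D01 D02 D12] : [/\ d2 H1 o0 o1 = 0, d2 H1 o0 o2 = 0 & d2 H1 o1 o2 = 0].
  by rewrite dk1 !mxE.
have [Da Db] : d2 H1 o0 o0 = d2 H1 o1 o1 /\ d2 H1 o0 o0 = d2 H1 o2 o2.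
  by rewrite dk1 !mxE.
move: D01 D02 D12 Da Db; rewrite !hd {hd} -XY => D01 D02 D12 Da Db.
have AE : A = - B - 8 * C by lra.
(* The arguments are the parts of weight 0, 1, 2, 3. The five goals express that [d2 H1] is scalar:
   its entries xz and yz, the difference xx - yy, the entry xy, and a combination of the diagonal
   differences. *)
have [|||||P0 S0 v1 v2] := @weights12_vanish R (20 * C) (p + q) (s + t)
   (2 * (A - B)) (8 * X) (p - 3 * q) (3 * s - t).
- by transitivity (16 * 0 : R); last ring; rewrite -D02 AE; ring.
- by transitivity (16 * 0 : R); last ring; rewrite -D12 AE; ring.
- apply/eqP; rewrite -subr_eq0; apply/eqP; move/eqP: Da; rewrite -subr_eq0 => /eqP Da.
  by rewrite subr0; transitivity (4 * 0 : R); last ring; rewrite -Da AE; field.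
- by transitivity (8 * 0 : R); last ring; rewrite -D01 AE; ring.
- move/eqP: Da; rewrite -subr_eq0 => /eqP Da; move/eqP: Db; rewrite -subr_eq0 => /eqP Db.
  apply/eqP; rewrite -subr_eq0; apply/eqP.
  transitivity (4 * (2 * 0 - 0) : R); last ring.
  by rewrite -{1}Db -Da AE; field.
have X0 : X = 0 by lra.
have [qE tE] : q = - p /\ t = - s by split; lra.
have [BE {}AE] : B = - 4 * C /\ A = - 4 * C by split; lra.
have ps : p ^+ 2 + s ^+ 2 = 50 * C ^+ 2.
  by move: Db; rewrite AE BE X0 qE tE => Db; lra.
have [C0|Cn] := eqVneq C 0.
  exists h1, 0; split=> //; rewrite -/H1 hE AE BE C0 -XY X0 qE tE.
  move: ps; rewrite C0 expr0n mulr0 => /sum_sqr_eq0[-> ->].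
  by rewrite mulr0 oppr0.
have [c [d [cd al]]] := align3 p s.
have rz := rzm_rotation cd; have hH2 := in_H4_frame rz hH1.
have hE2 := frame_z_h9 hH1 hE cd; set H2 := act _ H1 in hE2 hH2.
pose p2 := p * (c ^+ 3 - 3 * c * d ^+ 2) + s * (3 * c ^+ 2 * d - d ^+ 3).
have cd2 : (c ^+ 2 + d ^+ 2) ^+ 2 = 1 by rewrite cd expr1n.
have hE2' : get4 H2 = h9 (- 4 * C) (- 4 * C) C 0 0 p2 (- p2) 0 0.
  rewrite hE2; congr h9; rewrite ?AE ?BE ?qE ?tE -?XY ?X0 /p2; try ring.
  - by transitivity (- 4 * C * (c ^+ 2 + d ^+ 2)); [ring | rewrite cd; ring].
  - by transitivity (- 4 * C * (c ^+ 2 + d ^+ 2)); [ring | rewrite cd; ring].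
  - by transitivity (C * (c ^+ 2 + d ^+ 2) ^+ 2); [ring | rewrite cd2; ring].
  - by move/eqP: al; rewrite -subr_eq0 => /eqP al; rewrite -[RHS]oppr0 -al; ring.
  - by move/eqP: al; rewrite -subr_eq0 => /eqP al; rewrite -[RHS]al; ring.
pose r2 := p2 / (5 * C); pose r3 : R := Num.sqrt 3.
have r3E : r3 ^+ 2 = 3 by rewrite sqr_sqrtr // ler0n.
have r2E : r2 ^+ 2 = 2.
  have p2E : p2 ^+ 2 = 50 * C ^+ 2.
    rewrite -ps -[RHS]mulr1 -(expr1n R 3) -cd.
    transitivity (p2 ^+ 2 + (p * (3 * c ^+ 2 * d - d ^+ 3)
       - s * (c ^+ 3 - 3 * c * d ^+ 2)) ^+ 2); last by rewrite /p2; ring.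
    by rewrite al subrr expr0n addr0.
  by rewrite /r2 expr_div_n p2E; field.
have p2E : p2 = 5 * C * r2 by rewrite /r2; field.
have rK := cube_frame_rotation r2E r3E.
exists (h1 *m rzm c d *m cube_frame r2 r3), (6 * C).
split; first by do !apply: rotation_mul.
rewrite trmx_mul -act_mul; [|exact: rotation_tr|by apply/rotation_tr/rotation_mul].
rewrite trmx_mul -act_mul; [|exact: rotation_tr|exact: rotation_tr].
by apply: cube_frame_h9 => //; rewrite hE2' p2E; congr h9; ring.
Qed.

End IsotropicD2.

(** * Axial families *)

Section Axial.
Variable R : realType.
Implicit Types (g h m r : 'M[R]_3) (n : 'cV[R]_3) (H : tensor R 4).

Definition unitv n : Prop := n o0 0 ^+ 2 + n o1 0 ^+ 2 + n o2 0 ^+ 2 = 1.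
Definition proj n : 'M[R]_3 := n *m n^T.
Definition axial n m : Prop := exists x y : R, m = x *: proj n + y%:M.

Definition coaxial H (a b : 'M[R]_3) n : Prop :=
  [/\ unitv n, axial n a, axial n b, axial n (d2 H) & axial n (contr H (proj n))].

Lemma projE n i j : proj n i j = n i 0 * n j 0.
Proof. by rewrite mxE big_ord1 mxE. Qed.

Lemma unitvE n : unitv n <-> n^T *m n = 1%:M.
Proof.
have nnE : (n^T *m n) 0 0 = n o0 0 ^+ 2 + n o1 0 ^+ 2 + n o2 0 ^+ 2.
  by rewrite mxE sum3 !mxE !expr2.
split=> [un|/matrixP/(_ 0 0)].
  by apply/matrixP => i j; rewrite !ord1 nnE un mxE.
by rewrite nnE mxE.
Qed.

Lemma proj_tr n : (proj n)^T = proj n.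
Proof. by rewrite trmx_mul trmxK. Qed.

Lemma frm_proj h n : frm h (proj n) = proj (h^T *m n).
Proof. by rewrite /frm /proj trmx_mul trmxK !mulmxA. Qed.

Lemma unitv_frame h n : rotation h -> unitv n -> unitv (h^T *m n).
Proof.
move=> rh /unitvE un; apply/unitvE.
by rewrite trmx_mul trmxK mulmxA -(mulmxA n^T) rotation_mulmV // mulmx1.
Qed.

Lemma axial_frame h n m : rotation h -> axial n m -> axial (h^T *m n) (frm h m).
Proof.
move=> rh [x [y ->]]; exists x, y.
by rewrite frmD frmZ frm_proj -scalemx1 frmZ frm1 // scalemx1.
Qed.

Lemma coaxial_frame h H a b n : rotation h -> totally_symmetric H -> coaxial H a b n ->
  coaxial (act h^T H) (frm h a) (frm h b) (h^T *m n).
Proof.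
move=> rh sH [un xa xb xd xc]; split; rewrite ?d2_frame //.
- exact: unitv_frame.
- exact: axial_frame.
- exact: axial_frame.
- exact: axial_frame.
by rewrite -frm_proj contr_frame //; apply: axial_frame.
Qed.

Lemma coaxial_unframe h H a b n : rotation h -> totally_symmetric H ->
  coaxial (act h^T H) (frm h a) (frm h b) n -> coaxial H a b (h *m n).
Proof.
move=> rh sH /(coaxial_frame (rotation_tr rh) (act_sym _ sH)).
by rewrite !frmK // act_mul ?trmxK ?rotation_mulmV ?act1 //; apply: rotation_tr.
Qed.

Lemma axialD n m1 m2 : axial n m1 -> axial n m2 -> axial n (m1 + m2).
Proof.
move=> [x1 [y1 ->]] [x2 [y2 ->]]; exists (x1 + x2), (y1 + y2).
by rewrite scalerDl raddfD /= addrACA.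
Qed.

Lemma axialZ n c m : axial n m -> axial n (c *: m).
Proof.
move=> [x [y ->]]; exists (c * x), (c * y).
by rewrite scalerDr scalerA scale_scalar_mx.
Qed.

Lemma axial_scalar n c : axial n c%:M.
Proof. by exists 0, c; rewrite scale0r add0r. Qed.

Lemma axial_proj n : axial n (proj n).
Proof. by exists 1, 0; rewrite scale1r raddf0 addr0. Qed.

Definition ev (i : 'I_3) : 'cV[R]_3 := delta_mx i 0.

Lemma unitv_ev i : unitv (ev i).
Proof. by move: i; apply: ord3P; rewrite /unitv !mxE /=; ring. Qed.

Lemma axial_diag0 x y : axial (ev o0) (diag3 y x x).
Proof.
exists (y - x), x; apply: mx3P; rewrite mxE !mxE big_ord1 !mxE /= ?mulr1n ?mulr0n; ring.
Qed.
Lemma axial_diag1 x y : axial (ev o1) (diag3 x y x).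
Proof.
exists (y - x), x; apply: mx3P; rewrite mxE !mxE big_ord1 !mxE /= ?mulr1n ?mulr0n; ring.
Qed.
Lemma axial_diag2 x y : axial (ev o2) (diag3 x x y).
Proof.
exists (y - x), x; apply: mx3P; rewrite mxE !mxE big_ord1 !mxE /= ?mulr1n ?mulr0n; ring.
Qed.

Lemma diag3_tr x y z : (diag3 x y z)^T = diag3 x y z :> 'M[R]_3.
Proof. by apply: mx3P; rewrite !mxE. Qed.

Lemma sym_diag3 m : m^T = m -> m o0 o1 = 0 -> m o0 o2 = 0 -> m o1 o2 = 0 ->
  m = diag3 (m o0 o0) (m o1 o1) (m o2 o2).
Proof. by move=> sm m01 m02 m12; apply: symx3P; rewrite ?diag3_tr // !mxE. Qed.

Lemma form_act g k (T : tensor R k) x :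
  form (act g T) x = form T (fun i => \sum_j invmx g i j * x j).
Proof. exact: mform_act. Qed.

Lemma form_h9 H A B C X Y p q s t (x : 'I_3 -> R) : get4 H = h9 A B C X Y p q s t ->
  form H x = (B + C) * x o0 ^+ 4 + (A + C) * x o1 ^+ 4 + (A + B) * x o2 ^+ 4
  + 4 * X * x o0 ^+ 3 * x o1 + 4 * Y * x o0 * x o1 ^+ 3
  + 4 * p * x o0 ^+ 3 * x o2 + 4 * t * x o1 ^+ 3 * x o2
  - 4 * (p + q) * x o0 * x o2 ^+ 3 - 4 * (s + t) * x o1 * x o2 ^+ 3
  - 6 * C * x o0 ^+ 2 * x o1 ^+ 2 - 6 * B * x o0 ^+ 2 * x o2 ^+ 2
  - 6 * A * x o1 ^+ 2 * x o2 ^+ 2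
  + 12 * s * x o0 ^+ 2 * x o1 * x o2 + 12 * q * x o0 * x o1 ^+ 2 * x o2
  - 12 * (X + Y) * x o0 * x o1 * x o2 ^+ 2.
Proof. by move=> hE; rewrite form4E !sum3 hE /h9 /=; ring. Qed.

Lemma form_fix g H : rotation g -> totally_symmetric H ->
  act g H = H <-> forall x, form H (fun i => \sum_j g j i * x j) = form H x.
Proof.
move=> rg sH.
have fE x : form (act g H) x = form H (fun i => \sum_j g j i * x j).
  rewrite form_act (rotation_inv rg); apply: mform_ext => _ i.
  by apply: eq_bigr => j _; rewrite mxE.
split=> [gH x|gH]; first by rewrite -fE gH.
by apply: form_inj => // [|x]; [apply: act_sym | rewrite fE gH].
Qed.

Lemma rotation_norm g (x : 'I_3 -> R) : rotation g ->
  \sum_i (\sum_j g j i * x j) ^+ 2 = \sum_i x i ^+ 2.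
Proof.
move=> rg; have /matrixP rows := rotation_mulmV rg.
have := (rows o0 o0, rows o0 o1, rows o0 o2, rows o1 o1, rows o1 o2, rows o2 o2).
rewrite !mulmx3 !mxE /= !mulr1n !mulr0n => -[[[[[e00 e01] e02] e11] e12] e22].
rewrite !sum3.
transitivity (x o0 ^+ 2 * (g o0 o0 * g o0 o0 + g o0 o1 * g o0 o1 + g o0 o2 * g o0 o2)
  + x o1 ^+ 2 * (g o1 o0 * g o1 o0 + g o1 o1 * g o1 o1 + g o1 o2 * g o1 o2)
  + x o2 ^+ 2 * (g o2 o0 * g o2 o0 + g o2 o1 * g o2 o1 + g o2 o2 * g o2 o2)
  + 2 * x o0 * x o1 * (g o0 o0 * g o1 o0 + g o0 o1 * g o1 o1 + g o0 o2 * g o1 o2)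
  + 2 * x o0 * x o2 * (g o0 o0 * g o2 o0 + g o0 o1 * g o2 o1 + g o0 o2 * g o2 o2)
  + 2 * x o1 * x o2 * (g o1 o0 * g o2 o0 + g o1 o1 * g o2 o1 + g o1 o2 * g o2 o2)).
  by ring.
by rewrite e00 e01 e02 e11 e12 e22; ring.
Qed.

(** The form of [H] is 5c times the sum of fourth powers minus 3c times the fourth power of the
    norm, and rotations preserve the norm. *)
Lemma cubic_fix g H c : rotation g -> totally_symmetric H ->
  get4 H = h9 c c c 0 0 0 0 0 0 -> c != 0 ->
  act g H = H <-> forall x : 'I_3 -> R,
    \sum_i (\sum_j g j i * x j) ^+ 4 = \sum_i x i ^+ 4.
Proof.
move=> rg sH hE cn; rewrite form_fix //.
have fE x : form H x = 5 * c * (\sum_i x i ^+ 4) - 3 * c * (\sum_i x i ^+ 2) ^+ 2.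
  by rewrite (form_h9 _ hE) !sum3; ring.
split=> gH x; have := gH x; rewrite !fE rotation_norm //; last by move->.
move/addIr/mulfI; apply.
by rewrite mulf_neq0 // pnatr_eq0.
Qed.

Lemma involution_axis r : rotation r -> r <> 1%:M -> r *m r = 1%:M ->
  exists2 h, rotation h & frm h r = rzm (-1) 0.
Proof.
move=> rr r1 r2; have [h [c [s [rh cs fE]]]] := rotation_axis rr r1.
exists h => //; have : frm h r *m frm h r = 1%:M by rewrite -frm_mul // r2 frm1.
rewrite fE => /matrixP e; have := (e o0 o0, e o0 o1).
rewrite !mulmx3 !mxE /= mulr1n mulr0n => -[e00 e01].
have s0 : s = 0 by apply/eqP; rewrite -sqrf_eq0; apply/eqP; lra.
have /eqP : c ^+ 2 = 1 by rewrite -cs s0; ring.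
rewrite sqrf_eq1 => /orP[] /eqP cE; last by rewrite cE s0.
have r1' : rzm 1 0 = 1%:M :> 'M[R]_3.
  by apply: mx3P; rewrite !mxE //= oppr0.
by case: r1; apply: (frm_inj rh); rewrite fE cE s0 r1' frm1.
Qed.

(** A half-turn about v is 2 v v^T - 1, where v is the third column of [h]. *)
Lemma involution_entries h r i j : rotation h -> frm h r = rzm (-1) 0 ->
  r i j = 2 * h i o2 * h j o2 - (i == j)%:R.
Proof.
move=> rh fE; have /matrixP/(_ i j) e := rotation_mulmV rh.
have -> : r = frm h^T (rzm (-1) 0) by rewrite -fE frmK.
rewrite mulmx3 !mxE in e; rewrite -e /frm trmxK !mulmx3 !mxE /=; ring.
Qed.

Lemma contr_cubic H c m : get4 H = h9 c c c 0 0 0 0 0 0 -> totally_symmetric H ->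
  m^T = m -> contr H m = (5 * c) *: diag3 (m o0 o0) (m o1 o1) (m o2 o2)
    + ((- 2 * c) *: m + (- c * \tr m)%:M).
Proof.
move=> hE sH sm; have hc := contr_h9 hE sm; rewrite /mxtrace sum3.
apply: symx3P; first exact: contr_tr.
  by rewrite !linearD !linearZ /= diag3_tr sm tr_scalar_mx.
all: by rewrite hc !mxE /= ?mulr1n ?mulr0n; ring.
Qed.

(** Write r = 2 v v^T - 1 and D = diag(n_i^2). Commuting with nn^T makes v parallel or orthogonal to
    [n]; commuting with D makes n_i^2 constant on the support of v. If v has three nonzero
    coordinates, D is scalar. If it has two, either these have equal squares or [n] is a coordinate
    vector and D = nn^T. If v has one nonzero coordinate, or two of equal squares, [r] is a symmetry
    of the cube. *)
Lemma cubic_involution H c n r : in_H4 H -> get4 H = h9 c c c 0 0 0 0 0 0 ->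
  unitv n -> rotation r -> r <> 1%:M -> r *m r = 1%:M ->
  r *m proj n = proj n *m r -> r *m contr H (proj n) = contr H (proj n) *m r ->
  act r H = H \/ axial n (contr H (proj n)).
Proof.
move=> [sH _] hE un rr r1 r2 rn rc; rewrite (contr_cubic hE sH (proj_tr n)) in rc *.
set D := diag3 _ _ _ in rc *.
suff : act r H = H \/ axial n D.
  case; [by left | right]; apply: axialD; first exact: axialZ.
  by apply: axialD; [apply/axialZ/axial_proj | apply: axial_scalar].
have [c0|cn] := eqVneq c 0.
  left; apply: tensor4P => i j k l; rewrite get4_act !hE c0.
  have z i' j' k' l' : h9 0 0 0 0 0 0 0 0 0 i' j' k' l' = 0 :> R.
    by move: i' j' k' l'; do 4 apply: ord3P; rewrite /h9 /= ?addr0 ?oppr0.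
  by rewrite z; do 4 (rewrite big1 // => ? _); rewrite z mulr0.
have rD : r *m D = D *m r.
  have cn5 : 5 * c != 0 by rewrite mulf_neq0 // pnatr_eq0.
  apply: (scalerI cn5); move: rc; rewrite !mulmxDr !mulmxDl -!scalemxAr -!scalemxAl rn.
  by rewrite scalar_mxC => /addIr.
have [h rh fE] := involution_axis rr r1 r2.
pose v i := h i o2; have rE i j : r i j = 2 * v i * v j - (i == j)%:R.
  exact: involution_entries.
have vv : v o0 ^+ 2 + v o1 ^+ 2 + v o2 ^+ 2 = 1.
  by have /matrixP/(_ o2 o2) := rotation_mulVm rh; rewrite mulmx3 !mxE /= !expr2.
have DE i j : D i j = (i == j)%:R * n i 0 ^+ 2.
  by rewrite mxE !projE -!expr2; move: i j; apply: ord3P; apply: ord3P; rewrite /= ?mul1r ?mul0r.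
have vD i j : v i * v j * (n j 0 ^+ 2 - n i 0 ^+ 2) = 0.
  have /matrixP/(_ i j) := rD; rewrite !mulmx3 !rE !DE.
  by move: i j; apply: ord3P; apply: ord3P; rewrite /= ?mulr1n ?mulr0n; lra.
have vn i j : (v o0 * n o0 0 + v o1 * n o1 0 + v o2 * n o2 0) *
    (v i * n j 0 - n i 0 * v j) = 0.
  have /matrixP/(_ i j) := rn; rewrite !mulmx3 !rE !projE.
  by move: i j; apply: ord3P; apply: ord3P; rewrite /= ?mulr1n ?mulr0n; lra.
have eqD i j : v i != 0 -> v j != 0 -> n j 0 ^+ 2 = n i 0 ^+ 2.
  move=> vi vj; apply/eqP; rewrite -subr_eq0; move/eqP: (vD i j).
  by rewrite !mulf_eq0 (negbTE vi) (negbTE vj).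
have Dsc : n o0 0 ^+ 2 = n o1 0 ^+ 2 -> n o0 0 ^+ 2 = n o2 0 ^+ 2 -> axial n D.
  move=> e1 e2; rewrite (_ : D = (n o0 0 ^+ 2)%:M); first exact: axial_scalar.
  by apply: mx3P; rewrite DE !mxE /= ?mulr1n ?mulr0n ?mul1r ?mul0r.
have Dp i j : i != j -> n i 0 = 0 -> n j 0 = 0 -> axial n D.
  move=> ij ni nj; rewrite (_ : D = proj n); first exact: axial_proj.
  apply/matrixP => k l; rewrite DE projE.
  case: eqVneq => [->|kl]; first by rewrite mul1r expr2.
  rewrite mul0r; move: i j k l ij kl ni nj.
  by do 4 apply: ord3P; rewrite ?eqxx // => _ _ ni nj; rewrite ?ni ?nj ?mul0r ?mulr0.
have pair i j k : i != j -> i != k -> j != k -> v i != 0 -> v j != 0 -> v k = 0 ->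
    axial n D \/ v i ^+ 2 = v j ^+ 2.
  move=> ij ik jk vi vj vk; have nij := eqD _ _ vi vj.
  have [e|e] := eqVneq (v o0 * n o0 0 + v o1 * n o1 0 + v o2 * n o2 0) 0.
    have e2 : v i * n i 0 = - (v j * n j 0).
      move: i j k ij ik jk vi vj vk e {nij}.
      by do 3 apply: ord3P; rewrite ?eqxx // => _ _ _ _ _ ->; lra.
    have [ni|ni] := eqVneq (n i 0) 0.
      left; apply: (Dp i j) => //; apply/eqP; rewrite -sqrf_eq0 nij ni expr0n //.
    right; apply: (mulIf (_ : n i 0 ^+ 2 != 0)); first by rewrite sqrf_eq0.
    by rewrite -exprMn e2 sqrrN exprMn nij.
  right; have /eqP := vn i j; rewrite mulf_eq0 (negbTE e) /= subr_eq0 => /eqP e2.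
  have [ni|ni] := eqVneq (n i 0) 0.
    move: nij; rewrite ni expr0n => /eqP; rewrite sqrf_eq0 => /eqP nj.
    case/eqP: e; move: i j k ij ik jk vi vj vk ni nj {e2}.
    by do 3 apply: ord3P; rewrite ?eqxx // => _ _ _ _ _ -> -> ->; rewrite ?mul0r ?mulr0 ?addr0.
  apply: (mulIf (_ : n i 0 ^+ 2 != 0)); first by rewrite sqrf_eq0.
  by rewrite -[in RHS]exprMn mulrC [v j * _]mulrC -e2 exprMn nij mulrC.
suff : axial n D \/ forall x : 'I_3 -> R,
    \sum_i (\sum_j r j i * x j) ^+ 4 = \sum_i x i ^+ 4.
  by case; [right | left; apply/(cubic_fix rr sH hE cn)].
have P1 (w : R) : 2 * w ^+ 2 = 1 -> w ^+ 4 = 4^-1.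
  by move=> w2; rewrite (exprM w 2 2) (_ : w ^+ 2 = 2^-1); [field | lra].
have [v0|v0] := eqVneq (v o0) 0; have [v1|v1] := eqVneq (v o1) 0;
  have [v2|v2] := eqVneq (v o2) 0; move: vv; rewrite ?v0 ?v1 ?v2 => vv.
- by move/eqP: vv; rewrite !expr0n /= !addr0 eq_sym oner_eq0.
- right=> x; rewrite !sum3 !rE v0 v1 /= (_ : 2 * v o2 * v o2 = 2); last by lra.
  by ring.
- right=> x; rewrite !sum3 !rE v0 v2 /= (_ : 2 * v o1 * v o1 = 2); last by lra.
  by ring.
- have [|e] := pair o1 o2 o0 isT isT isT v1 v2 v0; first by left.
  right=> x; rewrite !sum3 !rE v0 /= (_ : 2 * v o1 * v o1 = 1); last by lra.
  rewrite (_ : 2 * v o2 * v o2 = 1); last by lra.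
  transitivity (x o0 ^+ 4 + (16 * v o1 ^+ 4 * v o2 ^+ 4) * (x o1 ^+ 4 + x o2 ^+ 4)).
    by ring.
  by rewrite (P1 (v o1)) ?(P1 (v o2)); [field | lra | lra].
- right=> x; rewrite !sum3 !rE v1 v2 /= (_ : 2 * v o0 * v o0 = 2); last by lra.
  by ring.
- have [|e] := pair o0 o2 o1 isT isT isT v0 v2 v1; first by left.
  right=> x; rewrite !sum3 !rE v1 /= (_ : 2 * v o0 * v o0 = 1); last by lra.
  rewrite (_ : 2 * v o2 * v o2 = 1); last by lra.
  transitivity (x o1 ^+ 4 + (16 * v o0 ^+ 4 * v o2 ^+ 4) * (x o0 ^+ 4 + x o2 ^+ 4)).
    by ring.
  by rewrite (P1 (v o0)) ?(P1 (v o2)); [field | lra | lra].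
- have [|e] := pair o0 o1 o2 isT isT isT v0 v1 v2; first by left.
  right=> x; rewrite !sum3 !rE v2 /= (_ : 2 * v o0 * v o0 = 1); last by lra.
  rewrite (_ : 2 * v o1 * v o1 = 1); last by lra.
  transitivity (x o2 ^+ 4 + (16 * v o0 ^+ 4 * v o1 ^+ 4) * (x o0 ^+ 4 + x o1 ^+ 4)).
    by ring.
  by rewrite (P1 (v o0)) ?(P1 (v o1)); [field | lra | lra].
by left; apply: Dsc; apply/esym/eqD.
Qed.

End Axial.

(** * Half-turns that commute with the family F_o *)

Section InvolutionSymmetry.
Variable R : realType.
Implicit Types (g h m r a b : 'M[R]_3) (n : 'cV[R]_3) (H : tensor R 4).

Definition rpi : 'M[R]_3 := rzm (-1) 0.
Definition block m : Prop := m o0 o2 = 0 /\ m o1 o2 = 0.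

Lemma rpi_rotation : rotation rpi.
Proof. by apply: rzm_rotation; ring. Qed.

Lemma rpi_tr : rpi^T = rpi.
Proof. by apply: mx3P; rewrite !mxE /= ?oppr0. Qed.

Lemma comm_rpi m : rpi *m m = m *m rpi -> block m.
Proof.
move=> /matrixP e; have := (e o0 o2, e o1 o2).
by rewrite !mulmx3 !mxE /= => -[e02 e12]; split; lra.
Qed.

Lemma block_comm m : m^T = m -> block m -> rpi *m m = m *m rpi.
Proof.
move=> sm [m02 m12]; have m20 := tr_entry o2 o0 sm; have m21 := tr_entry o2 o1 sm.
by apply: mx3P; rewrite !mulmx3 !mxE /= ?m20 ?m21 ?m02 ?m12; ring.
Qed.

Lemma frm_rpi c d : c ^+ 2 + d ^+ 2 = 1 -> frm (rzm c d) rpi = rpi.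
Proof.
move=> cd; rewrite /frm; apply: mx3P; rewrite !mulmx3 !mxE /=; lra.
Qed.

Lemma frm_block c d m : block m -> block (frm (rzm c d) m).
Proof. by move=> [m02 m12]; split; rewrite !mulmx3 !mxE /= m02 m12; ring. Qed.

Lemma Lo_frame h H a b : rotation h -> totally_symmetric H ->
  Lo (act h^T H) (frm h a) (frm h b) = List.map (frm h) (Lo H a b).
Proof.
move=> rh sH; rewrite /Lo /= /c4 /c3 !d2_frame // -!frm_mul //.
by rewrite !contr_frame.
Qed.

Lemma Lm_frame h H a b : rotation h -> totally_symmetric H ->
  Lm (act h^T H) (frm h a) (frm h b) = List.map (frm h) (Lm H a b).
Proof.
move=> rh sH; rewrite /Lm Lo_frame // /symprod !d2_frame // -!frm_mul // -!frmD -!frmZ.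
by rewrite !contr_frame // List.map_app.
Qed.

Lemma contr1 H : in_H4 H -> contr H 1%:M = 0.
Proof.
move=> hH; have [A [B [C [X [Y [p [q [s [t hE]]]]]]]]] := harmonic_param hH.
have hc := contr_h9 hE (trmx1 R 3).
apply: symx3P; rewrite ?trmx0 ?contr_tr //; first by case: hH.
all: by rewrite hc !mxE /= ?mulr1n ?mulr0n; ring.
Qed.

Lemma contr_proj_axial H n m x y : in_H4 H -> x != 0 -> m = x *: proj n + y%:M ->
  axial n (contr H m) -> axial n (contr H (proj n)).
Proof.
move=> hH xn mE; rewrite mE contrD contrZ -scalemx1 contrZ contr1 // scaler0 addr0.
by move/(axialZ x^-1); rewrite scalerA mulVf // scale1r.
Qed.

Lemma odd0_fix H A B C X Y : in_H4 H -> get4 H = h9 A B C X Y 0 0 0 0 -> act rpi H = H.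
Proof.
move=> hH hE; apply: tensor4P => i j k l.
have cd : (-1) ^+ 2 + 0 ^+ 2 = 1 :> R by ring.
have := frame_z_h9 hH hE cd; rewrite -/rpi rpi_tr => ->.
by rewrite hE; congr h9; ring.
Qed.

(** For [m] block, the xz and yz entries of H : m involve only the odd parameters: these are the two
    linear equations. *)
Lemma block_ker H A B C X Y p q s t m : get4 H = h9 A B C X Y p q s t ->
  m^T = m -> block m -> block (contr H m) ->
  p * (m o0 o0 - m o2 o2) + q * (m o1 o1 - m o2 o2) + s * (2 * m o0 o1) = 0 /\
  s * (m o0 o0 - m o2 o2) + t * (m o1 o1 - m o2 o2) + q * (2 * m o0 o1) = 0.
Proof.
move=> hE sm [m02 m12] [c02 c12]; have hc := contr_h9 hE sm.
by move: c02 c12; rewrite !hc m02 m12 => c02 c12; split; lra.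
Qed.

Section BlockFamily.
Variables (H : tensor R 4) (a b : 'M[R]_3).
Hypotheses (hH : in_H4 H) (sa : sym_traceless a) (sb : sym_traceless b).
Hypothesis blk : forall m, List.In m (Lo H a b) -> block m.

Let sH : totally_symmetric H. Proof. by case: hH. Qed.

Let blkD : [/\ block (d2 H), block a, block b, block (c3 H) & block (c4 H)] /\
  [/\ block (contr H a), block (contr H b), block (contr H (a *m a))
    & block (contr H (b *m b))].
Proof. by split; split; apply: blk; rewrite /=; auto 12. Qed.

Let sqr_tr m : m^T = m -> (m *m m)^T = m *m m.
Proof. by move=> sm; rewrite trmx_mul sm. Qed.

Let sqr_block m : m^T = m -> block m -> block (m *m m).
Proof.
move=> sm [m02 m12]; have m20 := tr_entry o2 o0 sm; have m21 := tr_entry o2 o1 sm.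
by split; rewrite mulmx3 m02 m12; ring.
Qed.

(* If the part of H odd in z is z times the cube of a linear form, which we take to be x,
   then d2 forces H to be tetragonal about y. *)
Lemma odd_cube_coaxial A B C X Y k : k != 0 ->
  get4 H = h9 A B C X Y k 0 0 0 -> coaxial H a b (ev R o1).
Proof.
move=> kn hE; have [[bd ba bb bc bc4] [bHa bHb bHaa bHbb]] := blkD.
have hd := d2_h9 hE sH; have [d02 d12] := bd; move: (d02) (d12); rewrite !hd => e02 e12.
have [kd _] := block_ker hE (d2_tr sH) bd bc.
have ker0 m : m^T = m -> block m -> block (contr H m) -> m o0 o0 = m o2 o2.
  move=> sm bm bc'; have [e _] := block_ker hE sm bm bc'.
  by apply/eqP; rewrite -subr_eq0; apply/eqP/(mulfI kn); lra.
have CA : C = A by apply: (mulfI kn); lra.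
have YX : Y = - (4 / 3) * X by apply: (mulfI kn); lra.
(* Under [CA] and [YX], the difference of the xx and zz entries of [d2 H] is 40/9 X^2. *)
have X0 : X = 0.
  apply/eqP; rewrite -sqrf_eq0; apply/eqP.
  have := ker0 _ (d2_tr sH) bd bc; rewrite !hd YX CA => e; lra.
have Y0 : Y = 0 by rewrite YX X0 mulr0.
(* Here H : a^2 and H : b^2 enter: [m] and its square both have equal xx and zz entries, and when
   [m] does, those of its square differ by m_xy^2. *)
have sq m : m^T = m -> block m -> block (contr H m) -> block (contr H (m *m m)) ->
    axial (ev R o1) m.
  move=> sm bm b1 b2; have e1 := ker0 _ sm bm b1.
  have e2 := ker0 _ (sqr_tr sm) (sqr_block sm bm) b2; move: e2.
  have [m02 m12] := bm; have m20 := tr_entry o2 o0 sm; have m21 := tr_entry o2 o1 sm.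
  have m10 := tr_entry o1 o0 sm; rewrite !mulmx3 m20 m21 m02 m12 m10 e1 => e2.
  have m01 : m o0 o1 = 0 by apply/eqP; rewrite -sqrf_eq0; apply/eqP; lra.
  by rewrite (sym_diag3 sm m01 m02 m12) e1; apply: axial_diag1.
split; [exact: unitv_ev| | | |].
- by case: sa => ? _; apply: sq.
- by case: sb => ? _; apply: sq.
- have d01 : d2 H o0 o1 = 0 by rewrite !hd X0 Y0; ring.
  rewrite (sym_diag3 (d2_tr sH) d01 d02 d12) (ker0 _ (d2_tr sH) bd bc).
  exact: axial_diag1.
have hc := contr_h9 hE (proj_tr (ev R o1)).
rewrite (_ : contr _ _ = diag3 (- A) (2 * A) (- A)); first exact: axial_diag1.
apply: symx3P; rewrite ?diag3_tr ?contr_tr //.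
all: by rewrite hc !projE !mxE /= ?X0 ?Y0 ?CA; ring.
Qed.

End BlockFamily.

(** The equations make p, s, q, t a geometric progression, so the binary cubic p x^3 + 3 s x^2 y + 3
    q x y^2 + t y^3 is [k] times the cube of c x + d y. *)
Lemma odd_cube (p q s t : R) : q ^+ 2 = s * t -> s ^+ 2 = p * q -> p * t = q * s ->
  ~ [/\ p = 0, q = 0, s = 0 & t = 0] -> exists c d k, [/\ k != 0, c ^+ 2 + d ^+ 2 = 1 &
   [/\ p = k * c ^+ 3, s = k * c ^+ 2 * d, q = k * c * d ^+ 2 & t = k * d ^+ 3]].
Proof.
move=> e1 e2 e3 nz; have [p0|pn] := eqVneq p 0.
  have s0 : s = 0 by apply/eqP; rewrite -sqrf_eq0 e2 p0 mul0r.
  have q0 : q = 0 by apply/eqP; rewrite -sqrf_eq0 e1 s0 mul0r.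
  exists 0, 1, t; split; rewrite ?p0 ?q0 ?s0; first by apply/eqP => t0; case: nz.
    by ring.
  by split; ring.
pose r := Num.sqrt (p ^+ 2 + s ^+ 2).
have r2 : r ^+ 2 = p ^+ 2 + s ^+ 2 by rewrite sqr_sqrtr // addr_ge0 ?sqr_ge0.
have rn : r != 0.
  apply/eqP => r0; move: r2; rewrite r0 expr0n => /esym/sum_sqr_eq0[p0].
  by rewrite p0 eqxx in pn.
have qE : q = s ^+ 2 / p by rewrite e2; field.
have tE : t = s ^+ 3 / p ^+ 2 by apply: (mulfI pn); rewrite e3 qE; field.
exists (p / r), (s / r), (r ^+ 3 / p ^+ 2); split.
- by rewrite mulf_neq0 ?expf_neq0 ?invr_neq0 ?expf_neq0.
- by rewrite !expr_div_n -mulrDl -r2 divff // expf_neq0.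
by split; rewrite ?qE ?tE; field; rewrite ?pn ?rn.
Qed.

(** ([N1], [N2], [N3]) is the cross product of the rows (p, q, s) and (s, t, q); when it is nonzero,
    its multiples are the vectors orthogonal to both. *)
Lemma cross_line (p q s t u v w : R) :
  p * u + q * v + s * w = 0 -> s * u + t * v + q * w = 0 ->
  let N1 := q ^+ 2 - s * t in let N2 := s ^+ 2 - p * q in let N3 := p * t - q * s in
  ~ [/\ N1 = 0, N2 = 0 & N3 = 0] ->
  exists l, [/\ u = l * N1, v = l * N2 & w = l * N3].
Proof.
move=> e1 e2 N1 N2 N3 Nn; pose NN := N1 ^+ 2 + N2 ^+ 2 + N3 ^+ 2.
have NNn : NN != 0.
  apply/eqP => NN0; apply: Nn.
  have z (x : R) : x ^+ 2 = 0 -> x = 0 by move/eqP; rewrite sqrf_eq0 => /eqP.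
  have := (sqr_ge0 N1, sqr_ge0 N2, sqr_ge0 N3); rewrite /NN in NN0.
  by move=> [[h1 h2] h3]; split; apply: z; lra.
exists ((u * N1 + v * N2 + w * N3) / NN).
have key x N : NN * x - (u * N1 + v * N2 + w * N3) * N = 0 ->
    x = (u * N1 + v * N2 + w * N3) / NN * N.
  by move=> e; apply: (mulfI NNn); rewrite mulrA mulrCA divff // mulr1; lra.
split; apply: key; rewrite /NN.
- transitivity (N2 * ((s * u + t * v + q * w) * s - (p * u + q * v + s * w) * q)
    - N3 * ((s * u + t * v + q * w) * q - (p * u + q * v + s * w) * t)).
    by rewrite /N1 /N2 /N3; ring.
  by rewrite e1 e2; ring.
- transitivity (N3 * ((s * u + t * v + q * w) * p - (p * u + q * v + s * w) * s)
    - N1 * ((s * u + t * v + q * w) * s - (p * u + q * v + s * w) * q)).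
    by rewrite /N1 /N2 /N3; ring.
  by rewrite e1 e2; ring.
transitivity (N1 * ((s * u + t * v + q * w) * q - (p * u + q * v + s * w) * t)
    - N2 * ((s * u + t * v + q * w) * p - (p * u + q * v + s * w) * s)).
  by rewrite /N1 /N2 /N3; ring.
by rewrite e1 e2; ring.
Qed.

Lemma block_diag m : m^T = m -> block m -> exists c d, c ^+ 2 + d ^+ 2 = 1 /\
  exists x y z, frm (rzm c d) m = diag3 x y z.
Proof.
move=> sm bm; have [c [d [cd al]]] := align2 ((m o0 o0 - m o1 o1) / 2) (m o0 o1).
exists c, d; split=> //; have [b02 b12] := frm_block c d bm.
have sf : (frm (rzm c d) m)^T = frm (rzm c d) m by rewrite frm_tr sm.
exists (frm (rzm c d) m o0 o0), (frm (rzm c d) m o1 o1), (frm (rzm c d) m o2 o2).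
apply: sym_diag3 => //; have m10 := tr_entry o1 o0 sm; have [m02 m12] := bm.
by rewrite !mulmx3 !mxE /= m10 m02 m12; lra.
Qed.

(** A diagonalizable matrix annihilated by a monic quadratic polynomial has at most two eigenvalues;
    in dimension 3 one is repeated, and the remaining eigenvector is the axis. *)
Lemma quad_axial m x y : m^T = m -> block m -> m *m m = x *: m + y%:M ->
  exists2 n, unitv n & axial n m.
Proof.
move=> sm bm mm; have [c [d [cd [u [v [w fE]]]]]] := block_diag sm bm.
have rz := rzm_rotation cd; set h := rzm c d in fE rz.
have [i ax] : exists i, axial (ev R i) (frm h m).
  have := congr1 (frm h) mm; rewrite frm_mul // frmD frmZ -scalemx1 frmZ frm1 // fE.
  move/matrixP => e; have := (e o0 o0, e o1 o1, e o2 o2).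
  rewrite !mulmx3 !mxE /= => -[[e0 e1] e2].
  have [->|uv] := eqVneq u v; first by exists o2; apply: axial_diag2.
  have [->|uw] := eqVneq u w; first by exists o1; apply: axial_diag1.
  have [->|vw] := eqVneq v w; first by exists o0; apply: axial_diag0.
  have uvx : u + v = x.
    by apply: (mulfI (_ : u - v != 0)); rewrite ?subr_eq0 //; lra.
  have uwx : u + w = x.
    by apply: (mulfI (_ : u - w != 0)); rewrite ?subr_eq0 //; lra.
  by case/eqP: vw; lra.
exists (h *m ev R i).
  by have := unitv_frame (rotation_tr rz) (unitv_ev R i); rewrite trmxK.
by have := axial_frame (rotation_tr rz) ax; rewrite frmK // trmxK.
Qed.

End InvolutionSymmetry.

Section InvolutionDichotomy.
Variable R : realType.
Implicit Types (g h m r a b : 'M[R]_3) (n : 'cV[R]_3) (H : tensor R 4).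

(** Modulo scalars a block symmetric matrix is the vector (m_xx - m_zz, m_yy - m_zz, 2 m_xy), and
    [cross_line] puts both vectors on one line. *)
Lemma block_span (p q s t : R) m m' : m^T = m -> m'^T = m' -> block m -> block m' ->
  ~ [/\ q ^+ 2 - s * t = 0, s ^+ 2 - p * q = 0 & p * t - q * s = 0] ->
  (p * (m o0 o0 - m o2 o2) + q * (m o1 o1 - m o2 o2) + s * (2 * m o0 o1) = 0 /\
   s * (m o0 o0 - m o2 o2) + t * (m o1 o1 - m o2 o2) + q * (2 * m o0 o1) = 0) ->
  (p * (m' o0 o0 - m' o2 o2) + q * (m' o1 o1 - m' o2 o2) + s * (2 * m' o0 o1) = 0 /\
   s * (m' o0 o0 - m' o2 o2) + t * (m' o1 o1 - m' o2 o2) + q * (2 * m' o0 o1) = 0) ->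
  (forall k, m <> k%:M) -> exists x y, m' = x *: m + y%:M.
Proof.
move=> sm sm' [m02 m12] [m02' m12'] Nn [e1 e2] [e1' e2'] ms.
have [l [lU lV lW]] := cross_line e1 e2 Nn.
have [l' [lU' lV' lW']] := cross_line e1' e2' Nn.
have ln : l != 0.
  apply/eqP => l0; apply: (ms (m o2 o2)); move: lU lV lW; rewrite l0 !mul0r => lU lV lW.
  by apply: symx3P; rewrite ?tr_scalar_mx // !mxE /= ?mulr1n ?mulr0n; lra.
exists (l' / l), (m' o2 o2 - l' / l * m o2 o2).
have sc (x x' z : R) : x = l * z -> x' = l' * z -> x' = l' / l * x.
  by move=> -> ->; field.
have f1 := sc _ _ _ lU lU'; have f2 := sc _ _ _ lV lV'; have f3 := sc _ _ _ lW lW'.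
set k := l' / l in f1 f2 f3 *.
apply: symx3P; rewrite ?linearD ?linearZ /= ?sm ?tr_scalar_mx //;
  rewrite !mxE /= ?mulr1n ?mulr0n ?m02 ?m12 ?m02' ?m12'; lra.
Qed.

Lemma traceless_nonscalar m k : m != 0 -> \tr m = 0 -> m <> k%:M.
Proof.
move=> mn tm mk; case/eqP: mn; move: tm; rewrite mk mxtrace_scalar => /eqP.
by rewrite mulrn_eq0 /= => /eqP ->; rewrite raddf0.
Qed.

Lemma axial_nonscalar n m : axial n m -> (forall k, m <> k%:M) ->
  exists x y, x != 0 /\ m = x *: proj n + y%:M.
Proof.
move=> [x [y mE]] ms; exists x, y; split=> //; apply/eqP => x0.
by apply: (ms y); rewrite mE x0 scale0r add0r.
Qed.

Lemma comm_axial g n m x y : x != 0 -> m = x *: proj n + y%:M ->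
  g *m m = m *m g -> g *m proj n = proj n *m g.
Proof.
move=> xn ->; rewrite mulmxDr mulmxDl scalar_mxC => /addIr.
by rewrite -scalemxAr -scalemxAl => /(scalerI xn).
Qed.

(** Whether [H] is cubic or zero, an edge direction of the cube is an axis. *)
Lemma cubic_coaxial H : in_H4 H -> (exists k, d2 H = k%:M) ->
  exists n, coaxial H 0 0 n.
Proof.
move=> hH [k dk]; have sH : totally_symmetric H by case: hH.
have [h [c [rh hE]]] := isotropic_d2_cubic hH dk.
exists (h *m ev R o0); apply: coaxial_unframe => //.
have f0 : frm h 0 = 0 by rewrite /frm mulmx0 mul0mx.
have x0 n : axial n (0 : 'M[R]_3) by rewrite -(raddf0 (@scalar_mx R 3)); apply: axial_scalar.
rewrite f0; split=> //; first exact: unitv_ev.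
  by rewrite d2_frame // dk -scalemx1 frmZ frm1 // scalemx1; apply: axial_scalar.
rewrite (contr_cubic hE) ?proj_tr //; last exact: act_sym.
apply: axialD; last by apply: axialD; [apply/axialZ/axial_proj | apply: axial_scalar].
apply: axialZ; rewrite !projE !mxE /=.
by rewrite !mul0r !mul1r; apply: axial_diag0.
Qed.

Section BlockDichotomy.
Variables (H : tensor R 4) (a b : 'M[R]_3).
Hypotheses (hH : in_H4 H) (sa : sym_traceless a) (sb : sym_traceless b).
Hypothesis blk : forall m, List.In m (Lo H a b) -> block m.

(** The cases are the ranks of the two linear equations. Rank 0 makes [H] even in z, rank 1 leads to
    [odd_cube_coaxial] after a rotation about z, and rank 2 confines [ker] to a line modulo
    scalars. *)
Lemma block_even_or_coaxial : act (rpi R) H = H \/ exists n, coaxial H a b n.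
Proof.
have sH : totally_symmetric H by case: hH.
have [A [B [C [X [Y [p [q [s [t hE]]]]]]]]] := harmonic_param hH.
have [[p0 q0 s0 t0]|odd] := pselect [/\ p = 0, q = 0, s = 0 & t = 0].
  by left; apply: odd0_fix => //; rewrite hE p0 q0 s0 t0.
have [[N1 N2 N3]|Nn] := pselect [/\ q ^+ 2 - s * t = 0, s ^+ 2 - p * q = 0 & p * t - q * s = 0].
  right.
  have e1 : q ^+ 2 = s * t by lra.
  have e2 : s ^+ 2 = p * q by lra.
  have e3 : p * t = q * s by lra.
  have [c [d [k [kn cd [pE sE qE tE]]]]] := odd_cube e1 e2 e3 odd.
  have rz := rzm_rotation cd.
  exists (rzm c d *m ev R o1); apply: coaxial_unframe => //.
  have hE' := frame_z_h9 hH hE cd.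
  have cd3 : (c ^+ 2 + d ^+ 2) ^+ 3 = 1 by rewrite cd expr1n.
  have [A' [B' [C' [X' [Y' {}hE']]]]] : exists A B C X Y,
      get4 (act (rzm c d)^T H) = h9 A B C X Y k 0 0 0.
    do 5 eexists; rewrite hE' pE qE sE tE; congr h9; [| ring | ring | ring].
    by transitivity (k * (c ^+ 2 + d ^+ 2) ^+ 3); [ring | rewrite cd3 mulr1].
  apply: (odd_cube_coaxial _ _ _ _ kn hE').
  - exact: in_H4_frame.
  - exact: sym_traceless_frm.
  - exact: sym_traceless_frm.
  rewrite Lo_frame // => m /List.in_map_iff[m0 [<- m0L]].
  by apply: frm_block; apply: blk.
have [[bd ba bb bc bc4] [bHa bHb bHaa bHbb]] :
  [/\ block (d2 H), block a, block b, block (c3 H) & block (c4 H)] /\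
  [/\ block (contr H a), block (contr H b), block (contr H (a *m a))
    & block (contr H (b *m b))].
  by split; split; apply: blk; rewrite /=; auto 12.
pose ker m := p * (m o0 o0 - m o2 o2) + q * (m o1 o1 - m o2 o2) + s * (2 * m o0 o1) = 0 /\
   s * (m o0 o0 - m o2 o2) + t * (m o1 o1 - m o2 o2) + q * (2 * m o0 o1) = 0.
have kerP m : m^T = m -> block m -> block (contr H m) -> ker m by apply: block_ker hE.
have sd := d2_tr sH; have sc3 : (c3 H)^T = c3 H by apply: contr_tr.
have kd := kerP _ sd bd bc; have kc := kerP _ sc3 bc bc4.
have [[ta na] [tb nb]] := (sa, sb).
have ka := kerP _ ta ba bHa; have kb := kerP _ tb bb bHb.
have sq_tr m : m^T = m -> (m *m m)^T = m *m m by move=> sm; rewrite trmx_mul sm.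
have sq_bl m : m^T = m -> block m -> block (m *m m).
  move=> sm [m02 m12]; have m20 := tr_entry o2 o0 sm; have m21 := tr_entry o2 o1 sm.
  by split; rewrite mulmx3 m02 m12; ring.
have kaa := kerP _ (sq_tr _ ta) (sq_bl _ ta ba) bHaa.
have kbb := kerP _ (sq_tr _ tb) (sq_bl _ tb bb) bHbb.
(* all of ker lies in the span of 1 and any of its non-scalar members *)
have span m m' : m^T = m -> m'^T = m' -> block m -> block m' -> ker m -> ker m' ->
    (forall k, m <> k%:M) -> exists x y, m' = x *: m + y%:M.
  by move=> *; apply: (@block_span p q s t).
have all_axial m n : m^T = m -> block m -> ker m -> (forall k, m <> k%:M) -> axial n m ->
    [/\ axial n a, axial n b, axial n (d2 H) & axial n (c3 H)].
  move=> sm bm km ms xm.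
  have ext m' : m'^T = m' -> block m' -> ker m' -> axial n m'.
    move=> sm' bm' km'; have [x [y ->]] := span m m' sm sm' bm bm' km km' ms.
    by apply: axialD; [apply: axialZ | apply: axial_scalar].
  by split; apply: ext.
have finish n : unitv n -> axial n a -> axial n b -> axial n (d2 H) -> axial n (c3 H) ->
    (forall k, d2 H <> k%:M) -> exists n, coaxial H a b n.
  move=> un xa xb xd xc ds; exists n; split=> //.
  have [x [y [xn dE]]] := axial_nonscalar xd ds.
  exact: (contr_proj_axial hH xn dE).
(* Serves for [a] and for [b]: the square of [m] is affine in [m], so [m] has a repeated eigenvalue,
   and its axis is shared by all of [ker]. *)
have with_m m : m != 0 -> sym_traceless m -> block m -> block (contr H m) -> ker m ->
    ker (m *m m) -> act (rpi R) H = H \/ exists n, coaxial H a b n.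
  move=> mn [sm tm] bm bHm km kmm.
  have ms k : m <> k%:M by apply: traceless_nonscalar.
  have [x [y mm]] := span m (m *m m) sm (sq_tr _ sm) bm (sq_bl _ sm bm) km kmm ms.
  have [n un xm] := quad_axial sm bm mm.
  have [xa xb xd xc] := all_axial m n sm bm km ms xm.
  (* A nonscalar [d2 H] yields H : nn through [c3 H]. If [d2 H] is scalar, [H] is zero or cubic and
     [cubic_involution] decides. *)
  have [[k dk]|ds] := pselect (exists k, d2 H = k%:M); last first.
    by right; apply: (finish n) => // k dk; apply: ds; exists k.
  have [u [v [un0 mE]]] := axial_nonscalar xm ms.
  have rr := rpi_rotation R; have mr := block_comm sm bm.
  have pr := comm_axial un0 mE mr.
  have cE : contr H m = u *: contr H (proj n).
    by rewrite mE contrD contrZ -scalemx1 contrZ contr1 // scaler0 addr0.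
  have cr : rpi R *m contr H (proj n) = contr H (proj n) *m rpi R.
    apply: (scalerI un0); rewrite [LHS]scalemxAr [RHS]scalemxAl -cE.
    by apply: block_comm => //; apply: contr_tr.
  have [h [c [rh hE']]] := isotropic_d2_cubic hH dk.
  have := @cubic_involution R (act h^T H) c (h^T *m n) (frm h (rpi R)).
  case=> //.
  - exact: in_H4_frame.
  - exact: unitv_frame.
  - exact: frm_rotation.
  - move=> e; have /matrixP/(_ o0 o0) : rpi R = 1%:M by apply: (frm_inj rh); rewrite e frm1.
    rewrite !mxE /= mulr1n => e'; have /eqP : 2 = 0 :> R by lra.
    by rewrite pnatr_eq0.
  - rewrite -frm_mul //; have -> : rpi R *m rpi R = 1%:M.
      by apply: mx3P; rewrite mulmx3 !mxE /= ?mulr1n ?mulr0n; ring.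
    by rewrite frm1.
  - by rewrite -frm_proj; apply/frm_comm.
  - by rewrite -frm_proj contr_frame //; apply/frm_comm.
  - by move/(act_conj_fix H rr rh); left.
  rewrite -frm_proj contr_frame // => /(axial_frame (rotation_tr rh)).
  rewrite frmK // trmxK mulmxA rotation_mulmV // mul1mx => xc'.
  by right; exists n; split.
have [a0|an] := eqVneq a 0; last exact: (with_m a).
have [b0|bn] := eqVneq b 0; last exact: (with_m b).
have [ds|ds] := pselect (exists k, d2 H = k%:M).
  by right; rewrite a0 b0; apply: cubic_coaxial.
have {}ds k : d2 H <> k%:M by move=> dk; apply: ds; exists k.
have [x [y c3E]] := span _ _ sd sc3 bd bc kd kc ds.
have [c [d [cd [u [v [w fE]]]]]] := block_diag sd bd.
have rz := rzm_rotation cd; set h := rzm c d in fE rz.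
have hH' := in_H4_frame rz hH; have sH' : totally_symmetric (act h^T H) by case: hH'.
have dE' : d2 (act h^T H) = diag3 u v w by rewrite d2_frame.
have cE' : c3 (act h^T H) = x *: diag3 u v w + y%:M.
  by rewrite /c3 d2_frame // contr_frame // -/(c3 H) c3E frmD frmZ fE -scalemx1 frmZ frm1.
(* A repeated eigenvalue of [d2 H] gives the axis. For distinct ones the odd part vanishes in the
   eigenframe, which is obtained by a rotation about z and so leaves [rpi] unchanged. *)
have [[i xi]|] : (exists i, axial (ev R i) (frm h (d2 H))) \/ act (rpi R) H = H; last by left.
  rewrite fE.
  have [->|uv] := eqVneq u v; first by left; exists o2; apply: axial_diag2.
  have [->|uw] := eqVneq u w; first by left; exists o1; apply: axial_diag1.
  have [->|vw] := eqVneq v w; first by left; exists o0; apply: axial_diag0.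
  right; have [A' [B' [C' [X' [Y' [p' [q' [s' [t' hE']]]]]]]]] := harmonic_param hH'.
  have [] := contr_coaxial_diag_odd0 hE' sH';
    rewrite ?cE' ?dE' ?mxE /= ?mulr1n ?mulr0n ?mulr0 ?addr0 //; first by ring.
  move=> p0 q0 s0 t0; apply/(act_conj_fix H (rpi_rotation R) rz).
  rewrite -/(frm h (rpi R)) frm_rpi //; apply: (odd0_fix hH').
  by rewrite hE' p0 q0 s0 t0.
have xd : axial (h *m ev R i) (d2 H).
  by have := axial_frame (rotation_tr rz) xi; rewrite frmK // trmxK.
have un : unitv (h *m ev R i).
  by have := unitv_frame (rotation_tr rz) (unitv_ev R i); rewrite trmxK.
have [xa xb _ xc] := all_axial _ _ sd bd kd ds xd.
by right; apply: (finish _ un).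
Qed.

End BlockDichotomy.

Lemma involution_sym_or_coaxial H a b r : in_H4 H -> sym_traceless a -> sym_traceless b ->
  symM (Lo H a b) r -> r <> 1%:M -> r *m r = 1%:M ->
  act r H = H \/ exists n, coaxial H a b n.
Proof.
move=> hH sa sb [rr cr] r1 r2; have sH : totally_symmetric H by case: hH.
have [h rh fE] := involution_axis rr r1 r2.
have [] := @block_even_or_coaxial (act h^T H) (frm h a) (frm h b).
- exact: in_H4_frame.
- exact: sym_traceless_frm.
- exact: sym_traceless_frm.
- rewrite Lo_frame // => m /List.in_map_iff[m0 [<- m0L]].
  by apply: comm_rpi; rewrite /rpi -fE; apply/frm_comm => //; apply: cr.
- by rewrite /rpi -fE => /(act_conj_fix H rr rh); left.
by move=> [n /(coaxial_unframe rh sH) cn]; right; exists (h *m n).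
Qed.

End InvolutionDichotomy.

(** * Generalized cross products *)

Section CrossForms.
Variable R : realType.
Implicit Types (g h m : 'M[R]_3) (x u v w : 'cV[R]_3) (H : tensor R 4).

Definition det3 (u v w : 'I_3 -> R) : R :=
  u o0 * (v o1 * w o2 - v o2 * w o1) + u o1 * (v o2 * w o0 - v o0 * w o2)
  + u o2 * (v o0 * w o1 - v o1 * w o0).

Lemma sum_eps (u v w : 'I_3 -> R) :
  \sum_i \sum_j \sum_k eps i j k * v j * w k * u i = det3 u v w.
Proof. by rewrite !sum3 /eps /det3 /=; field. Qed.

Definition cross_unsym H m : tensor R 5 := fun idx : {ffun 'I_5 -> 'I_3} =>
  \sum_(j < 3) \sum_(k < 3) eps (idx ord0) j k
    * H [ffun i : 'I_4 => if nat_of_ord i == 0%N then j else idx (inord i)]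
    * m2t m [ffun i : 'I_2 => if nat_of_ord i == 0%N then k else idx (inord (3 + i))].

Lemma crossHE H m : crossH H m = symmetrize (cross_unsym H m).
Proof. by []. Qed.

Lemma cross_unsymE H m i1 i2 i3 i4 i5 : cross_unsym H m (idx5 i1 i2 i3 i4 i5) =
  \sum_j \sum_k eps i1 j k * get4 H j i2 i3 i4 * m k i5.
Proof.
apply: eq_bigr => j _; apply: eq_bigr => k _; congr (_ * _ * _).
- by rewrite ffunE.
- rewrite /get4; congr H; apply/ffunP => -[[|[|[|[|//]]]] Hi];
    by rewrite !ffunE /= ?inordK.
by rewrite /m2t !ffunE /= !inordK //= !inordK.
Qed.

Definition q0 := @Ordinal 5 0 isT. Definition q1 := @Ordinal 5 1 isT.
Definition q2 := @Ordinal 5 2 isT. Definition q3 := @Ordinal 5 3 isT.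
Definition q4 := @Ordinal 5 4 isT.

Lemma mform5 (T : tensor R 5) (X : 'I_5 -> 'I_3 -> R) : mform T X =
  \sum_a \sum_b \sum_c \sum_d \sum_e T (idx5 a b c d e) *
    (X q0 a * X q1 b * X q2 c * X q3 d * X q4 e).
Proof.
rewrite /mform sum_ffun5; do 5 (apply: eq_bigr => ? _).
rewrite !big_ord_recr big_ord0 /= mul1r !ffunE /=; congr (_ * (X _ _ * X _ _ * X _ _ * X _ _ * X _ _)).
all: exact: val_inj.
Qed.

Definition trilin H (y1 y2 y3 : 'I_3 -> R) (j : 'I_3) : R :=
  \sum_b \sum_c \sum_d get4 H j b c d * (y1 b * y2 c * y3 d).

Lemma mform_cross H m (X : 'I_5 -> 'I_3 -> R) : mform (cross_unsym H m) X =
  det3 (X q0) (trilin H (X q1) (X q2) (X q3)) (fun k => \sum_e m k e * X q4 e).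
Proof.
rewrite mform5 -sum_eps; apply: eq_bigr => a _.
transitivity (\sum_b \sum_c \sum_d \sum_e \sum_j \sum_k
  (eps a j k * X q0 a) * (get4 H j b c d * (X q1 b * X q2 c * X q3 d)) * (m k e * X q4 e)).
  do 4 (apply: eq_bigr => ? _).
  rewrite cross_unsymE mulr_suml; apply: eq_bigr => j _; rewrite mulr_suml.
  by apply: eq_bigr => k _; ring.
rewrite [LHS](eq_bigr (fun b => \sum_j \sum_k \sum_c \sum_d \sum_e
  (eps a j k * X q0 a) * (get4 H j b c d * (X q1 b * X q2 c * X q3 d)) * (m k e * X q4 e)));
  last first.
  move=> b _; rewrite [RHS]exchange_big /=.
  under [RHS]eq_bigr => k _ do rewrite exchange_big /=.
  under [LHS]eq_bigr => c _.
    under eq_bigr => d _.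
      rewrite exchange_big /=.
      under eq_bigr => j _ do rewrite exchange_big /=.
      rewrite exchange_big /=. over.
    over.
  under [LHS]eq_bigr => c _ do rewrite exchange_big /=.
  rewrite [LHS]exchange_big /=; apply: eq_bigr => k _.
  apply: eq_bigr => c _; rewrite exchange_big /=; apply: eq_bigr => j _.
  by [].
rewrite exchange_big /=; apply: eq_bigr => j _.
rewrite exchange_big /=; apply: eq_bigr => k _.
transitivity ((eps a j k * X q0 a) * trilin H (X q1) (X q2) (X q3) j *
  \sum_e m k e * X q4 e); last by ring.
rewrite /trilin [X in _ = X * _]mulr_sumr [RHS]mulr_suml; apply: eq_bigr => b _.
rewrite [X in _ = X * _]mulr_sumr [RHS]mulr_suml; apply: eq_bigr => c _.
rewrite [X in _ = X * _]mulr_sumr [RHS]mulr_suml; apply: eq_bigr => d _.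
by rewrite mulr_sumr.
Qed.

End CrossForms.

Section CrossVanishing.
Variable R : realType.
Implicit Types (g h m : 'M[R]_3) (x u v w : 'cV[R]_3) (H : tensor R 4).

(** Replaces a sum over the symmetric group by a sum over a list that can be computed, with 120
    terms for n = 5. *)
Lemma sum_perm_seq n (F : seq nat -> R) :
  \sum_(s : 'S_n) F [seq nat_of_ord (s i) | i <- enum 'I_n] =
  \sum_(l <- permutations (iota 0 n)) F l.
Proof.
pose f (s : 'S_n) := [seq nat_of_ord (s i) | i <- enum 'I_n].
rewrite -(big_map f xpredT F); apply: perm_big.
have finj : injective f.
  move=> s1 s2 e; apply/permP => i; apply: val_inj.
  have := congr1 (fun l => nth 0%N l i) e.
  by rewrite /f !(nth_map i) -?enumT ?size_enum_ord ?nth_ord_enum.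
apply: uniq_perm.
- by rewrite map_inj_uniq // index_enum_uniq.
- exact: permutations_uniq.
move=> l; rewrite mem_permutations; apply/mapP/idP => [[s _ ->]|].
  rewrite /f map_comp -val_enum_ord; apply: perm_map.
  apply: uniq_perm; [|exact: enum_uniq|].
    by rewrite (map_inj_uniq (@perm_inj _ s)) enum_uniq.
  move=> i; rewrite mem_enum; apply/mapP; exists (s^-1 i)%g; rewrite ?mem_enum ?permKV //.
rewrite -val_enum_ord => ll.
have szl : size l == n by rewrite (perm_size ll) size_map size_enum_ord.
have : perm_eq (Tuple szl) [tuple nat_of_ord i | i < n].
  by rewrite /= (_ : map _ _ = map val (enum 'I_n)).
case/tuple_permP => s es; exists s; first by rewrite mem_index_enum.
rewrite [l]es /f; apply: eq_map => i /=.
by rewrite tnth_mktuple.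
Qed.

Lemma form_ttr5 (S : tensor R 5) (y : 'I_3 -> R) : form (ttr (n := 3) S) y =
  \sum_i mform S (fun k r => if (k < 2)%N then (r == i)%:R else y r).
Proof.
transitivity (\sum_a \sum_b \sum_c \sum_i S (idx5 i i a b c) * (y a * y b * y c)).
  rewrite /form /mform /ttr sum_ffun3; do 3 (apply: eq_bigr => ? _).
  rewrite mulr_suml; apply: eq_bigr => i _.
  rewrite !big_ord_recr big_ord0 /= mul1r; congr (S _ * _); last by rewrite !ffunE.
  apply/ffunP => m; rewrite !ffunE.
  by case: splitP => -[r Hr] /= em; rewrite ?ffunE em;
    move: r Hr {em}; do 4?[case=> [|] //].
under eq_bigr => a _ do under eq_bigr => b _ do rewrite exchange_big /=.
under eq_bigr => a _ do rewrite exchange_big /=.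
rewrite exchange_big /=; apply: eq_bigr => i _; rewrite mform5 /=.
transitivity (\sum_j \sum_k (j == i)%:R * (k == i)%:R *
   \sum_a \sum_b \sum_c S (idx5 j k a b c) * (y a * y b * y c)).
  rewrite [RHS](bigD1 i) //= [X in _ = _ + X]big1 ?addr0 => [|j /negbTE ji]; last first.
    by rewrite big1 // => k _; rewrite ji !mul0r.
  rewrite [RHS](bigD1 i) //= [X in _ = _ + X]big1 ?addr0 => [|j /negbTE ji]; last first.
    by rewrite ji mulr0 mul0r.
  by rewrite eqxx !mul1r.
do 2 (apply: eq_bigr => ? _); rewrite mulr_sumr; apply: eq_bigr => ? _.
rewrite mulr_sumr; apply: eq_bigr => ? _; rewrite mulr_sumr; apply: eq_bigr => ? _.
ring.
Qed.

Lemma trilin_swap12 H y1 y2 y3 j : totally_symmetric H ->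
  trilin H y1 y2 y3 j = trilin H y2 y1 y3 j.
Proof.
move=> sH; rewrite /trilin exchange_big; do 3 (apply: eq_bigr => ? _).
rewrite [_ * y1 _]mulrC; congr (_ * _); apply: get4_perm => //.
by apply/seq.permP => c /=; lia.
Qed.

Lemma trilin_swap23 H y1 y2 y3 j : totally_symmetric H ->
  trilin H y1 y2 y3 j = trilin H y1 y3 y2 j.
Proof.
move=> sH; apply: eq_bigr => b _; rewrite exchange_big; do 2 (apply: eq_bigr => ? _).
rewrite mulrAC; congr (_ * _); apply: get4_perm => //.
by apply/seq.permP => c /=; lia.
Qed.

(** The only kind of term that survives in the trace of the cross product: one traced index on [H],
    the other on [m]. *)
Definition trQ H m (y : 'I_3 -> R) : R :=
  \sum_i det3 y (trilin H (fun r => (r == i)%:R) y y) (fun k => m k i).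

(** Symmetrization spreads the two traced slots evenly over the ten pairs of slots. A pair
    containing the slot of the Levi-Civita tensor gives 0 by symmetry of [H] or of [m], a pair
    inside [H] gives 0 by tracelessness, and the three pairs joining [H] to [m] give [trQ]: hence
    3/10. *)
Lemma form_trcross H m y : in_H4 H -> m^T = m ->
  form (trcrossH H m) y = 3 / 10 * trQ H m y.
Proof.
move=> hH sm; rewrite /trcrossH form_ttr5 crossHE.
pose Z (i : 'I_3) (b : bool) r : R := if b then (r == i)%:R else y r.
pose K b0 b1 b2 b3 b4 : R := \sum_i det3 (Z i b0) (trilin H (Z i b1) (Z i b2) (Z i b3))
   (fun k => \sum_e m k e * Z i b4 e).
pose G (l : seq nat) := K (nth 0 l 0 < 2)%N (nth 0 l 1 < 2)%N (nth 0 l 2 < 2)%N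
   (nth 0 l 3 < 2)%N (nth 0 l 4 < 2)%N.
under eq_bigr => i _ do rewrite mform_symmetrize.
rewrite -mulr_sumr exchange_big /=.
transitivity (5`!%:R^-1 * \sum_(l <- permutations (iota 0 5)) G l : R).
  congr (_ * _); rewrite -sum_perm_seq; apply: eq_bigr => s _.
  rewrite /G; have nthE (k : 'I_5) : nth 0%N [seq nat_of_ord (s i) | i <- enum 'I_5] k = s k.
    by rewrite (nth_map k) ?size_enum_ord ?nth_ord_enum.
  rewrite (nthE q0) (nthE q1) (nthE q2) (nthE q3) (nthE q4).
  by apply: eq_bigr => i _; rewrite mform_cross.
have [A [B [C [X [Y [p [q [s [t hE]]]]]]]]] := harmonic_param hH.
have m10 := tr_entry o1 o0 sm; have m20 := tr_entry o2 o0 sm; have m21 := tr_entry o2 o1 sm.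
have K1 : K true true false false false = 0.
  by rewrite /K !sum3 /det3 /trilin !sum3 /Z /= hE /h9 /= m10 m20 m21; ring.
have K2 : K true false false false true = 0.
  by rewrite /K !sum3 /det3 /trilin !sum3 /Z /= hE /h9 /= m10 m20 m21; ring.
have K3 : K false true true false false = 0.
  by rewrite /K !sum3 /det3 /trilin !sum3 /Z /= hE /h9 /= m10 m20 m21; ring.
have K4 : K false true false false true = trQ H m y.
  apply: eq_bigr => i _; rewrite /det3.
  have mE k : \sum_e m k e * Z i true e = m k i.
    rewrite (bigD1 i) //= big1 ?addr0 /Z ?eqxx ?mulr1 // => e /negbTE ei.
    by rewrite ei mulr0.
  by rewrite !mE.
have sH : totally_symmetric H by case: hH.
have S12 b0 b1 b2 b3 b4 : K b0 b1 b2 b3 b4 = K b0 b2 b1 b3 b4.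
  by apply: eq_bigr => i _; rewrite /det3 !(trilin_swap12 (Z i b1)).
have S23 b0 b1 b2 b3 b4 : K b0 b1 b2 b3 b4 = K b0 b1 b3 b2 b4.
  by apply: eq_bigr => i _; rewrite /det3 !(trilin_swap23 _ (Z i b2)).
have E3 : K true false true false false = 0 by rewrite S12 K1.
have E4 : K true false false true false = 0 by rewrite S23 E3.
have E5 : K false true false true false = 0 by rewrite S23 K3.
have E6 : K false false true true false = 0 by rewrite S12 E5.
have E7 : K false false true false true = trQ H m y by rewrite S12 K4.
have E8 : K false false false true true = trQ H m y by rewrite S23 E7.
rewrite (_ : permutations (iota 0 5) = ltac:(let t := eval vm_compute in
  (permutations (iota 0 5)) in exact t)); last by vm_compute.
rewrite !big_cons big_nil /G /= ?(K1, K2, K3, K4, E3, E4, E5, E6, E7, E8).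
by rewrite ?(add0r, addr0) (_ : 5`! = 120)%N //; field.
Qed.

Lemma symmetrize_totally_sym n (T : tensor R n) : totally_symmetric (symmetrize T).
Proof.
move=> s idx; rewrite /symmetrize; congr (_ * _).
rewrite (reindex_inj (mulIg s^-1%g)) /=; apply: eq_bigr => r _.
by congr T; apply/ffunP => k; rewrite !ffunE permM permKV.
Qed.

Lemma ttr_totally_sym n (T : tensor R n.+2) :
  totally_symmetric T -> totally_symmetric (ttr T).
Proof.
move=> sT s idx; apply: eq_bigr => i _.
pose f (k : 'I_(2 + n)) : 'I_(2 + n) := match split k with
  inl j => lshift n j | inr j => rshift 2 (s j) end.
have finj : injective f.
  move=> k1 k2; rewrite /f; case: (splitP k1) => j1 e1; case: (splitP k2) => j2 e2.
  - by move/lshift_inj => jj; apply: val_inj; rewrite /= e1 e2 jj.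
  - by move/eqP; rewrite eq_lrshift.
  - by move/eqP; rewrite eq_rlshift.
  by move/rshift_inj/perm_inj => jj; apply: val_inj; rewrite /= e1 e2 jj.
rewrite -[RHS](sT (perm finj)); congr T; apply/ffunP => k; rewrite !ffunE permE /f.
have e1 (j : 'I_2) : split (lshift n j) = inl j := unsplitK (inl j).
have e2 (j : 'I_n) : split (rshift 2 j) = inr j := unsplitK (inr j).
by case: (@splitP 2 n k) => j ek; rewrite ?e1 ?e2 ?ffunE.
Qed.

End CrossVanishing.

Section TraceCrossVanishing.
Variable R : realType.
Implicit Types (g h m : 'M[R]_3) (x u v w : 'cV[R]_3) (H : tensor R 4).

Lemma trcross0P H m : in_H4 H -> m^T = m ->
  trcrossH H m = tzero R 3 <-> forall y, trQ H m y = 0.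
Proof.
move=> hH sm; split=> [tr0 y|Q0].
  have := form_trcross y hH sm; rewrite tr0 /form /mform big1 => [e|j _].
    apply: (mulfI (_ : 3 / 10 != 0 :> R)); last by rewrite -e mulr0.
    by rewrite mulf_neq0 ?invr_eq0 ?pnatr_eq0.
  by rewrite mul0r.
apply: form_inj => [||y]; first by apply/ttr_totally_sym/symmetrize_totally_sym.
  by [].
rewrite form_trcross // Q0 mulr0 /form /mform big1 // => j _; exact: mul0r.
Qed.

Lemma symmetrize0P n (T : tensor R n) :
  symmetrize T = tzero R n <-> forall y, form T y = 0.
Proof.
split=> [T0 y|]; last exact: form0_symmetrize.
by rewrite -form_symmetrize T0 /form /mform big1 // => j _; exact: mul0r.
Qed.

Lemma crossH0P H m : crossH H m = tzero R 5 <->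
  forall y, det3 y (trilin H y y y) (fun k => \sum_e m k e * y e) = 0.
Proof.
rewrite crossHE symmetrize0P; split=> e y; have := e y; by rewrite /form mform_cross.
Qed.

Lemma cross20P (m1 m2 : 'M[R]_3) : cross2 m1 m2 = tzero R 3 <->
  forall y, det3 y (fun j => \sum_e m1 j e * y e) (fun k => \sum_e m2 k e * y e) = 0.
Proof.
rewrite /cross2 /cross symmetrize0P.
suff fE y : form (fun idx : {ffun 'I_3 -> 'I_3} =>
    \sum_(j < 3) \sum_(k < 3) eps (idx ord0) j k
      * m2t m1 [ffun m : 'I_2 => if nat_of_ord m == 0%N then j else idx (inord m)]
      * m2t m2 [ffun m : 'I_2 => if nat_of_ord m == 0%N then k else idx (inord (1 + m))]) y =
    det3 y (fun j => \sum_e m1 j e * y e) (fun k => \sum_e m2 k e * y e).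
  by split=> e y; have := e y; rewrite fE.
rewrite /form /mform sum_ffun3 -sum_eps; apply: eq_bigr => a _.
transitivity (\sum_b \sum_c \sum_j \sum_k (eps a j k * m1 j b * m2 k c) * (y a * y b * y c)).
  apply: eq_bigr => b _; apply: eq_bigr => c _.
  rewrite mulr_suml; apply: eq_bigr => j _; rewrite mulr_suml; apply: eq_bigr => k _.
  rewrite /m2t !ffunE /= !inordK //= ?inordK //=.
  by rewrite !big_ord_recr big_ord0 /= mul1r !ffunE.
by move: a; apply: ord3P; rewrite !sum3; ring.
Qed.

End TraceCrossVanishing.

Section CrossCovariance.
Variable R : realType.
Implicit Types (g h m N : 'M[R]_3) (H : tensor R 4) (y : 'I_3 -> R).

Definition crossP H m y : R := det3 y (trilin H y y y) (fun k => \sum_e m k e * y e).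

(** Reduces the covariance of cross products to that of [contr]. *)
Lemma trilin_contr H y1 y j :
  trilin H y1 y y j = \sum_e contr H (proj (\col_i y i)) j e * y1 e.
Proof.
apply: eq_bigr => e _; rewrite mxE mulr_suml; apply: eq_bigr => c _.
rewrite mulr_suml; apply: eq_bigr => d _; rewrite projE !mxE; ring.
Qed.

Definition rowact h y : 'I_3 -> R := fun i => \sum_j h i j * y j.

Lemma rowact_col h y : \col_i rowact h y i = h *m \col_i y i.
Proof. by apply/matrixP => i j; rewrite !mxE; apply: eq_bigr => k _; rewrite mxE. Qed.

Lemma rowactK h y : rotation h -> rowact h^T (rowact h y) = y.
Proof.
move=> rh; apply: funext => i.
have /matrixP/(_ i 0) : \col_i rowact h^T (rowact h y) i = \col_i y i.
  by rewrite !rowact_col mulmxA rotation_mulVm // mul1mx.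
by rewrite !mxE.
Qed.

Lemma rowactKV h y : rotation h -> rowact h (rowact h^T y) = y.
Proof. by move=> rh; have := rowactK y (rotation_tr rh); rewrite trmxK. Qed.

Lemma contr_proj_frame h H y : rotation h ->
  contr (act h^T H) (proj (\col_i y i)) = frm h (contr H (proj (\col_i rowact h y i))).
Proof.
move=> rh; rewrite -contr_frame // frm_proj rowact_col mulmxA.
by rewrite rotation_mulVm // mul1mx.
Qed.

Lemma rowact_frm h m y : rotation h -> rowact (frm h m) y = rowact h^T (rowact m (rowact h y)).
Proof.
move=> rh; apply: funext => i.
have /matrixP/(_ i 0) : \col_i rowact (frm h m) y i =
    \col_i rowact h^T (rowact m (rowact h y)) i.
  by rewrite !rowact_col /frm !mulmxA.
by rewrite !mxE.
Qed.

Lemma det3_frame h u v w : rotation h ->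
  det3 (rowact h^T u) (rowact h^T v) (rowact h^T w) = det3 u v w.
Proof.
move=> [_ dh]; rewrite -[RHS]mul1r -dh det33 /det3 /rowact !sum3 !mxE; ring.
Qed.

Lemma crossP_frame h H m y : rotation h ->
  crossP (act h^T H) (frm h m) y = crossP H m (rowact h y).
Proof.
move=> rh; rewrite /crossP -[RHS](det3_frame _ _ _ rh) rowactK //; congr det3.
  apply: funext => j; rewrite trilin_contr contr_proj_frame //.
  rewrite -/(rowact (frm h (contr H (proj (\col_i rowact h y i)))) y j) rowact_frm //.
  by apply: eq_bigr => i _; congr (_ * _); rewrite trilin_contr.
by rewrite -/(rowact (frm h m) y) rowact_frm.
Qed.

(** The scalar product of [y] with the vector dual to the antisymmetric part of [N], up to a
    factor. *)
Definition axl y N : R := y o0 * (N o1 o2 - N o2 o1) + y o1 * (N o2 o0 - N o0 o2)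
  + y o2 * (N o0 o1 - N o1 o0).

Lemma trQE H m y : trQ H m y = axl y (contr H (proj (\col_i y i)) *m m^T).
Proof.
rewrite /trQ /det3 /axl !mulmx3 sum3.
have tE i j : trilin H (fun r => (r == i)%:R) y y j = contr H (proj (\col_i y i)) j i.
  rewrite trilin_contr (bigD1 i) //= big1 ?addr0 ?eqxx ?mulr1 // => k /negbTE ki.
  by rewrite ki mulr0.
rewrite !tE; set N := contr _ _; rewrite ![m^T _ _]mxE; ring.
Qed.

Lemma axl_frame h y N : rotation h -> axl (rowact h^T y) (frm h N) = axl y N.
Proof.
move=> [_ dh]; rewrite -[RHS]mul1r -dh det33 /axl /rowact !sum3 /frm !mulmx3 !mxE; ring.
Qed.

Lemma trQ_frame h H m y : rotation h ->
  trQ (act h^T H) (frm h m) y = trQ H m (rowact h y).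
Proof.
move=> rh; rewrite !trQE contr_proj_frame // frm_tr -frm_mul //.
by rewrite -(axl_frame (rowact h y) _ rh) rowactK.
Qed.

Lemma trilin3_h9 H A B C X Y p q s t y : get4 H = h9 A B C X Y p q s t ->
  (trilin H y y y o0 = (B + C) * y o0 ^+ 3 + 3 * X * y o0 ^+ 2 * y o1
    + 3 * p * y o0 ^+ 2 * y o2 - 3 * C * y o0 * y o1 ^+ 2 + 6 * s * y o0 * y o1 * y o2
    - 3 * B * y o0 * y o2 ^+ 2 + Y * y o1 ^+ 3 + 3 * q * y o1 ^+ 2 * y o2
    - 3 * (X + Y) * y o1 * y o2 ^+ 2 - (p + q) * y o2 ^+ 3) *
  (trilin H y y y o1 = X * y o0 ^+ 3 - 3 * C * y o0 ^+ 2 * y o1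
    + 3 * s * y o0 ^+ 2 * y o2 + 3 * Y * y o0 * y o1 ^+ 2 + 6 * q * y o0 * y o1 * y o2
    - 3 * (X + Y) * y o0 * y o2 ^+ 2 + (A + C) * y o1 ^+ 3 + 3 * t * y o1 ^+ 2 * y o2
    - 3 * A * y o1 * y o2 ^+ 2 - (s + t) * y o2 ^+ 3).
Proof. by move=> hE; split; rewrite /trilin !sum3 hE /h9 /=; ring. Qed.

(** The last factor is, up to a constant, the derivative of the quartic form along rotations about
    z: crossing with a nonscalar axial matrix tests invariance under all of them. *)
Lemma crossP_diag H m y al be : m = diag3 al al be ->
  crossP H m y = (be - al) * y o2 *
    (y o0 * trilin H y y y o1 - y o1 * trilin H y y y o0).
Proof. by move=> ->; rewrite /crossP /det3 !sum3 !mxE /=; ring. Qed.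

Definition vec (a b c : R) (i : 'I_3) : R :=
  match nat_of_ord i with 0 => a | 1 => b | _ => c end.

(** Twelve integer points off the plane z = 0 give enough linear equations to leave weight 0
    alone. *)
Lemma crossP_diag0 H A B C X Y p q s t al be : get4 H = h9 A B C X Y p q s t ->
  be != al -> (forall y, crossP H (diag3 al al be) y = 0) ->
  [/\ A = B, B = - 4 * C, X = 0 & Y = 0] /\ [/\ p = 0, q = 0, s = 0 & t = 0].
Proof.
move=> hE ba P0; have tE y := trilin3_h9 y hE.
have {}P0 x1 x2 x3 : x3 != 0 ->
    x1 * trilin H (vec x1 x2 x3) (vec x1 x2 x3) (vec x1 x2 x3) o1
    - x2 * trilin H (vec x1 x2 x3) (vec x1 x2 x3) (vec x1 x2 x3) o0 = 0.
  move=> x3n; have := P0 (vec x1 x2 x3); rewrite (crossP_diag _ _ erefl) => /eqP.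
  by rewrite mulf_eq0 mulf_eq0 subr_eq0 (negbTE ba) (negbTE x3n) => /eqP.
have n1 : 1 != 0 :> R by apply: oner_neq0.
have n2 : -1 != 0 :> R by rewrite oppr_eq0.
have n3 : 2 != 0 :> R by rewrite pnatr_eq0.
have e1 := P0 1 0 1 n1; have e2 := P0 0 1 1 n1; have e3 := P0 1 0 (-1) n2.
have e4 := P0 0 1 (-1) n2; have e5 := P0 1 0 2 n3; have e6 := P0 0 1 2 n3.
have e7 := P0 1 1 1 n1; have e8 := P0 1 (-1) 1 n1; have e9 := P0 2 1 1 n1.
have e10 := P0 1 2 1 n1; have e11 := P0 1 1 2 n3; have e12 := P0 1 (-1) 2 n3.
rewrite !tE /vec /= in e1 e2 e3 e4 e5 e6 e7 e8 e9 e10 e11 e12.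
clear P0 tE; split; split; lra.
Qed.

End CrossCovariance.

Section AxialForms.
Variable R : realType.
Implicit Types (g h m c : 'M[R]_3) (H : tensor R 4) (y : 'I_3 -> R).

Lemma axial_ev2P m : axial (ev R o2) m <-> exists x z : R, m = diag3 x x z.
Proof.
split=> [[x1 [x2 ->]]|[x [y ->]]]; last exact: axial_diag2.
exists x2, (x1 + x2).
by apply: mx3P; rewrite mxE !mxE big_ord1 !mxE /= ?mulr1n ?mulr0n; ring.
Qed.

Lemma crossP_weight0 H C m y : get4 H = h9 (- 4 * C) (- 4 * C) C 0 0 0 0 0 0 ->
  axial (ev R o2) m -> crossP H m y = 0.
Proof.
move=> hE /axial_ev2P[x1 [x2 ->]]; have tE := trilin3_h9 y hE.
by rewrite (crossP_diag _ _ erefl) !tE; ring.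
Qed.

(** The last factor is, up to a constant, the derivative along rotations about z of the cubic H(z,
    y, y, y). Its vanishing kills weights 1, 2 and 3 but does not see weight 4, which is free of
    z. *)
Lemma trQ_diag H A B C X Y p q s t y al be : get4 H = h9 A B C X Y p q s t ->
  totally_symmetric H ->
  trQ H (diag3 al al be) y = (be - al) *
   (y o0 * (s * y o0 ^+ 2 + t * y o1 ^+ 2 - (s + t) * y o2 ^+ 2
      + 2 * (q * y o0 * y o1 - (X + Y) * y o0 * y o2 - A * y o1 * y o2))
  - y o1 * (p * y o0 ^+ 2 + q * y o1 ^+ 2 - (p + q) * y o2 ^+ 2
      + 2 * (s * y o0 * y o1 - B * y o0 * y o2 - (X + Y) * y o1 * y o2))).
Proof.
move=> hE sH; rewrite trQE diag3_tr.
set P := proj _; have sP : P^T = P by apply: proj_tr.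
have hc := contr_h9 hE sP; have sN := contr_tr P sH.
have n10 := tr_entry o1 o0 sN; have n20 := tr_entry o2 o0 sN; have n21 := tr_entry o2 o1 sN.
have PE i j : P i j = y i * y j by rewrite /P projE !mxE.
have dE i j : diag3 al al be i j = (i == j)%:R * (if i == o2 then be else al).
  by rewrite mxE; move: i j; apply: ord3P; apply: ord3P; rewrite /=; ring.
rewrite /axl !mulmx3 n10 n20 n21 !hc !PE !dE /=; ring.
Qed.

Lemma trQ_diag0 H A B C X Y p q s t al be : get4 H = h9 A B C X Y p q s t ->
  totally_symmetric H -> be != al -> (forall y, trQ H (diag3 al al be) y = 0) ->
  [/\ A = B, Y = - X & [/\ p = 0, q = 0, s = 0 & t = 0]].
Proof.
move=> hE sH ba Q0.
have {}Q0 x1 x2 x3 := Q0 (vec x1 x2 x3).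
have bn : be - al != 0 by rewrite subr_eq0.
have z (u : R) : (be - al) * u = 0 -> u = 0 by move/eqP; rewrite mulf_eq0 (negbTE bn) => /eqP.
have e1 := Q0 1 0 0; have e2 := Q0 0 1 0; have e3 := Q0 1 0 1; have e4 := Q0 0 1 1.
have e5 := Q0 1 1 0; have e6 := Q0 1 (-1) 0; have e7 := Q0 1 1 1; have e8 := Q0 1 (-1) 1.
have e9 := Q0 1 1 (-1); have e10 := Q0 1 0 (-1).
rewrite !(trQ_diag _ _ _ hE sH) /vec /= in e1 e2 e3 e4 e5 e6 e7 e8 e9 e10.
move/z: e1 => e1; move/z: e2 => e2; move/z: e3 => e3; move/z: e4 => e4.
move/z: e5 => e5; move/z: e6 => e6; move/z: e7 => e7; move/z: e8 => e8.
move/z: e9 => e9; move/z: e10 => e10.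
clear Q0 z hE sH; do !split; lra.
Qed.

Lemma trQ_even4 H A C X m y : get4 H = h9 A A C X (- X) 0 0 0 0 -> totally_symmetric H ->
  axial (ev R o2) m -> trQ H m y = 0.
Proof.
move=> hE sH /axial_ev2P[x1 [x2 ->]].
by rewrite (trQ_diag _ _ _ hE sH); ring.
Qed.

(** [y] and its image under diag(al, al, be) span the same plane as [y] and z, for [y] generic; if
    this plane always contains the image under [c], then [c] is axial. *)
Lemma cross2_diag0 c al be : c^T = c -> be != al ->
  (forall y, det3 y (rowact (diag3 al al be) y) (rowact c y) = 0) ->
  [/\ c o0 o0 = c o1 o1, c o0 o1 = 0, c o0 o2 = 0 & c o1 o2 = 0].
Proof.
move=> sc ba P0; have c10 := tr_entry o1 o0 sc; have c20 := tr_entry o2 o0 sc.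
have c21 := tr_entry o2 o1 sc.
have {}P0 x1 x2 : x1 * (c o1 o0 * x1 + c o1 o1 * x2 + c o1 o2)
    - x2 * (c o0 o0 * x1 + c o0 o1 * x2 + c o0 o2) = 0.
  apply: (mulfI (_ : be - al != 0)); first by rewrite subr_eq0.
  rewrite mulr0 -[RHS]oppr0 -(P0 (vec x1 x2 1)) /det3 /rowact !sum3 !mxE /vec /=; ring.
have e1 := P0 1 0; have e2 := P0 0 1; have e3 := P0 1 1; have e4 := P0 (-1) 0.
rewrite c10 in e1 e2 e3 e4; clear P0 c10 c20 c21 sc; split; lra.
Qed.

(** H : diag(al, al, be) sees only the weights 0, 1, 2 of [H], and an axial value kills weights 1
    and 2. *)
Lemma contr_diag_axial H A B C X Y p q s t al be : get4 H = h9 A B C X Y p q s t ->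
  be != al ->
  let c := contr H (diag3 al al be) in
  [/\ c o0 o0 = c o1 o1, c o0 o1 = 0, c o0 o2 = 0 & c o1 o2 = 0] ->
  [/\ A = B, Y = - X, q = - p & t = - s].
Proof.
move=> hE ba c; have hc := contr_h9 hE (diag3_tr al al be).
have bn : be - al != 0 by rewrite subr_eq0.
rewrite /c !hc !mxE /= => -[e00 e01 e02 e12].
by split; apply: (mulfI bn); lra.
Qed.

End AxialForms.

(** * Subgroups of the rotation group *)

Section Groups.
Variable R : realType.
Implicit Types (g h : 'M[R]_3) (Z : R -> R -> Prop).

Definition rx : 'M[R]_3 := diag3 1 (-1) (-1).

Definition dihedral Z g : Prop :=
  exists c s, Z c s /\ (g = rzm c s \/ g = rzm c s *m rx).

Lemma rzm_mul c s c' s' : rzm c s *m rzm c' s' = rzm (c * c' - s * s') (s * c' + c * s') :> 'M[R]_3.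
Proof. by apply: mx3P; rewrite mulmx3 !mxE /=; ring. Qed.

Lemma rzm_tr c s : (rzm c s)^T = rzm c (- s) :> 'M[R]_3.
Proof. by apply: mx3P; rewrite !mxE /= ?opprK ?oppr0. Qed.

Lemma rx_rzm c s : rx *m rzm c s = rzm c (- s) *m rx.
Proof. by apply: mx3P; rewrite !mulmx3 !mxE /=; ring. Qed.

Lemma rx_rx : rx *m rx = 1%:M.
Proof. by apply: mx3P; rewrite mulmx3 !mxE /= ?mulr1n ?mulr0n; ring. Qed.

Lemma rx_rotation : rotation rx.
Proof. by apply: diag3_rotation; ring. Qed.

Lemma rx_tr : rx^T = rx. Proof. exact: diag3_tr. Qed.

Lemma rzm10 : rzm 1 0 = 1%:M :> 'M[R]_3.
Proof. by apply: mx3P; rewrite !mxE //= oppr0. Qed.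

Lemma rotxpi : rotx pi = rx.
Proof. by apply: mx3P; rewrite !mxE //= ?cospi ?sinpi ?oppr0. Qed.

(** A subgroup of the unit circle, where (c, s) stands for c + i s; conjugation is inversion. *)
Record circle_subgroup Z : Prop := CircleSubgroup {
  cs_circle : forall c s, Z c s -> c ^+ 2 + s ^+ 2 = 1;
  cs_one : Z 1 0;
  cs_mul : forall c s c' s', Z c s -> Z c' s' -> Z (c * c' - s * s') (s * c' + c * s');
  cs_conj : forall c s, Z c s -> Z c (- s) }.

Lemma dihedral_subgroup Z : circle_subgroup Z -> subgroup_SO3 (dihedral Z).
Proof.
move=> [Zc Z1 ZM ZV]; split.
- move=> g [c [s [/Zc cs [->|->]]]]; first exact: rzm_rotation.
  by apply: rotation_mul; [apply: rzm_rotation | apply: rx_rotation].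
- by exists 1, 0; split=> //; left; rewrite rzm10.
- move=> g h [c [s [Zcs gE]]] [c' [s' [Zcs' hE]]].
  have p1 := ZM _ _ _ _ Zcs Zcs'; have p2 := ZM _ _ _ _ Zcs (ZV _ _ Zcs').
  case: gE => ->; case: hE => ->.
  + by exists (c * c' - s * s'), (s * c' + c * s'); rewrite rzm_mul; split=> //; left.
  + by exists (c * c' - s * s'), (s * c' + c * s'); rewrite mulmxA rzm_mul; split=> //; right.
  + exists (c * c' - s * - s'), (s * c' + c * - s'); split=> //; right.
    by rewrite -mulmxA rx_rzm mulmxA rzm_mul.
  + exists (c * c' - s * - s'), (s * c' + c * - s'); split=> //; left.
    by rewrite -mulmxA (mulmxA rx) rx_rzm -mulmxA rx_rx mulmx1 rzm_mul.
move=> g [c [s [Zcs gE]]]; have rz := rzm_rotation (Zc _ _ Zcs).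
case: gE => ->.
  by exists c, (- s); split; [exact: ZV | left; rewrite rotation_inv // rzm_tr].
exists c, s; split=> //; right.
rewrite rotation_inv; last exact: rotation_mul rz rx_rotation.
by rewrite trmx_mul rx_tr rzm_tr rx_rzm opprK.
Qed.

Lemma generated_dihedral Z (S : 'M[R]_3 -> Prop) : circle_subgroup Z ->
  (forall g, S g <-> exists c s, Z c s /\ g = rzm c s) ->
  forall g, Defs.generated (fun s => S s \/ s = rotx pi) g <-> dihedral Z g.
Proof.
move=> cZ SZ g; split=> [gen|[c [s [Zcs gE]]] K sK SK].
  apply: gen; first exact: dihedral_subgroup.
  move=> h [/SZ[c [s [Zcs ->]]]|->]; first by exists c, s; split=> //; left.
  by exists 1, 0; split; [exact: cs_one cZ | right; rewrite rzm10 mul1mx rotxpi].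
have Kr : K (rzm c s) by apply: SK; left; apply/SZ; exists c, s.
case: gE => -> //; case: sK => _ _ KM _; apply: KM => //.
by apply: SK; right; rewrite rotxpi.
Qed.

End Groups.

Section GroupDescriptions.
Variable R : realType.
Implicit Types (g h : 'M[R]_3) (Z : R -> R -> Prop).

Definition circ (c s : R) : Prop := c ^+ 2 + s ^+ 2 = 1.
(** On the circle, [circ2], [circ3] and [circ4] say that the square, the cube, the fourth power of c
    + i s is 1. *)
Definition circ2 (c s : R) : Prop := circ c s /\ s = 0.
Definition circ3 (c s : R) : Prop := [/\ circ c s, 3 * c ^+ 2 * s - s ^+ 3 = 0
  & c ^+ 3 - 3 * c * s ^+ 2 = 1].
Definition circ4 (c s : R) : Prop := circ c s /\ c * s = 0.

Lemma circ_mul c s c' s' : circ c s -> circ c' s' ->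
  circ (c * c' - s * s') (s * c' + c * s').
Proof.
rewrite /circ => e e'; transitivity ((c ^+ 2 + s ^+ 2) * (c' ^+ 2 + s' ^+ 2)); first by ring.
by rewrite e e' mulr1.
Qed.

Lemma circ_conj c s : circ c s -> circ c (- s).
Proof. by rewrite /circ sqrrN. Qed.

Lemma circ_one : circ 1 0.
Proof. by rewrite /circ; ring. Qed.

Lemma circ_subgroup : circle_subgroup circ.
Proof. by split=> //; [exact: circ_one | exact: circ_mul | exact: circ_conj]. Qed.

Lemma circ2_subgroup : circle_subgroup circ2.
Proof.
split=> [c s []//||c s c' s' [e z] [e' z']|c s [e z]].
- by split=> //; exact: circ_one.
- by split; [exact: circ_mul | rewrite z z'; ring].
by split; [exact: circ_conj | rewrite z oppr0].
Qed.

Lemma circ4_subgroup : circle_subgroup circ4.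
Proof.
split=> [c s []//||c s c' s' [e z] [e' z']|c s [e z]].
- by split; [exact: circ_one | ring].
- split; first exact: circ_mul.
  transitivity (c * s * (c' ^+ 2 - s' ^+ 2) + c' * s' * (c ^+ 2 - s ^+ 2)); first by ring.
  by rewrite z z' !mul0r addr0.
by split; [exact: circ_conj | rewrite mulrN z oppr0].
Qed.

Lemma circ3_subgroup : circle_subgroup circ3.
Proof.
split=> [c s []//||c s c' s' [e z w] [e' z' w']|c s [e z w]].
- by split; [exact: circ_one | ring | ring].
- split; first exact: circ_mul.
    transitivity ((3 * c ^+ 2 * s - s ^+ 3) * (c' ^+ 3 - 3 * c' * s' ^+ 2)
      + (3 * c' ^+ 2 * s' - s' ^+ 3) * (c ^+ 3 - 3 * c * s ^+ 2)); first by ring.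
    by rewrite z z' !mul0r addr0.
  transitivity ((c ^+ 3 - 3 * c * s ^+ 2) * (c' ^+ 3 - 3 * c' * s' ^+ 2)
    - (3 * c ^+ 2 * s - s ^+ 3) * (3 * c' ^+ 2 * s' - s' ^+ 3)); first by ring.
  by rewrite z w w' mul0r subr0 mulr1.
split; first exact: circ_conj.
  by rewrite -oppr0 -z; ring.
by rewrite sqrrN.
Qed.

Lemma circ_angle c s : circ c s -> exists t : R, c = cos t /\ s = sin t.
Proof.
have [t [r [cE sE]]] := polar c s; rewrite /circ cE sE !exprMn -mulrDr cos2Dsin2 mulr1.
move/eqP; rewrite sqrf_eq1 => /orP[] /eqP ->.
  by exists t; rewrite !mul1r.
by exists (t + pi); rewrite cosD sinD cospi sinpi; split; ring.
Qed.

Lemma rotzE (t : R) : rotz t = rzm (cos t) (sin t).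
Proof. by []. Qed.

Lemma circle_int Z (t : R) (k : int) : circle_subgroup Z -> Z (cos t) (sin t) ->
  Z (cos (k%:~R * t)) (sin (k%:~R * t)).
Proof.
move=> [_ Z1 ZM ZV] Zt.
have pos (n : nat) : Z (cos (n%:R * t)) (sin (n%:R * t)).
  elim: n => [|n IH]; first by rewrite mul0r cos0 sin0.
  by rewrite -natr1 mulrDl mul1r cosD sinD; apply: ZM.
case: k => n; first exact: pos.
by rewrite NegzE mulrNz mulNr cosN sinN; apply/ZV/pos.
Qed.

Lemma Zn_circle n Z : circle_subgroup Z ->
  Z (cos (2 * pi / n%:R)) (sin (2 * pi / n%:R)) ->
  (forall c s, Z c s -> exists k : int,
     c = cos (k%:~R * (2 * pi / n%:R)) /\ s = sin (k%:~R * (2 * pi / n%:R))) ->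
  forall g, @Zn R n g <-> exists c s, Z c s /\ g = rzm c s.
Proof.
move=> cZ Zt Zk g; split=> [[k ->]|[c [s [Zcs ->]]]].
  by do 2 eexists; split; last exact: rotzE; apply: circle_int.
by have [k [-> ->]] := Zk _ _ Zcs; exists k.
Qed.

Lemma Z2P g : @Zn R 2 g <-> exists c s, circ2 c s /\ g = rzm c s.
Proof.
have tE : 2 * pi / 2 = pi :> R by field.
apply: Zn_circle; rewrite ?tE; first exact: circ2_subgroup.
  by rewrite cospi sinpi; split=> //; rewrite /circ; ring.
move=> c s [e s0]; have /eqP : c ^+ 2 = 1 by rewrite -e s0; ring.
rewrite sqrf_eq1 s0 => /orP[] /eqP ->.
  by exists 0; rewrite mul0r cos0 sin0.
by exists 1; rewrite mul1r cospi sinpi.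
Qed.

Lemma Z4P g : @Zn R 4 g <-> exists c s, circ4 c s /\ g = rzm c s.
Proof.
have tE : 2 * pi / 4 = pi / 2 :> R by field.
apply: Zn_circle; rewrite ?tE; first exact: circ4_subgroup.
  by rewrite cos_pihalf sin_pihalf; split; rewrite /circ; ring.
move=> c s [e /eqP]; rewrite mulf_eq0 => /orP[] /eqP z.
  have /eqP : s ^+ 2 = 1 by rewrite -e z; ring.
  rewrite sqrf_eq1 z => /orP[] /eqP ->.
    by exists 1; rewrite mul1r cos_pihalf sin_pihalf.
  by exists (-1); rewrite mulrN1z mulN1r cosN sinN cos_pihalf sin_pihalf.
have /eqP : c ^+ 2 = 1 by rewrite -e z; ring.
rewrite sqrf_eq1 z => /orP[] /eqP ->.
  by exists 0; rewrite mul0r cos0 sin0.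
exists 2; have -> : 2%:~R * (pi / 2) = pi :> R by field.
by rewrite cospi sinpi.
Qed.

Lemma circ3_cases c s : circ3 c s -> c = 1 /\ s = 0 \/ c = - 2^-1 /\ s ^+ 2 = 3 / 4.
Proof.
rewrite /circ3 /circ => -[e z w].
have s2 : s ^+ 2 = 1 - c ^+ 2 by rewrite -e; ring.
(* The triple-angle formula: 4 c^3 - 3 c - 1 factors in this way. *)
have : (c - 1) * (2 * c + 1) ^+ 2 = 0.
  transitivity (c ^+ 3 - 3 * c * s ^+ 2 - 1); last by rewrite w subrr.
  by rewrite s2; ring.
move/eqP; rewrite mulf_eq0 sqrf_eq0 => /orP[] /eqP cE; [left | right].
  have c1 : c = 1 by lra.
  split=> //; apply/eqP; rewrite -sqrf_eq0 s2 c1; apply/eqP; ring.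
have c1 : c = - 2^-1 by lra.
by split=> //; rewrite s2 c1; field.
Qed.

Lemma Z3P g : @Zn R 3 g <-> exists c s, circ3 c s /\ g = rzm c s.
Proof.
set t : R := 2 * pi / 3.
have tE : t + (t + t) = pi + pi by rewrite /t; field.
have Zt : circ3 (cos t) (sin t).
  split; first exact: cos2Dsin2.
    have e : sin (t + (t + t)) = 0 by rewrite tE sinD sinpi; ring.
    by rewrite -[RHS]e !(cosD, sinD); ring.
  have e : cos (t + (t + t)) = 1 by rewrite tE cosD cospi sinpi; ring.
  by rewrite -[RHS]e !(cosD, sinD); ring.
apply: Zn_circle; rewrite -/t //; first exact: circ3_subgroup.
move=> c s /circ3_cases[[-> ->]|[-> s2]]; first by exists 0; rewrite mul0r cos0 sin0.
have st : 0 < sin t.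
  have := pi_gt0 R => pi0.
  by apply: sin_gt0_pi; rewrite /t; apply/andP; split; lra.
have [[_ st0]|[ct st2]] := circ3_cases Zt; first by move: st; rewrite st0 ltxx.
have /eqP : s ^+ 2 = sin t ^+ 2 by rewrite s2 st2.
rewrite eqf_sqr => /orP[] /eqP ->; first by exists 1; rewrite mul1r ct.
by exists (-1); rewrite mulrN1z mulN1r cosN sinN ct.
Qed.

Lemma D2P g : @Dn R 2 g <-> dihedral circ2 g.
Proof. by apply: generated_dihedral; [exact: circ2_subgroup | exact: Z2P]. Qed.

Lemma D3P g : @Dn R 3 g <-> dihedral circ3 g.
Proof. by apply: generated_dihedral; [exact: circ3_subgroup | exact: Z3P]. Qed.

Lemma D4P g : @Dn R 4 g <-> dihedral circ4 g.
Proof. by apply: generated_dihedral; [exact: circ4_subgroup | exact: Z4P]. Qed.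

Lemma O2P g : @O2 R g <-> dihedral circ g.
Proof.
apply: generated_dihedral; first exact: circ_subgroup.
move=> h; split=> [[t ->]|[c [s [/circ_angle[t [-> ->]] ->]]]].
  by exists (cos t), (sin t); split; first exact: cos2Dsin2.
by exists t.
Qed.

Lemma O2_axis g : @O2 R g <-> [/\ rotation g, g o0 o2 = 0 & g o1 o2 = 0].
Proof.
rewrite O2P; split=> [dg|[rg g02 g12]].
  split; first by have [] := dihedral_subgroup circ_subgroup => h _ _ _; apply: h.
    by case: dg => c [s [_ [->|->]]]; rewrite ?mulmx3 !mxE /=; ring.
  by case: dg => c [s [_ [->|->]]]; rewrite ?mulmx3 !mxE /=; ring.
by have [c [s [cs gE]]] := rotation_axis_z rg g02 g12; exists c, s.
Qed.

End GroupDescriptions.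

(** * Symmetry classes of axial families *)

Section AxialClasses.
Variable R : realType.
Implicit Types (g h m a b : 'M[R]_3) (n : 'cV[R]_3) (H : tensor R 4).

(** The group S of the overview. *)
Definition symH H a b g : Prop :=
  [/\ rotation g, g *m a = a *m g, g *m b = b *m g & act g H = H].

Lemma symH_frame h H a b g : rotation h ->
  symH H a b g <-> symH (act h^T H) (frm h a) (frm h b) (frm h g).
Proof.
move=> rh; split=> -[rg ga gb gH].
  have rg' := frm_rotation rh rg.
  by split=> //; [apply/frm_comm | apply/frm_comm | apply/act_conj_fix].
have rg' : rotation g by rewrite -(frmK g rh); apply: frm_rotation; first exact: rotation_tr.
by split=> //; [apply/(frm_comm _ _ rh) | apply/(frm_comm _ _ rh) | apply/(act_conj_fix _ rg' rh)].
Qed.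

Lemma conj_class_frame h (S S' K : 'M[R]_3 -> Prop) : rotation h ->
  (forall g, S g <-> S' (frm h g)) -> conj_class S' K -> conj_class S K.
Proof.
move=> rh SS' [k [rk S'K]]; exists (h *m k); split; first exact: rotation_mul.
move=> g; rewrite SS' S'K !rotation_inv //; last exact: rotation_mul.
by rewrite /frm trmx_mul !mulmxA.
Qed.

Lemma conj_class_refl (S K : 'M[R]_3 -> Prop) : (forall g, S g <-> K g) -> conj_class S K.
Proof.
move=> SK; exists 1%:M; split; first exact: rotation1.
by move=> g; rewrite invmx1 mul1mx mulmx1.
Qed.

Lemma map_fix (f : 'M[R]_3 -> 'M[R]_3) L : List.map f L = L ->
  forall m, List.In m L -> f m = m.
Proof. by elim: L => //= m0 L IH [e0 /IH e] m [<-//|/e]. Qed.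

(** All members of F_m are built covariantly, so a change of frame that fixes [H], [a], [b] fixes
    them. *)
Lemma symH_symM H a b g : totally_symmetric H -> symH H a b g -> symM (Lm H a b) g.
Proof.
move=> sH [rg ga gb gH]; split=> // m mL; apply/frm_fix => //.
move: m mL; apply: map_fix; rewrite -Lm_frame //; last exact: rotation_tr.
by rewrite trmxK gH !(frm_fix _ rg).2.
Qed.

Lemma symM_sub L L' g : (forall m, List.In m L' -> List.In m L) -> symM L g -> symM L' g.
Proof. by move=> LL [rg gL]; split=> // m /LL; apply: gL. Qed.

Lemma symM_Lm_Lo H a b g : symM (Lm H a b) g -> symM (Lo H a b) g.
Proof. by apply: symM_sub => m /=; tauto. Qed.

Lemma symM_Lo_Ltri H a b g : symM (Lo H a b) g -> symM (Ltri H a b) g.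
Proof. by apply: symM_sub => m /=; tauto. Qed.

(** Excludes the isotropic and cubic cases, where the triple commutes with every rotation. *)
Definition nontrivial H a b : Prop := ~ [/\ a = 0, b = 0 & exists k, d2 H = k%:M].

Lemma diag3_scalar x : diag3 x x x = x%:M :> 'M[R]_3.
Proof. by apply: mx3P; rewrite !mxE /= ?mulr1n ?mulr0n. Qed.

Lemma comm_diag g al be : be != al -> g *m diag3 al al be = diag3 al al be *m g ->
  g o0 o2 = 0 /\ g o1 o2 = 0.
Proof.
move=> ba /matrixP e; have bn : be - al != 0 by rewrite subr_eq0.
have := (e o0 o2, e o1 o2); rewrite !mulmx3 !mxE /= => -[e02 e12].
by split; apply: (mulfI bn); lra.
Qed.

Lemma O2_comm g m : @O2 R g -> axial (ev R o2) m -> g *m m = m *m g.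
Proof.
move=> /O2P[c [s [cs gE]]] /axial_ev2P[x [y ->]].
by case: gE => ->; apply: mx3P; rewrite !mulmx3 !mxE /=; ring.
Qed.

Section ZFrame.
Variables (H : tensor R 4) (a b : 'M[R]_3).
Hypotheses (hH : in_H4 H) (sa : sym_traceless a) (sb : sym_traceless b).
Hypotheses (xa : axial (ev R o2) a) (xb : axial (ev R o2) b) (xd : axial (ev R o2) (d2 H)).
Hypothesis nt : nontrivial H a b.

Lemma nonscalar_member : exists al be, be != al /\
  (List.In (diag3 al al be) (Ltri H a b)).
Proof.
have [x [x' aE]] := (axial_ev2P a).1 xa; have [y [y' bE]] := (axial_ev2P b).1 xb.
have [z [z' dE]] := (axial_ev2P (d2 H)).1 xd.
have [zz|] := eqVneq z' z; last by exists z, z'; rewrite /= -dE; auto.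
have [xx|] := eqVneq x' x; last by exists x, x'; rewrite /= -aE; auto.
have [yy|] := eqVneq y' y; last by exists y, y'; rewrite /= -bE; auto.
case: nt; split; last by exists z; rewrite dE zz diag3_scalar.
  case: sa => _; rewrite aE xx diag3_scalar mxtrace_scalar => /eqP.
  by rewrite mulrn_eq0 /= => /eqP ->; rewrite raddf0.
case: sb => _; rewrite bE yy diag3_scalar mxtrace_scalar => /eqP.
by rewrite mulrn_eq0 /= => /eqP ->; rewrite raddf0.
Qed.

Lemma symM_Ltri_O2 g : symM (Ltri H a b) g <-> @O2 R g.
Proof.
split=> [[rg gL]|og].
  have [al [be [ba mL]]] := nonscalar_member.
  by have [g02 g12] := comm_diag ba (gL _ mL); apply/O2_axis.
split; first by move/O2_axis: og => [].
by move=> m /= [<-|[<-|[<-|//]]]; apply: O2_comm.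
Qed.

Lemma symH_O2 g : symH H a b g -> @O2 R g.
Proof.
move=> sg; apply/symM_Ltri_O2/symM_Lo_Ltri/symM_Lm_Lo/symH_symM => //.
by case: hH.
Qed.

Lemma symH_O2P g : symH H a b g <-> @O2 R g /\ act g H = H.
Proof.
split=> [sg|[og gH]]; first by split; [exact: symH_O2 | case: sg].
by split; rewrite ?(O2_comm og) //; move/O2_axis: og => [].
Qed.

Lemma rx_fix A B C s t : get4 H = h9 A B C 0 0 0 0 s t -> act (rx R) H = H.
Proof.
move=> hE; have rr := rx_rotation R; apply: tensor4P.
suff -> : get4 (act (rx R) H) = get4 H by [].
rewrite -(rx_tr R) (harmonic_h9 (in_H4_frame rr hH)) [RHS]hE.
by congr h9; rewrite get4_frame // !sum3 !mxE hE /h9 /=; ring.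
Qed.

Lemma dihedral_fix Z : act (rx R) H = H ->
  (forall c s, circ c s -> act (rzm c s) H = H <-> Z c s) -> (forall c s, Z c s -> circ c s) ->
  forall g, symH H a b g <-> dihedral Z g.
Proof.
move=> xH zH Zc g; rewrite symH_O2P O2P; split=> [[[c [s [cs gE]]] gH]|[c [s [Zcs gE]]]].
  exists c, s; split=> //; apply/zH => //; have rz := rzm_rotation cs.
  by case: gE gH => -> //; rewrite -act_mul ?xH //; apply: rx_rotation.
have cs := Zc _ _ Zcs; have rz := rzm_rotation cs.
split; first by exists c, s.
by case: gE => ->; rewrite -?act_mul ?xH //; try apply: rx_rotation; apply/zH.
Qed.

Lemma class_weight0 C : get4 H = h9 (- 4 * C) (- 4 * C) C 0 0 0 0 0 0 ->
  conj_class (symH H a b) (@O2 R).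
Proof.
move=> hE; apply: conj_class_refl => g; rewrite O2P.
apply: (dihedral_fix (rx_fix hE)) => // c s cs; split=> // _.
apply: tensor4P => i j k l; have cs' := circ_conj cs.
have := frame_z_h9 hH hE cs'; rewrite rzm_tr opprK => ->; rewrite hE.
have e2 : (c ^+ 2 + s ^+ 2) ^+ 2 = 1 by rewrite cs expr1n.
congr h9; try ring.
- by transitivity (- 4 * C * (c ^+ 2 + s ^+ 2)); [ring | rewrite cs; ring].
- by transitivity (- 4 * C * (c ^+ 2 + s ^+ 2)); [ring | rewrite cs; ring].
by transitivity (C * (c ^+ 2 + s ^+ 2) ^+ 2); [ring | rewrite e2; ring].
Qed.

Lemma symH_D4 A C : get4 H = h9 A A C 0 0 0 0 0 0 -> A + 4 * C != 0 ->
  forall g, symH H a b g <-> @Dn R 4 g.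
Proof.
move=> hE wn g; rewrite D4P; apply: (dihedral_fix (rx_fix hE)) => [c s cs|c s []//].
have cs' := circ_conj cs; have := frame_z_h9 hH hE cs'; rewrite rzm_tr opprK => hE'.
have e1 : c ^+ 2 + s ^+ 2 = 1 := cs.
have e2 : (c ^+ 2 + s ^+ 2) ^+ 2 = 1 by rewrite cs expr1n.
split=> [gH|[_ z]].
  (* The rotation changes the component H_xxyy by 2 (A + 4 C) (c s)^2. *)
  split=> //; move: hE'; rewrite gH hE => /funeqP/(_ o0)/funeqP/(_ o0)/funeqP/(_ o1)/funeqP/(_ o1).
  rewrite /h9 /= => e; apply/eqP; rewrite -sqrf_eq0; apply/eqP; apply: (mulfI wn).
  by have : C * (c ^+ 2 + s ^+ 2) ^+ 2 = C by [rewrite e2 mulr1]; rewrite mulr0; lra.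
apply: tensor4P => i j k l; rewrite hE' hE; congr h9; try ring.
- by transitivity (A * (c ^+ 2 + s ^+ 2)); [ring | rewrite e1; ring].
- by transitivity (A * (c ^+ 2 + s ^+ 2)); [ring | rewrite e1; ring].
- transitivity (C * (c ^+ 2 + s ^+ 2) ^+ 2 - 2 * (A + 4 * C) * (c * s) ^+ 2); first by ring.
  by rewrite e2 z; ring.
- transitivity (c * s * (A + 4 * C) * (c ^+ 2 - s ^+ 2)); first by ring.
  by rewrite z !mul0r.
transitivity (- (c * s * (A + 4 * C) * (c ^+ 2 - s ^+ 2))); first by ring.
by rewrite z !mul0r oppr0.
Qed.

Lemma symH_D3 C s : get4 H = h9 (- 4 * C) (- 4 * C) C 0 0 0 0 s (- s) -> s != 0 ->
  forall g, symH H a b g <-> @Dn R 3 g.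
Proof.
move=> hE sn g; rewrite D3P; apply: (dihedral_fix (rx_fix hE)) => [c d cs|c d []//].
have cs' := circ_conj cs; have := frame_z_h9 hH hE cs'; rewrite rzm_tr opprK => hE'.
have e1 : c ^+ 2 + d ^+ 2 = 1 := cs.
have e2 : (c ^+ 2 + d ^+ 2) ^+ 2 = 1 by rewrite cs expr1n.
split=> [gH|[_ z w]].
  have F i j k l := congr1 (fun f => f i j k l) hE'; rewrite gH hE in F.
  have := (F o0 o0 o0 o2, F o0 o0 o1 o2); rewrite /h9 /= => -[f1 f2].
  by split=> //; apply: (mulfI sn); lra.
apply: tensor4P => i j k l; rewrite hE' hE; congr h9; try ring.
- by transitivity (- 4 * C * (c ^+ 2 + d ^+ 2)); [ring | rewrite e1; ring].
- by transitivity (- 4 * C * (c ^+ 2 + d ^+ 2)); [ring | rewrite e1; ring].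
- by transitivity (C * (c ^+ 2 + d ^+ 2) ^+ 2); [ring | rewrite e2; ring].
- by transitivity (- s * (3 * c ^+ 2 * d - d ^+ 3)); [ring | rewrite z mulr0].
- by transitivity (s * (3 * c ^+ 2 * d - d ^+ 3)); [ring | rewrite z mulr0].
- by transitivity (s * (c ^+ 3 - 3 * c * d ^+ 2)); [ring | rewrite w mulr1].
by transitivity (- s * (c ^+ 3 - 3 * c * d ^+ 2)); [ring | rewrite w mulr1].
Qed.

End ZFrame.

End AxialClasses.

Section HigherWeightClasses.
Variable R : realType.
Implicit Types (g h m a b : 'M[R]_3) (n : 'cV[R]_3) (H : tensor R 4).

Lemma frm_O2 h m : @O2 R h -> axial (ev R o2) m -> frm h m = m.
Proof.
move=> oh xm; have [rh _ _] := (O2_axis h).1 oh.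
by rewrite /frm -mulmxA -(O2_comm oh xm) mulmxA rotation_mulVm // mul1mx.
Qed.

Lemma rzm_O2 c s : c ^+ 2 + s ^+ 2 = 1 -> @O2 R (rzm c s).
Proof. by move=> cs; apply/O2P; exists c, s; split=> //; left. Qed.

Section HigherWeightZFrame.
Variables (H : tensor R 4) (a b : 'M[R]_3).
Hypotheses (hH : in_H4 H) (sa : sym_traceless a) (sb : sym_traceless b).
Hypotheses (xa : axial (ev R o2) a) (xb : axial (ev R o2) b) (xd : axial (ev R o2) (d2 H)).
Hypothesis nt : nontrivial H a b.

Lemma rzm_frame_class c d (K : 'M[R]_3 -> Prop) : c ^+ 2 + d ^+ 2 = 1 ->
  (d2 (act (rzm c d)^T H) = d2 H -> forall g, symH (act (rzm c d)^T H) a b g <-> K g) ->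
  conj_class (symH H a b) K.
Proof.
move=> cd HK; have rz := rzm_rotation cd; have oz := rzm_O2 cd.
have sH : totally_symmetric H by case: hH.
apply: (@conj_class_frame _ (rzm c d) _ (symH (act (rzm c d)^T H) a b)) => // [g|].
  by rewrite (symH_frame H a b g rz) (frm_O2 oz xa) (frm_O2 oz xb).
by apply/conj_class_refl/HK; rewrite d2_frame // frm_O2.
Qed.

(** A rotation about z removes [X] and so makes [rx] a symmetry; the squared amplitude (A + 4 C)^2 +
    (4 X)^2 of weight 4 is invariant, so A + 4 C' is nonzero. *)
Lemma class_weight4 A C X : get4 H = h9 A A C X (- X) 0 0 0 0 ->
  ~ (A + 4 * C = 0 /\ X = 0) -> conj_class (symH H a b) (@Dn R 4).
Proof.
move=> hE wX; have [c [d [cd al]]] := align4 ((A + 4 * C) / 4) X.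
apply: (rzm_frame_class cd) => dE; have rz := rzm_rotation cd.
have hE' := frame_z_h9 hH hE cd.
have e2 : (c ^+ 2 + d ^+ 2) ^+ 2 = 1 by rewrite cd expr1n.
have e4 : (c ^+ 2 + d ^+ 2) ^+ 4 = 1 by rewrite cd expr1n.
pose C' := C - 2 * (A + 4 * C) * c ^+ 2 * d ^+ 2 + 4 * X * c * d * (c ^+ 2 - d ^+ 2).
have hE2 : get4 (act (rzm c d)^T H) = h9 A A C' 0 0 0 0 0 0.
  rewrite hE'; congr h9; try ring.
  - by transitivity (A * (c ^+ 2 + d ^+ 2)); [ring | rewrite cd; ring].
  - by transitivity (A * (c ^+ 2 + d ^+ 2)); [ring | rewrite cd; ring].
  - transitivity (C * (c ^+ 2 + d ^+ 2) ^+ 2 - 2 * (A + 4 * C) * c ^+ 2 * d ^+ 2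
      + 4 * X * c * d * (c ^+ 2 - d ^+ 2)); first by ring.
    by rewrite e2 mulr1.
  - transitivity (X * (c ^+ 4 - 6 * c ^+ 2 * d ^+ 2 + d ^+ 4)
      - (A + 4 * C) / 4 * (4 * c ^+ 3 * d - 4 * c * d ^+ 3)); first by field.
    by rewrite al subrr.
  transitivity (- (X * (c ^+ 4 - 6 * c ^+ 2 * d ^+ 2 + d ^+ 4)
      - (A + 4 * C) / 4 * (4 * c ^+ 3 * d - 4 * c * d ^+ 3))); first by field.
  by rewrite al subrr oppr0.
apply: (symH_D4 (in_H4_frame rz hH) sa sb xa xb _ _ hE2).
- by rewrite dE.
- by rewrite /nontrivial dE.
apply/eqP => w0; apply: wX.
have wE : A + 4 * C' = (A + 4 * C) * (c ^+ 4 - 6 * c ^+ 2 * d ^+ 2 + d ^+ 4)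
   + 4 * X * (4 * c ^+ 3 * d - 4 * c * d ^+ 3).
  transitivity (A * (c ^+ 2 + d ^+ 2) ^+ 2 + 4 * (C * (c ^+ 2 + d ^+ 2) ^+ 2
    - 2 * (A + 4 * C) * c ^+ 2 * d ^+ 2 + 4 * X * c * d * (c ^+ 2 - d ^+ 2))).
    by rewrite e2 /C' !mulr1.
  by ring.
have : (A + 4 * C) ^+ 2 + (4 * X) ^+ 2 = 0.
  transitivity (((A + 4 * C) ^+ 2 + (4 * X) ^+ 2) * (c ^+ 2 + d ^+ 2) ^+ 4).
    by rewrite e4 mulr1.
  transitivity ((A + 4 * C') ^+ 2 + 16 * (X * (c ^+ 4 - 6 * c ^+ 2 * d ^+ 2 + d ^+ 4)
      - (A + 4 * C) / 4 * (4 * c ^+ 3 * d - 4 * c * d ^+ 3)) ^+ 2).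
    by rewrite wE; field.
  by rewrite w0 al subrr !expr0n /= mulr0 addr0.
by move=> /sum_sqr_eq0[-> /eqP]; rewrite mulf_eq0 pnatr_eq0 => /eqP.
Qed.

(** A rotation about z removes [p] and so makes [rx] a symmetry, while p^2 + s^2 is invariant. *)
Lemma class_weight3 C p s : get4 H = h9 (- 4 * C) (- 4 * C) C 0 0 p (- p) s (- s) ->
  ~ (p = 0 /\ s = 0) -> conj_class (symH H a b) (@Dn R 3).
Proof.
move=> hE ps; have [c [d [cd al]]] := align3 s (- p).
apply: (rzm_frame_class cd) => dE; have rz := rzm_rotation cd.
have hE' := frame_z_h9 hH hE cd.
have e2 : (c ^+ 2 + d ^+ 2) ^+ 2 = 1 by rewrite cd expr1n.
have e3 : (c ^+ 2 + d ^+ 2) ^+ 3 = 1 by rewrite cd expr1n.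
pose s' := s * (c ^+ 3 - 3 * c * d ^+ 2) - p * (3 * c ^+ 2 * d - d ^+ 3).
have p0 : p * (c ^+ 3 - 3 * c * d ^+ 2) + s * (3 * c ^+ 2 * d - d ^+ 3) = 0.
  by rewrite al; ring.
have hE2 : get4 (act (rzm c d)^T H) = h9 (- 4 * C) (- 4 * C) C 0 0 0 0 s' (- s').
  rewrite hE'; congr h9; rewrite /s'; try ring.
  - by transitivity (- 4 * C * (c ^+ 2 + d ^+ 2)); [ring | rewrite cd; ring].
  - by transitivity (- 4 * C * (c ^+ 2 + d ^+ 2)); [ring | rewrite cd; ring].
  - by transitivity (C * (c ^+ 2 + d ^+ 2) ^+ 2); [ring | rewrite e2; ring].
  - by rewrite -[RHS]p0; ring.
  by rewrite -[RHS]oppr0 -[in RHS]p0; ring.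
apply: (symH_D3 (in_H4_frame rz hH) sa sb xa xb _ _ hE2).
- by rewrite dE.
- by rewrite /nontrivial dE.
apply/eqP => s0; apply: ps; apply: sum_sqr_eq0.
transitivity ((p ^+ 2 + s ^+ 2) * (c ^+ 2 + d ^+ 2) ^+ 3); first by rewrite e3 mulr1.
transitivity (s' ^+ 2 + (p * (c ^+ 3 - 3 * c * d ^+ 2) + s * (3 * c ^+ 2 * d - d ^+ 3)) ^+ 2).
  by rewrite /s'; ring.
by rewrite s0 p0 !expr0n addr0.
Qed.

(** The entries xz and yz of [d2 H] are the real and imaginary parts of (p - i s) (A + 4 C + 4 i X),
    the product of the amplitudes of weights 3 and 4; they vanish as [d2 H] is axial. *)
Lemma weight34 A B C X Y p q s t : get4 H = h9 A B C X Y p q s t ->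
  [/\ A = B, Y = - X, q = - p & t = - s] ->
  p = 0 /\ s = 0 \/ A = - 4 * C /\ X = 0.
Proof.
move=> hE [AB YX qp ts]; have sH : totally_symmetric H by case: hH.
have [x [y dE]] := (axial_ev2P _).1 xd.
have hd := d2_h9 hE sH; have e1 : d2 H o0 o2 = 0 by rewrite dE mxE.
have e2 : d2 H o1 o2 = 0 by rewrite dE mxE.
move: e1 e2; rewrite !hd -AB YX qp ts => e1 e2.
have e : (p ^+ 2 + s ^+ 2) * ((A + 4 * C) ^+ 2 + (4 * X) ^+ 2) = 0.
  transitivity ((p * (C - A) + - p * (2 * A - 4 * A - 3 * C) + 3 * - s * X
      + - X * (4 * - s - 3 * s)) ^+ 2 + (- s * (C - A) + s * (2 * A - 4 * A - 3 * C)
      + 3 * p * - X + X * (4 * p - 3 * - p)) ^+ 2); first by ring.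
  by rewrite e1 e2; ring.
move/eqP: e; rewrite mulf_eq0 => /orP[] /eqP /sum_sqr_eq0[z1 z2]; [by left | right].
by split; [lra | apply/eqP; move/eqP: z2; rewrite mulf_eq0 pnatr_eq0].
Qed.

End HigherWeightZFrame.

End HigherWeightClasses.

(** * The transversely isotropic, tetragonal and trigonal conditions *)

Section AxialConditions.
Variable R : realType.
Implicit Types (g h m a b : 'M[R]_3) (n : 'cV[R]_3) (H : tensor R 4).

Lemma symM_frame h L g : rotation h -> symM L g <-> symM (List.map (frm h) L) (frm h g).
Proof.
move=> rh; split=> -[rg gL]; split.
- exact: frm_rotation.
- by move=> m /List.in_map_iff[m0 [<- m0L]]; apply/frm_comm => //; apply: gL.
- by rewrite -(frmK g rh); apply: frm_rotation => //; apply: rotation_tr.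
by move=> m mL; apply/(frm_comm _ _ rh); apply: gL; apply: List.in_map.
Qed.

Lemma Ltri_frame h H a b : rotation h -> totally_symmetric H ->
  Ltri (act h^T H) (frm h a) (frm h b) = List.map (frm h) (Ltri H a b).
Proof. by move=> rh sH; rewrite /Ltri /= d2_frame. Qed.

Lemma frm_invmx h g : rotation h -> invmx h *m g *m h = frm h g.
Proof. by move=> rh; rewrite rotation_inv. Qed.

Lemma has_class_famM L (K : 'M[R]_3 -> Prop) :
  has_class (famM L) K <-> conj_class (symM L) K.
Proof.
by split=> -[h [rh e]]; exists h; split=> // g; rewrite -e; have := sym_group_famM L g; tauto.
Qed.

Lemma nontrivial_frame h H a b : rotation h -> totally_symmetric H ->
  nontrivial H a b <-> nontrivial (act h^T H) (frm h a) (frm h b).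
Proof.
move=> rh sH; have f0 : frm h 0 = 0 by rewrite /frm mulmx0 mul0mx.
have fk k : frm h k%:M = k%:M by rewrite -scalemx1 frmZ frm1.
rewrite /nontrivial d2_frame //; split=> nt [a0 b0 [k dk]]; apply: nt; split.
- by apply: (frm_inj rh); rewrite f0.
- by apply: (frm_inj rh); rewrite f0.
- by exists k; apply: (frm_inj rh); rewrite fk.
- by rewrite a0 f0.
- by rewrite b0 f0.
by exists k; rewrite dk fk.
Qed.

Definition zframe H a b h : Prop :=
  [/\ rotation h, axial (ev R o2) (frm h a), axial (ev R o2) (frm h b),
      axial (ev R o2) (d2 (act h^T H)) & nontrivial (act h^T H) (frm h a) (frm h b)].

Lemma comm_quarter m : m^T = m -> rzm 0 1 *m m = m *m rzm 0 1 -> axial (ev R o2) m.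
Proof.
move=> sm /matrixP e; apply/axial_ev2P; exists (m o0 o0), (m o2 o2).
have := (e o0 o0, e o0 o1, e o0 o2, e o1 o2); rewrite !mulmx3 !mxE /=.
have m10 := tr_entry o1 o0 sm; rewrite m10 => -[[[e00 e01] e02] e12].
have m01 : m o0 o1 = 0 by lra.
have m11 : m o1 o1 = m o0 o0 by lra.
have m02 : m o0 o2 = 0 by lra.
have m12 : m o1 o2 = 0 by lra.
by rewrite [LHS](sym_diag3 sm) // m11.
Qed.

Lemma triple_zframe H a b : in_H4 H -> sym_traceless a -> sym_traceless b ->
  has_class (triple H a b) (@O2 R) -> exists h, zframe H a b h.
Proof.
move=> hH sa sb; have sH : totally_symmetric H by case: hH.
rewrite tripleE => /has_class_famM[h [rh e]]; exists h.
have e' g : symM (List.map (frm h) (Ltri H a b)) g <-> @O2 R g.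
  have {1}-> : g = frm h (frm h^T g) by have := frmK g (rotation_tr rh); rewrite trmxK.
  rewrite -symM_frame // e frm_invmx //.
  by have -> : frm h (frm h^T g) = g by have := frmK g (rotation_tr rh); rewrite trmxK.
rewrite -Ltri_frame // in e'.
(* A symmetric matrix that commutes with the quarter turn about z is axial. *)
have q : @O2 R (rzm 0 1) by apply: rzm_O2; ring.
have [_ qL] := (e' _).2 q.
have symfr m : m^T = m -> (frm h m)^T = frm h m by move=> sm; rewrite frm_tr sm.
split=> //.
- by apply: comm_quarter; [apply: symfr; case: sa | apply: qL => /=; auto].
- by apply: comm_quarter; [apply: symfr; case: sb | apply: qL => /=; auto].
- by apply: comm_quarter; [apply/d2_tr/act_sym | apply: qL => /=; auto].
move=> [a0 b0 [k dk]].
(* If the triple were scalar, this cyclic permutation of the axes, which moves the z-axis, would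
   belong to O(2). *)
pose g : 'M[R]_3 := \matrix_(i, j) match nat_of_ord i, nat_of_ord j with
  | 0, 2 => 1 | 1, 0 => 1 | 2, 1 => 1 | _, _ => 0 end.
have rg : rotation g by apply: rotationP; rewrite ?det33 !mxE /=; ring.
have /O2_axis[_ /eqP] : @O2 R g.
  apply/e'; split=> // m /=; rewrite a0 b0 dk => -[<-|[<-|[<-|//]]].
  - by rewrite scalar_mxC.
  - by rewrite mul0mx mulmx0.
  by rewrite mul0mx mulmx0.
by rewrite mxE /= oner_eq0.
Qed.

Lemma zframe_triple H a b h : in_H4 H -> sym_traceless a -> sym_traceless b ->
  zframe H a b h -> has_class (triple H a b) (@O2 R).
Proof.
move=> hH sa sb [rh xa xb xd nt]; have sH : totally_symmetric H by case: hH.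
rewrite tripleE; apply/has_class_famM; exists h; split=> // g.
rewrite frm_invmx // (symM_frame _ _ rh) -Ltri_frame //.
by apply: symM_Ltri_O2 => //; apply: sym_traceless_frm.
Qed.

Lemma coaxial_zframe H a b n : in_H4 H -> nontrivial H a b -> coaxial H a b n ->
  exists h, zframe H a b h.
Proof.
move=> hH nt cn; have sH : totally_symmetric H by case: hH.
have [un _ _ _ _] := cn; have [h rh hn] := @frame_axis R (fun i => n i 0) un.
exists h; have := coaxial_frame rh sH cn.
have -> : h^T *m n = ev R o2.
  apply/matrixP => i j; rewrite !mxE ord1.
  have /matrixP/(_ i o2) := rotation_mulVm rh; rewrite !mxE eqxx andbT => <-.
  by apply: eq_bigr => k _; rewrite hn.
by move=> [_ xa xb xd _]; split=> //; apply/(nontrivial_frame a b rh sH).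
Qed.

Section Conditions.
Variables (H : tensor R 4) (a b : 'M[R]_3).
Hypotheses (hH : in_H4 H) (sa : sym_traceless a) (sb : sym_traceless b).

Let sH : totally_symmetric H. Proof. by case: hH. Qed.

Let zparam h : zframe H a b h -> [/\ in_H4 (act h^T H), sym_traceless (frm h a)
  & sym_traceless (frm h b)].
Proof.
move=> [rh _ _ _ _].
by split; [apply: in_H4_frame | apply: sym_traceless_frm | apply: sym_traceless_frm].
Qed.

Let class_unframe h (K : 'M[R]_3 -> Prop) : rotation h ->
  conj_class (symH (act h^T H) (frm h a) (frm h b)) K -> conj_class (symH H a b) K.
Proof. by move=> rh; apply: (conj_class_frame rh) => g; apply: symH_frame. Qed.

Let Ltri_mem h m : rotation h -> List.In m (Ltri (act h^T H) (frm h a) (frm h b)) ->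
  exists2 m0, List.In m0 (Ltri H a b) & m = frm h m0.
Proof.
move=> rh; rewrite Ltri_frame // => /List.in_map_iff[m0 [<- m0L]]; by exists m0.
Qed.

Lemma transv_class : cond_transv H a b -> conj_class (symH H a b) (@O2 R).
Proof.
move=> [/(triple_zframe hH sa sb)[h zf] [c1 [c2 c3]]].
have cr m : List.In m (Ltri H a b) -> crossH H m = tzero R 5.
  by move=> /= [<-|[<-|[<-|]]].
have [rh xa xb xd nt] := zf; have [hH' sa' sb'] := zparam zf; apply: (class_unframe rh).
have [al [be [ba mL]]] := nonscalar_member sa' sb' xa xb xd nt.
have [A [B [C [X [Y [p [q [s [t hE]]]]]]]]] := harmonic_param hH'.
have P0 y : crossP (act h^T H) (diag3 al al be) y = 0.
  have [m0 /cr/crossH0P P0 ->] := Ltri_mem rh mL.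
  by rewrite crossP_frame //; apply: P0.
have [[AB BC X0 Y0] [p0 q0 s0 t0]] := crossP_diag0 hE ba P0.
apply: (class_weight0 hH' sa' sb' xa xb xd nt (C := C)).
by rewrite hE AB BC X0 Y0 p0 q0 s0 t0.
Qed.

Lemma tetra_class : cond_tetra H a b -> conj_class (symH H a b) (@Dn R 4).
Proof.
move=> [/(triple_zframe hH sa sb)[h zf] [c1 [c2 [c3 cn]]]].
have tcr m : List.In m (Ltri H a b) -> m^T = m /\ trcrossH H m = tzero R 3.
  move=> /= [<-|[<-|[<-|//]]]; split=> //; first exact: d2_tr.
    by case: sa.
  by case: sb.
have [rh xa xb xd nt] := zf; have [hH' sa' sb'] := zparam zf; apply: (class_unframe rh).
have [al [be [ba mL]]] := nonscalar_member sa' sb' xa xb xd nt.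
have [A [B [C [X [Y [p [q [s [t hE]]]]]]]]] := harmonic_param hH'.
have Q0 y : trQ (act h^T H) (diag3 al al be) y = 0.
  have [m0 /tcr[sm0 /(trcross0P hH sm0) Q0] ->] := Ltri_mem rh mL.
  by rewrite trQ_frame.
have [AB YX [p0 q0 s0 t0]] := trQ_diag0 hE hH'.1 ba Q0.
have hE' : get4 (act h^T H) = h9 A A C X (- X) 0 0 0 0.
  by rewrite hE -AB YX p0 q0 s0 t0.
apply: (class_weight4 hH' sa' sb' xa xb xd nt hE') => -[w X0].
have AE : A = - 4 * C by lra.
have hE0 : get4 (act h^T H) = h9 (- 4 * C) (- 4 * C) C 0 0 0 0 0 0.
  by rewrite hE' AE X0 oppr0.
(* Without weight 4 every cross product with an axial matrix vanishes, against [cn]. *)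
have z m : axial (ev R o2) (frm h m) -> crossH H m = tzero R 5.
  move=> xm; apply/crossH0P => y; rewrite -/(crossP H m y) -(rowactKV y rh).
  by rewrite -crossP_frame //; apply: crossP_weight0 hE0 xm.
by case: cn => [|[|]]; apply; apply: z; rewrite -?d2_frame.
Qed.

Lemma trigo_class : cond_trigo H a b -> conj_class (symH H a b) (@Dn R 3).
Proof.
move=> [/(triple_zframe hH sa sb)[h zf] [c1 [c2 [c3 cn]]]].
have ccr m : List.In m (Ltri H a b) -> m^T = m /\ cross2 m (contr H m) = tzero R 3.
  move=> /= [<-|[<-|[<-|//]]]; split=> //; first exact: d2_tr.
    by case: sa.
  by case: sb.
have [rh xa xb xd nt] := zf; have [hH' sa' sb'] := zparam zf; apply: (class_unframe rh).
have [al [be [ba mL]]] := nonscalar_member sa' sb' xa xb xd nt.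
have [A [B [C [X [Y [p [q [s [t hE]]]]]]]]] := harmonic_param hH'.
have C0 y : det3 y (rowact (diag3 al al be) y)
    (rowact (contr (act h^T H) (diag3 al al be)) y) = 0.
  have [m0 /ccr[sm0 /cross20P Q0] ->] := Ltri_mem rh mL.
  by rewrite contr_frame // !rowact_frm // -{1}(rowactK y rh) det3_frame.
have sc : (contr (act h^T H) (diag3 al al be))^T = contr (act h^T H) (diag3 al al be).
  by apply: contr_tr; case: hH'.
have w12 := contr_diag_axial hE ba (cross2_diag0 sc ba C0).
have w34 := weight34 hH' xd hE w12; have [AB YX qp ts] := w12.
(* Without weight 3 every traced cross product vanishes, against [cn]; this excludes the first case
   of [w34]. *)
have ps : ~ (p = 0 /\ s = 0).
  move=> [p0 s0].
  have hE0 : get4 (act h^T H) = h9 A A C X (- X) 0 0 0 0.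
    by rewrite hE -AB YX qp ts p0 s0 oppr0.
  have z m : m^T = m -> axial (ev R o2) (frm h m) -> trcrossH H m = tzero R 3.
    move=> sm xm; apply/trcross0P => // y; rewrite -(rowactKV y rh).
    by rewrite -trQ_frame //; apply: trQ_even4 hE0 _ xm; case: hH'.
  case: cn => [|[|]]; apply; apply: z; rewrite -?d2_frame ?d2_tr //.
    by case: sa.
  by case: sb.
case: w34 => [//|[AE X0]].
apply: (class_weight3 hH' sa' sb' xa xb xd nt (C := C) (p := p) (s := s)) => //.
by rewrite hE -AB AE YX X0 qp ts oppr0.
Qed.

(** The conditions on [cross2] hold for any axis, since [m] and H : m are then both axial. What
    remains is to distinguish whether the traces, and then the cross products themselves, vanish. *)
Lemma coaxial_cond n : nontrivial H a b -> coaxial H a b n ->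
  [\/ cond_transv H a b, cond_tetra H a b | cond_trigo H a b].
Proof.
move=> nt cn; have [h zf] := coaxial_zframe hH nt cn.
have tri := zframe_triple hH sa sb zf.
have [t0|tn] := pselect ([/\ trcrossH H (d2 H) = tzero R 3, trcrossH H a = tzero R 3
  & trcrossH H b = tzero R 3]).
  have [t1 t2 t3] := t0.
  have [c0|cn0] := pselect ([/\ crossH H (d2 H) = tzero R 5, crossH H a = tzero R 5
    & crossH H b = tzero R 5]).
    by constructor 1; case: c0.
  constructor 2; do 4?split=> //; apply: contrapT => /not_orP[n1 /not_orP[n2 n3]].
  by apply: cn0; split; apply: contrapT.
have [un xa xb xd xc] := cn.
have cr m : axial n m -> cross2 m (contr H m) = tzero R 3.
  move=> [x [z ->]]; apply/cross20P => y.
  rewrite contrD contrZ -scalemx1 contrZ contr1 // scaler0 addr0.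
  have [x' [z' ->]] := xc.
  rewrite /det3 !sum3 !mxE !big_ord1 !mxE /= ?mulr1n ?mulr0n; ring.
constructor 3; split=> //; rewrite !cr //; do 3?split=> //.
apply: contrapT => /not_orP[n1 /not_orP[n2 n3]].
by apply: tn; split; apply: contrapT.
Qed.

End Conditions.

End AxialConditions.

(** * The isotropic and cubic classes *)

Section CubicClass.
Variable R : realType.
Implicit Types (g h m a b : 'M[R]_3) (n : 'cV[R]_3) (H : tensor R 4).

Lemma h9_zero_fix H g : get4 H = h9 0 0 0 0 0 0 0 0 0 -> act g H = H.
Proof.
move=> hE; apply: tensor4P => i j k l; rewrite get4_act !hE.
have z i' j' k' l' : h9 0 0 0 0 0 0 0 0 0 i' j' k' l' = 0 :> R.
  by move: i' j' k' l'; do 4 apply: ord3P; rewrite /h9 /= ?addr0 ?oppr0.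
by rewrite z; do 4 (rewrite big1 // => ? _); rewrite z mulr0.
Qed.

Lemma d2_cubic H c : in_H4 H -> get4 H = h9 c c c 0 0 0 0 0 0 ->
  d2 H o0 o0 = 10 * c ^+ 2.
Proof. by move=> [sH _] hE; have hd := d2_h9 hE sH; rewrite !hd; ring. Qed.

Lemma iso_class H a b : in_H4 H -> cond_iso H a b -> conj_class (symH H a b) (@SO3 R).
Proof.
move=> hH [-> [-> d0]]; have sH : totally_symmetric H by case: hH.
have dk : d2 H = 0%:M by rewrite d0 raddf0.
have [h [c [rh hE]]] := isotropic_d2_cubic hH dk.
have c0 : c = 0.
  have := d2_cubic (in_H4_frame rh hH) hE.
  rewrite d2_frame // d0 /frm mulmx0 mul0mx mxE => /esym/eqP.
  by rewrite mulf_eq0 pnatr_eq0 sqrf_eq0 => /eqP.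
rewrite c0 in hE; apply: conj_class_refl => g; split=> [[]//|rg].
split=> //; rewrite ?mul0mx ?mulmx0 //.
by apply/(act_conj_fix H rg rh)/h9_zero_fix.
Qed.

Lemma sign_sqr (x : R) : x = 1 \/ x = -1 <-> x ^+ 2 = 1.
Proof.
split=> [[->|->]|/eqP]; [by ring | by ring |].
by rewrite sqrf_eq1 => /orP[] /eqP ->; [left | right].
Qed.

(** Up to sign, the i-th coordinates of the images of the vertices are the four sums g_i0 ± g_i1 ±
    g_i2; comparing their squares, all equal to 1, kills the mixed products. *)
Lemma cube_entries g i j k : cubeO g -> j != k -> g i j * g i k = 0.
Proof.
move=> [rg gv].
have sq (e1 e2 e3 : R) : e1 ^+ 2 = 1 -> e2 ^+ 2 = 1 -> e3 ^+ 2 = 1 ->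
    (g i o0 * e1 + g i o1 * e2 + g i o2 * e3) ^+ 2 = 1.
  move=> h1 h2 h3.
  have hv : forall k, (\col_k vec e1 e2 e3 k) k 0 = 1 \/ (\col_k vec e1 e2 e3 k) k 0 = -1.
    by apply: ord3P; rewrite mxE /=; apply/sign_sqr.
  by have /sign_sqr := gv _ hv i; rewrite mxE sum3 !mxE /vec /=.
have p : 1 ^+ 2 = 1 :> R by ring.
have m : (-1) ^+ 2 = 1 :> R by ring.
have s1 := sq 1 1 1 p p p; have s2 := sq 1 1 (-1) p p m.
have s3 := sq 1 (-1) 1 p m p; have s4 := sq 1 (-1) (-1) p m m.
clear sq; move: j k; do 2 apply: ord3P; rewrite ?eqxx // => _; lra.
Qed.

Lemma cube_sqr g i j : cubeO g -> g i j ^+ 4 = g i j ^+ 2.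
Proof.
move=> cg; have [rg _] := cg.
have /matrixP/(_ i i) := rotation_mulmV rg; rewrite mulmx3 !mxE eqxx mulr1n => rows.
have e01 := cube_entries i cg (isT : o0 != o1); have e02 := cube_entries i cg (isT : o0 != o2).
have e12 := cube_entries i cg (isT : o1 != o2).
move: j; apply: ord3P.
- transitivity (g i o0 ^+ 2 * (g i o0 * g i o0 + g i o1 * g i o1 + g i o2 * g i o2)
    - (g i o0 * g i o1) ^+ 2 - (g i o0 * g i o2) ^+ 2); first by ring.
  by rewrite rows e01 e02; ring.
- transitivity (g i o1 ^+ 2 * (g i o0 * g i o0 + g i o1 * g i o1 + g i o2 * g i o2)
    - (g i o0 * g i o1) ^+ 2 - (g i o1 * g i o2) ^+ 2); first by ring.
  by rewrite rows e01 e12; ring.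
transitivity (g i o2 ^+ 2 * (g i o0 * g i o0 + g i o1 * g i o1 + g i o2 * g i o2)
    - (g i o0 * g i o2) ^+ 2 - (g i o1 * g i o2) ^+ 2); first by ring.
by rewrite rows e02 e12; ring.
Qed.

(** Forwards, each row has a single nonzero entry, so fourth powers are permuted. Backwards, the
    image x of a vertex has both its squares and its fourth powers summing to 3, so the sum of the
    (x_i^2 - 1)^2 is 0. *)
Lemma cubeOP g : cubeO g <-> rotation g /\
  forall x : 'I_3 -> R, \sum_i (rowact g^T x i) ^+ 4 = \sum_i x i ^+ 4.
Proof.
split=> [cg|[rg q4]].
  have [rg _] := cg; split=> // x; rewrite -[in RHS](rowactKV x rg).
  set y := rowact g^T x; apply/esym.
  have rowE i : rowact g y i ^+ 4 = \sum_j g i j ^+ 2 * y j ^+ 4.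
    have e01 := cube_entries i cg (isT : o0 != o1).
    have e02 := cube_entries i cg (isT : o0 != o2).
    have e12 := cube_entries i cg (isT : o1 != o2).
    rewrite /rowact !sum3 -!(cube_sqr i _ cg).
    transitivity (g i o0 ^+ 4 * y o0 ^+ 4 + g i o1 ^+ 4 * y o1 ^+ 4 + g i o2 ^+ 4 * y o2 ^+ 4
      + (g i o0 * g i o1) * (4 * g i o0 ^+ 2 * y o0 ^+ 3 * y o1
          + 6 * g i o0 * g i o1 * y o0 ^+ 2 * y o1 ^+ 2 + 4 * g i o1 ^+ 2 * y o0 * y o1 ^+ 3
          + 12 * g i o0 * g i o2 * y o0 ^+ 2 * y o1 * y o2
          + 12 * g i o1 * g i o2 * y o0 * y o1 ^+ 2 * y o2
          + 12 * g i o2 ^+ 2 * y o0 * y o1 * y o2 ^+ 2)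
      + (g i o0 * g i o2) * (4 * g i o0 ^+ 2 * y o0 ^+ 3 * y o2
          + 6 * g i o0 * g i o2 * y o0 ^+ 2 * y o2 ^+ 2 + 4 * g i o2 ^+ 2 * y o0 * y o2 ^+ 3)
      + (g i o1 * g i o2) * (4 * g i o1 ^+ 2 * y o1 ^+ 3 * y o2
          + 6 * g i o1 * g i o2 * y o1 ^+ 2 * y o2 ^+ 2 + 4 * g i o2 ^+ 2 * y o1 * y o2 ^+ 3)).
      by ring.
    by rewrite e01 e02 e12 !mul0r !addr0.
  under eq_bigr => i _ do rewrite rowE.
  rewrite exchange_big /=; apply: eq_bigr => j _; rewrite -mulr_suml.
  have /matrixP/(_ j j) := rotation_mulVm rg; rewrite !mxE eqxx mulr1n => cols.
  rewrite (_ : \sum_i g i j ^+ 2 = 1) ?mul1r // -cols.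
  by apply: eq_bigr => i _; rewrite mxE expr2.
split=> // v v1 i; apply/sign_sqr.
pose x k := v k 0; have x2 k : x k ^+ 2 = 1 by apply/sign_sqr; apply: v1.
have x4 k : x k ^+ 4 = 1 by rewrite (exprM _ 2 2) x2; ring.
have gvE k : (g *m v) k 0 = rowact g x k by rewrite mxE.
have n4 := q4 (rowact g x); have n2 := rotation_norm (rowact g x) rg.
have K k : \sum_j g j k * rowact g x j = x k.
  by have := congr1 (fun f => f k) (rowactK x rg); rewrite /= => <-;
     apply: eq_bigr => j _; rewrite mxE.
rewrite rowactK // !sum3 !x4 in n4.
rewrite (eq_bigr (fun k => x k ^+ 2)) in n2; last by move=> k _; rewrite K.
rewrite !sum3 !x2 in n2; rewrite gvE.
have z : (rowact g x o0 ^+ 2 - 1) ^+ 2 + (rowact g x o1 ^+ 2 - 1) ^+ 2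
    + (rowact g x o2 ^+ 2 - 1) ^+ 2 = 0 by lra.
have := (sqr_ge0 (rowact g x o0 ^+ 2 - 1), sqr_ge0 (rowact g x o1 ^+ 2 - 1),
         sqr_ge0 (rowact g x o2 ^+ 2 - 1)) => -[[z0 z1] z2].
have e (w : R) : (w - 1) ^+ 2 = 0 -> w = 1 by move/eqP; rewrite sqrf_eq0 subr_eq0 => /eqP.
by move: i; apply: ord3P; apply: e; lra.
Qed.

Lemma cubic_class H a b : in_H4 H -> cond_cubic H a b ->
  conj_class (symH H a b) (@cubeO R).
Proof.
move=> hH [-> [-> [dd dn]]]; have sH : totally_symmetric H by case: hH.
have [k dk] : exists k, d2 H = k%:M.
  by exists (3^-1 * \tr (d2 H)); move/eqP: dd; rewrite /dev subr_eq0 scalemx1 => /eqP.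
have [h [c [rh hE]]] := isotropic_d2_cubic hH dk.
have hH' := in_H4_frame rh hH; have sH' : totally_symmetric (act h^T H) by case: hH'.
have cn : c != 0.
  apply/eqP => c0; apply: dn; rewrite dk.
  have e : frm h (d2 H) o0 o0 = 0.
    by rewrite -d2_frame // (d2_cubic hH' hE) c0 expr0n mulr0.
  move: e; rewrite dk -scalemx1 frmZ frm1 // !mxE /= mulr1n mulr1 => ->.
  by rewrite scale0r.
apply: (conj_class_frame rh (S' := symH (act h^T H) 0 0)) => [g|].
  have := symH_frame H 0 0 g rh.
  by rewrite (_ : frm h 0 = 0) // /frm mulmx0 mul0mx.
apply: conj_class_refl => g; rewrite cubeOP.
have rE (x : 'I_3 -> R) : \sum_i (\sum_j g j i * x j) ^+ 4 = \sum_i rowact g^T x i ^+ 4.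
  by apply: eq_bigr => i _; congr (_ ^+ 4); apply: eq_bigr => j _; rewrite mxE.
split=> [[rg _ _ gH]|[rg q4]].
  by split=> // x; rewrite -rE; apply: (cubic_fix rg sH' hE cn).1 gH x.
split=> //; rewrite ?mul0mx ?mulmx0 //; apply/(cubic_fix rg sH' hE cn) => x.
by rewrite rE q4.
Qed.

End CubicClass.

(** * Orthotropic and monoclinic families *)

Section LowSymmetry.
Variable R : realType.
Implicit Types (g h m a b : 'M[R]_3) (n : 'cV[R]_3) (H : tensor R 4).

Lemma proj_idem n : unitv n -> proj n *m proj n = proj n.
Proof. by move=> /unitvE un; rewrite /proj mulmxA -(mulmxA n) un mulmx1. Qed.

Lemma axial_mul n m1 m2 : unitv n -> axial n m1 -> axial n m2 -> axial n (m1 *m m2).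
Proof.
move=> un [x1 [y1 ->]] [x2 [y2 ->]]; rewrite mulmxDl !mulmxDr -!scalemxAl -!scalemxAr.
rewrite proj_idem // !mul_scalar_mx !mul_mx_scalar.
do !apply: axialD; do ?apply: axialZ; try exact: axial_proj; exact: axial_scalar.
Qed.

Lemma coaxial_Lm H a b n m : in_H4 H -> coaxial H a b n -> List.In m (Lm H a b) -> axial n m.
Proof.
move=> hH [un xa xb xd xc].
have xC m' : axial n m' -> axial n (contr H m').
  move=> [x [y ->]]; rewrite contrD contrZ -scalemx1 contrZ contr1 // scaler0 addr0.
  exact: axialZ.
have xS m1 m2 : axial n m1 -> axial n m2 -> axial n (symprod m1 m2).
  by move=> x1 x2; apply/axialZ/axialD; apply: axial_mul.
have xM m1 : axial n m1 -> axial n (m1 *m m1) by move=> x1; apply: axial_mul.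
by rewrite /= /c4 /c3; do 12 (case=> [<-|]; first by auto 6).
Qed.

(** The rotation about [n] with cosine 3/5 and sine 4/5; its trace 1 + 6/5 differs from 3 and -1,
    the traces in D_2 and Z_2. *)
Lemma axial_rotation n : unitv n -> exists g, [/\ rotation g, \tr g = 11 / 5 &
  forall m, axial n m -> g *m m = m *m g].
Proof.
move=> un; have [h rh hn] := @frame_axis R (fun i => n i 0) un.
have cs : (3 / 5) ^+ 2 + (4 / 5) ^+ 2 = 1 :> R by field.
have rz := rzm_rotation cs; have rt := rotation_tr rh.
exists (frm h^T (rzm (3 / 5) (4 / 5))); split.
- exact: frm_rotation.
- by rewrite frm_trace // /mxtrace sum3 !mxE /=; field.
move=> m xm; apply/(frm_comm _ _ rh).
have -> : frm h (frm h^T (rzm (3 / 5) (4 / 5))) = rzm (3 / 5) (4 / 5).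
  by have := frmK (rzm (3 / 5) (4 / 5)) rt; rewrite trmxK.
apply: O2_comm; first exact: rzm_O2.
have := axial_frame rh xm; congr axial.
apply/matrixP => i j; rewrite !mxE ord1.
have /matrixP/(_ i o2) := rotation_mulVm rh; rewrite !mxE eqxx andbT => <-.
by apply: eq_bigr => k _; rewrite hn.
Qed.

Lemma symH1 H a b : symH H a b 1%:M.
Proof. by split; rewrite ?mul1mx ?mulmx1 ?act1 //; apply: rotation1. Qed.

Lemma D2_trace g : dihedral (@circ2 R) g -> [/\ \tr g = 3 \/ \tr g = -1 & g *m g = 1%:M].
Proof.
move=> [c [s [[e s0] gE]]]; have c2 : c ^+ 2 = 1 by rewrite -e s0; ring.
split.
  case: gE => ->; last by right; rewrite /mxtrace sum3 !mulmx3 !mxE /= s0; ring.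
  move/eqP: c2; rewrite sqrf_eq1 => /orP[] /eqP ->; [left | right];
    by rewrite /mxtrace sum3 !mxE /=; ring.
case: gE => ->; rewrite s0; apply: mx3P;
  by rewrite !mulmx3 !mxE /= ?mulr1n ?mulr0n; lra.
Qed.

Lemma trace_115 : ~ (11 / 5 = 3 :> R \/ 11 / 5 = -1 :> R).
Proof. by case=> e; have /eqP : 1 = 0 :> R by [lra]; rewrite oner_eq0. Qed.

Section LowSymmetryConditions.
Variables (H : tensor R 4) (a b : 'M[R]_3).
Hypotheses (hH : in_H4 H) (sa : sym_traceless a) (sb : sym_traceless b).

Let sH : totally_symmetric H. Proof. by case: hH. Qed.

(** An axis would put a rotation of trace 11/5 into a group conjugate to D_2. So there is none, and
    every nontrivial element, being a half-turn, fixes [H] by the dichotomy. *)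
Lemma ortho_class : cond_ortho H a b -> conj_class (symH H a b) (@Dn R 2).
Proof.
rewrite /cond_ortho FoE => /has_class_famM[k [rk e]]; exists k; split=> // g.
rewrite -e; split=> [/(symH_symM sH)/symM_Lm_Lo //|gO].
have [rg gL] := gO.
have [->|g1] := pselect (g = 1%:M); first exact: symH1.
have ncoax : ~ exists n, coaxial H a b n.
  move=> [n cn]; have [un _ _ _ _] := cn; have [g0 [rg0 tg0 cg0]] := axial_rotation un.
  have : symM (Lo H a b) g0.
    apply: symM_Lm_Lo; split=> // m mL; apply: cg0; exact: coaxial_Lm mL.
  by move/e/D2P/D2_trace => -[]; rewrite frm_invmx // frm_trace // tg0 => /trace_115.
have [_ g2] := D2_trace ((D2P _).1 ((e g).1 gO)).
have {}g2 : g *m g = 1%:M.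
  by apply: (frm_inj rk); rewrite frm_mul // frm1 // -g2 !frm_invmx.
have [gH|//] := involution_sym_or_coaxial hH sa sb gO g1 g2.
by split=> //; apply: gL => /=; auto.
Qed.

Lemma mono_class : cond_mono H a b -> conj_class (symH H a b) (@Zn R 2).
Proof.
rewrite /cond_mono FmE => /has_class_famM[k [rk e]]; exists k; split=> // g.
rewrite -e; split=> [/(symH_symM sH) //|gM].
have gO := symM_Lm_Lo gM; have [rg gL] := gO.
have [->|g1] := pselect (g = 1%:M); first exact: symH1.
have Zdi h : @Zn R 2 h -> dihedral (@circ2 R) h.
  by move=> /Z2P[c [s [cs ->]]]; exists c, s; split=> //; left.
have ncoax : ~ exists n, coaxial H a b n.
  move=> [n cn]; have [un _ _ _ _] := cn; have [g0 [rg0 tg0 cg0]] := axial_rotation un.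
  have : symM (Lm H a b) g0 by split=> // m mL; apply: cg0; exact: coaxial_Lm mL.
  by move/e/Zdi/D2_trace => -[]; rewrite frm_invmx // frm_trace // tg0 => /trace_115.
have [_ g2] := D2_trace (Zdi _ ((e g).1 gM)).
have {}g2 : g *m g = 1%:M.
  by apply: (frm_inj rk); rewrite frm_mul // frm1 // -g2 !frm_invmx.
have [gH|//] := involution_sym_or_coaxial hH sa sb gO g1 g2.
by split=> //; apply: gL => /=; auto.
Qed.

(** If one of [a], [b], [d2 H] is nonscalar, nn is affine in it, and its contraction with [H], a
    member of F_o, yields H : nn. Otherwise [H] is zero or cubic, and the axis may have to be
    replaced. *)
Lemma Lo_axial_coaxial n : unitv n -> (forall m, List.In m (Lo H a b) -> axial n m) ->
  exists n, coaxial H a b n.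
Proof.
move=> un xL.
have [xd xa xb] : [/\ axial n (d2 H), axial n a & axial n b].
  by split; apply: xL => /=; auto.
have [xc xHa xHb] : [/\ axial n (c3 H), axial n (contr H a) & axial n (contr H b)].
  by split; apply: xL => /=; auto 10.
have [a0|an] := eqVneq a 0; last first.
  have [x [y [xn aE]]] := axial_nonscalar xa (fun k => traceless_nonscalar an sa.2).
  by exists n; split=> //; apply: (contr_proj_axial hH xn aE xHa).
have [b0|bn] := eqVneq b 0; last first.
  have [x [y [xn bE]]] := axial_nonscalar xb (fun k => traceless_nonscalar bn sb.2).
  by exists n; split=> //; apply: (contr_proj_axial hH xn bE xHb).
have [ds|ds] := pselect (exists k, d2 H = k%:M).
  by rewrite a0 b0; apply: cubic_coaxial.
have [|x [y [xn dE]]] := axial_nonscalar xd; first by move=> k dk; apply: ds; exists k.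
by exists n; split=> //; apply: (contr_proj_axial hH xn dE xc).
Qed.

Lemma Lm_sym m : List.In m (Lm H a b) -> m^T = m.
Proof.
have [[ta _] [tb _]] := (sa, sb).
by move=> /=; do 12 (case=> [<-|]; first by rewrite ?contr_tr ?d2_tr // ta); done.
Qed.

End LowSymmetryConditions.

Lemma comm_rzm m c s : m^T = m -> s != 0 -> rzm c s *m m = m *m rzm c s ->
  axial (ev R o2) m.
Proof.
move=> sm sn /matrixP e; apply/axial_ev2P; exists (m o0 o0), (m o2 o2).
have m10 := tr_entry o1 o0 sm; have m20 := tr_entry o2 o0 sm; have m21 := tr_entry o2 o1 sm.
have := (e o0 o0, e o0 o1, e o0 o2, e o1 o2); rewrite !mulmx3 !mxE /=.
rewrite m10 => -[[[e00 e01] e02] e12].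
have m01 : m o0 o1 = 0 by apply: (mulfI sn); lra.
have m11 : m o1 o1 = m o0 o0 by apply: (mulfI sn); lra.
have z : (c - 1) * m o0 o2 = s * m o1 o2 /\ (c - 1) * m o1 o2 = - s * m o0 o2.
  by split; lra.
have nn : (c - 1) ^+ 2 + s ^+ 2 != 0.
  by apply/eqP => /sum_sqr_eq0[_ s0]; rewrite s0 eqxx in sn.
have [z1 z2] := z.
have m02 : m o0 o2 = 0.
  apply: (mulfI nn); rewrite mulr0.
  transitivity ((c - 1) * ((c - 1) * m o0 o2) - s * (- s * m o0 o2)); first by ring.
  by rewrite z1 -z2; ring.
have m12 : m o1 o2 = 0.
  apply: (mulfI nn); rewrite mulr0.
  transitivity ((c - 1) * ((c - 1) * m o1 o2) + s * (s * m o1 o2)); first by ring.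
  by rewrite z2 -z1; ring.
by rewrite [LHS](sym_diag3 sm) // m11.
Qed.

Lemma symH_contr H a b g m : totally_symmetric H -> symH H a b g ->
  g *m m = m *m g -> g *m contr H m = contr H m *m g.
Proof.
move=> sH [rg _ _ gH] gm; apply/(frm_fix _ rg).
by rewrite -contr_frame ?trmxK ?gH ?(frm_fix _ rg).2 //; apply: rotation_tr.
Qed.

Lemma rzm_sym_coaxial H a b c s : in_H4 H -> sym_traceless a -> sym_traceless b ->
  s != 0 -> symH H a b (rzm c s) -> coaxial H a b (ev R o2).
Proof.
move=> hH sa sb sn sg; have sH : totally_symmetric H by case: hH.
have [_ gL] := symH_symM sH sg.
have x m : List.In m (Lm H a b) -> axial (ev R o2) m.
  by move=> mL; apply: (comm_rzm (Lm_sym hH sa sb mL) sn (gL _ mL)).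
split; [exact: unitv_ev| | | |]; try (by apply: x => /=; auto).
apply: (comm_rzm _ sn); first exact: contr_tr.
apply: (symH_contr sH sg); apply: mx3P; rewrite !mulmx3 !projE !mxE /=; ring.
Qed.

End LowSymmetry.

Section LowSymmetryClasses.
Variable R : realType.
Implicit Types (g h m a b : 'M[R]_3) (n : 'cV[R]_3) (H : tensor R 4).

(** The position of the eigenvectors of the xy-block: two block symmetric matrices are diagonalized
    by a common rotation about z exactly when their [offd] are proportional. *)
Definition offd m : R * R := (m o0 o0 - m o1 o1, m o0 o1).

(** The commutator of [m1] and [m2] is a nonzero multiple of the infinitesimal rotation about z.
    Commuting with it makes [g] a rotation about z; a nonzero sine would make both [offd] vanish. *)
Lemma block_symM_Z2 (L : seq 'M[R]_3) m1 m2 : (forall m, List.In m L -> m^T = m /\ block m) ->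
  List.In m1 L -> List.In m2 L ->
  (offd m1).1 * (offd m2).2 != (offd m2).1 * (offd m1).2 ->
  forall g, symM L g <-> @Zn R 2 g.
Proof.
move=> Lb m1L m2L; rewrite /offd /= => D g; rewrite Z2P; split; last first.
  move=> [c [s [[e s0] ->]]]; split; first exact: rzm_rotation.
  move=> m /Lb[sm bm]; have /eqP : c ^+ 2 = 1 by rewrite -e s0; ring.
  rewrite sqrf_eq1 s0 => /orP[] /eqP ->; first by rewrite rzm10 mul1mx mulmx1.
  exact: block_comm.
move=> [rg gL]; have [s1 [b02 b12]] := Lb _ m1L; have [s2 [c02 c12]] := Lb _ m2L.
have g1 := gL _ m1L; have g2 := gL _ m2L.
pose K := m1 *m m2 - m2 *m m1.
have gK : g *m K = K *m g.
  have p1 : g *m (m1 *m m2) = m1 *m m2 *m g by rewrite mulmxA g1 -mulmxA g2 mulmxA.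
  have p2 : g *m (m2 *m m1) = m2 *m m1 *m g by rewrite mulmxA g2 -mulmxA g1 mulmxA.
  by rewrite mulmxBr mulmxBl p1 p2.
pose d := (m1 o0 o0 - m1 o1 o1) * m2 o0 o1 - (m2 o0 o0 - m2 o1 o1) * m1 o0 o1.
have dn : d != 0 by rewrite subr_eq0.
have [x10 x20 x21] : [/\ m1 o1 o0 = m1 o0 o1, m1 o2 o0 = 0 & m1 o2 o1 = 0].
  by split; rewrite (tr_entry _ _ s1).
have [y10 y20 y21] : [/\ m2 o1 o0 = m2 o0 o1, m2 o2 o0 = 0 & m2 o2 o1 = 0].
  by split; rewrite (tr_entry _ _ s2).
have KE : K = d *: (\matrix_(i, j) match nat_of_ord i, nat_of_ord j with
    0, 1 => 1 | 1, 0 => -1 | _, _ => 0 end).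
  have BE i j : K i j = (m1 *m m2) i j - (m2 *m m1) i j by rewrite !mxE.
  apply: mx3P; rewrite BE !mulmx3 !mxE /= ?b02 ?b12 ?c02 ?c12 ?x10 ?x20 ?x21 ?y10 ?y20 ?y21 /d;
    ring.
move: gK; rewrite KE -scalemxAr -scalemxAl => /(scalerI dn)/matrixP e.
have := (e o0 o2, e o1 o2, e o0 o0, e o0 o1).
rewrite !mulmx3 !mxE /= => -[[[e02 e12] e00] e01].
have [c [s [cs gE]]] := rotation_axis_z rg (ltac:(lra) : g o0 o2 = 0) (ltac:(lra) : g o1 o2 = 0).
case: gE => gE; last first.
  move: e00 e01; rewrite gE !mulmx3 !mxE /= => e00 e01.
  have c0 : c = 0 by lra.
  have s0 : s = 0 by lra.
  by move/eqP: cs; rewrite c0 s0 expr0n addr0 eq_sym oner_eq0.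
exists c, s; split=> //; split=> //; apply: contrapT => /eqP sn.
have z m : m^T = m -> g *m m = m *m g -> m o0 o0 - m o1 o1 = 0 /\ m o0 o1 = 0.
  move=> sm; rewrite gE => /matrixP f; have := (f o0 o0, f o0 o1).
  rewrite !mulmx3 !mxE /= (tr_entry o1 o0 sm) => -[f00 f01].
  by split; apply: (mulfI sn); lra.
have [u1 v1] := z _ s1 g1; have [u2 v2] := z _ s2 g2.
by move: dn; rewrite /d u1 u2 !mul0r subrr eqxx.
Qed.

(** Each pair of coordinate axes is separated by some member, not always the same one; this forces
    [g] to be diagonal. *)
Lemma diag_symM_D2 (L : seq 'M[R]_3) :
  (forall m, List.In m L -> exists x y z, m = diag3 x y z) ->
  (exists2 m, List.In m L & m o0 o0 != m o1 o1) ->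
  (exists2 m, List.In m L & m o0 o0 != m o2 o2) ->
  (exists2 m, List.In m L & m o1 o1 != m o2 o2) ->
  forall g, symM L g <-> @Dn R 2 g.
Proof.
move=> Ld [m1 m1L n1] [m2 m2L n2] [m3 m3L n3] g; rewrite D2P; split; last first.
  move=> dg; split.
    by have [sub _ _ _] := dihedral_subgroup (circ2_subgroup R); apply: sub.
  move=> m /Ld[x [y [z ->]]]; case: dg => c [s [[_ s0] gE]].
  by case: gE => ->; rewrite s0; apply: mx3P; rewrite !mulmx3 !mxE /=; ring.
move=> [rg gL].
have z m i j : List.In m L -> m i i != m j j -> g i j = 0.
  move=> mL nij; have [x [y [w mE]]] := Ld _ mL.
  have /matrixP/(_ i j) := gL _ mL; rewrite !mulmx3.
  have d k l : k != l -> m k l = 0.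
    by rewrite mE mxE; move: k l; do 2 apply: ord3P.
  have nn : m j j - m i i != 0 by rewrite subr_eq0 eq_sym.
  have [d01 d02 d12] : [/\ m o0 o1 = 0, m o0 o2 = 0 & m o1 o2 = 0] by split; apply: d.
  have [d10 d20 d21] : [/\ m o1 o0 = 0, m o2 o0 = 0 & m o2 o1 = 0] by split; apply: d.
  by move: i j nij nn; do 2 apply: ord3P; rewrite ?eqxx // => nij nn;
    rewrite ?d01 ?d02 ?d12 ?d10 ?d20 ?d21 => e; apply: (mulfI nn); lra.
have g02 := z _ _ _ m2L n2; have g12 := z _ _ _ m3L n3.
have g10 : g o1 o0 = 0 by apply: (z _ _ _ m1L); rewrite eq_sym.
have [c [s [cs gE]]] := rotation_axis_z rg g02 g12.
exists c, s; split=> //; split=> //.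
by case: gE g10 => ->; rewrite ?mulmx3 !mxE /= => e; lra.
Qed.

Lemma symM_class_frame h (L : seq 'M[R]_3) (K : 'M[R]_3 -> Prop) : rotation h ->
  (forall g, symM (List.map (frm h) L) g <-> K g) -> has_class (famM L) K.
Proof.
move=> rh e; apply/has_class_famM; exists h; split=> // g.
by rewrite frm_invmx // -e; apply: symM_frame.
Qed.

(** With the axis of [g] along z, the absence of a coaxial vector makes [g] a half-turn, so all of
    F_m is block. The alternative is whether the xy-blocks commute. *)
Lemma low_symmetry_cond H a b g : in_H4 H -> sym_traceless a -> sym_traceless b ->
  ~ (exists n, coaxial H a b n) -> symH H a b g -> g <> 1%:M ->
  cond_ortho H a b \/ cond_mono H a b.
Proof.
move=> hH sa sb nc sg g1; have sH : totally_symmetric H by case: hH.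
have [rg _ _ _] := sg; have [h [c [s [rh cs fE]]]] := rotation_axis rg g1.
have hH' := in_H4_frame rh hH; have sa' := sym_traceless_frm rh sa.
have sb' := sym_traceless_frm rh sb.
have sg' := (symH_frame H a b g rh).1 sg; rewrite fE in sg'.
have s0 : s = 0.
  apply: contrapT => /eqP sn; apply: nc; exists (h *m ev R o2).
  by apply: coaxial_unframe => //; apply: rzm_sym_coaxial sn sg'.
have c1 : c = -1.
  have /eqP : c ^+ 2 = 1 by rewrite -cs s0; ring.
  rewrite sqrf_eq1 => /orP[] /eqP // c1; case: g1; apply: (frm_inj rh).
  by rewrite fE c1 s0 rzm10 frm1.
rewrite c1 s0 -/(rpi R) in sg'.
have blk m : List.In m (Lm (act h^T H) (frm h a) (frm h b)) -> m^T = m /\ block m.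
  move=> mL; split; first exact: Lm_sym mL.
  have [_ gL] := symH_symM hH'.1 sg'.
  by apply/comm_rpi/gL.
(* Two members with noncommuting blocks give the monoclinic condition; otherwise one rotation about
   z diagonalizes all members. *)
have [[m1 [m2 [m1L m2L D]]]|par] := pselect (exists m1 m2,
   [/\ List.In m1 (Lm (act h^T H) (frm h a) (frm h b)),
       List.In m2 (Lm (act h^T H) (frm h a) (frm h b)) &
       (offd m1).1 * (offd m2).2 != (offd m2).1 * (offd m1).2]).
  right; rewrite /cond_mono FmE; apply: (symM_class_frame rh); rewrite -Lm_frame //.
  exact: block_symM_Z2 m1L m2L D.
left.
have [c' [d' [cd diag]]] : exists c' d', c' ^+ 2 + d' ^+ 2 = 1 /\
    forall m, List.In m (Lm (act h^T H) (frm h a) (frm h b)) ->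
      (offd m).1 * (c' * d') = (offd m).2 * (c' ^+ 2 - d' ^+ 2).
  have [[m [mL mn]]|all0] := pselect (exists m,
     List.In m (Lm (act h^T H) (frm h a) (frm h b)) /\ offd m <> (0, 0)).
    have [c' [d' [cd al]]] := align2 ((offd m).1 / 2) (offd m).2.
    exists c', d'; split=> // m' m'L.
    have p : (offd m).1 * (offd m').2 = (offd m').1 * (offd m).2.
      by apply: contrapT => /eqP D; apply: par; exists m, m'.
    have al' : (offd m).1 * (c' * d') = (offd m).2 * (c' ^+ 2 - d' ^+ 2).
      by rewrite -al; field.
    apply/eqP; rewrite -subr_eq0; apply/eqP.
    have [u0|un] := eqVneq (offd m).1 0.
      have vn : (offd m).2 != 0.
        by apply/eqP => v0; apply: mn; rewrite [LHS]surjective_pairing u0 v0.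
      apply: (mulfI vn); rewrite mulr0.
      transitivity ((offd m').1 * (offd m).2 * (c' * d')
        - (offd m').2 * ((offd m).2 * (c' ^+ 2 - d' ^+ 2))); first by ring.
      by rewrite -p -al'; ring.
    apply: (mulfI un); rewrite mulr0.
    transitivity ((offd m').1 * ((offd m).1 * (c' * d'))
      - (offd m).1 * (offd m').2 * (c' ^+ 2 - d' ^+ 2)); first by ring.
    by rewrite p al'; ring.
  exists 1, 0; split; first by ring.
  move=> m mL; have -> : offd m = (0, 0).
    by apply: contrapT => mn; apply: all0; exists m.
  by rewrite /= !mul0r.
have rz := rzm_rotation cd; set k := rzm c' d' in rz.
have rhk := rotation_mul rh rz.
have Ld m : List.In m (List.map (frm (h *m k)) (Lm H a b)) -> exists x y z, m = diag3 x y z.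
  move=> /List.in_map_iff[m0 [<- m0L]].
  have -> : frm (h *m k) m0 = frm k (frm h m0) by rewrite /frm trmx_mul !mulmxA.
  have m1L : List.In (frm h m0) (Lm (act h^T H) (frm h a) (frm h b)).
    by rewrite Lm_frame //; apply: List.in_map.
  have [sm bm] := blk _ m1L; have := diag _ m1L; move: sm bm; rewrite /offd /=.
  move: (frm h m0) => w sw bw e.
  exists (frm k w o0 o0), (frm k w o1 o1), (frm k w o2 o2).
  have [b02 b12] := frm_block c' d' bw; apply: sym_diag3 => //; first by rewrite frm_tr sw.
  have [w02 w12] := bw.
  by rewrite /frm !mulmx3 !mxE /= (tr_entry o1 o0 sw) w02 w12; lra.
have sub m : List.In m (List.map (frm (h *m k)) (Lo H a b)) ->
    List.In m (List.map (frm (h *m k)) (Lm H a b)).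
  by move=> /List.in_map_iff[m0 [<- m0L]]; apply: List.in_map; move: m0L => /=; tauto.
(* If no member of F_o separates two coordinate axes, the third axis is common to F_o and
   [Lo_axial_coaxial] contradicts [nc]. *)
have ax i : (forall m, List.In m (List.map (frm (h *m k)) (Lo H a b)) -> axial (ev R i) m) -> False.
  move=> xL; apply: nc.
  have [|||||n cn] := @Lo_axial_coaxial R (act (h *m k)^T H) (frm (h *m k) a) (frm (h *m k) b)
    _ _ _ (ev R i).
  - exact: in_H4_frame.
  - exact: sym_traceless_frm.
  - exact: sym_traceless_frm.
  - exact: unitv_ev.
  - by move=> m; rewrite Lo_frame //; apply: xL.
  by exists (h *m k *m n); apply: coaxial_unframe.
rewrite /cond_ortho FoE; apply: (symM_class_frame rhk); apply: diag_symM_D2.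
- by move=> m /sub/Ld.
- apply: contrapT => no; apply: (ax o2) => m mL; have [x [y [z mE]]] := Ld _ (sub _ mL).
  rewrite mE (_ : y = x); first exact: axial_diag2.
  apply: contrapT => /eqP xy; apply: no; exists m => //; rewrite mE !mxE /=.
  by rewrite eq_sym.
- apply: contrapT => no; apply: (ax o1) => m mL; have [x [y [z mE]]] := Ld _ (sub _ mL).
  rewrite mE (_ : z = x); first exact: axial_diag1.
  apply: contrapT => /eqP xy; apply: no; exists m => //; rewrite mE !mxE /=.
  by rewrite eq_sym.
apply: contrapT => no; apply: (ax o0) => m mL; have [x [y [z mE]]] := Ld _ (sub _ mL).
rewrite mE (_ : z = y); first exact: axial_diag0.
apply: contrapT => /eqP xy; apply: no; exists m => //; rewrite mE !mxE /=.
by rewrite eq_sym.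
Qed.

End LowSymmetryClasses.

(** * The eight classes are distinct *)

Section ClassInvariants.
Variable R : realType.
Implicit Types (g h : 'M[R]_3) (S K : 'M[R]_3 -> Prop).

Definition has_trace K (t : R) : Prop := exists2 g, K g & \tr g = t.

(** Separates D_2 from Z_2. *)
Definition has_two_halfturns K : Prop :=
  exists g h, [/\ K g, K h, g <> h, \tr g = -1 & \tr h = -1].

(** Separates SO(3) from O(2): trace 0 means angle 2 pi / 3, and in O(2) such rotations are all
    about z, hence commute. *)
Definition has_skew_thirdturns K : Prop :=
  exists g h, [/\ K g, K h, g *m h <> h *m g, \tr g = 0 & \tr h = 0].

(* Numbers the eight classes from 0 in the order of the clauses of the theorem. *)
Definition class_code K : nat :=
  if `[< has_trace K (11 / 5) >] then (if `[< has_skew_thirdturns K >] then 0 else 2)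
  else if `[< has_trace K 1 >] then (if `[< has_trace K 0 >] then 1 else 3)
  else if `[< has_trace K 0 >] then 4
  else if `[< has_two_halfturns K >] then 5
  else if `[< has_trace K (-1) >] then 6 else 7.

Lemma conj_class_frm S K : conj_class S K ->
  exists2 h, rotation h & (forall g, S g <-> K (frm h g)) /\ (forall g, K g <-> S (frm h^T g)).
Proof.
move=> [h [rh e]]; have SK g : S g <-> K (frm h g) by rewrite e frm_invmx.
exists h => //; split=> // g; rewrite SK.
by have := frmK g (rotation_tr rh); rewrite trmxK => ->.
Qed.

Lemma frm_invariants h S K : rotation h -> (forall g, S g -> K (frm h g)) ->
  [/\ forall t, has_trace S t -> has_trace K t, has_two_halfturns S -> has_two_halfturns K
    & has_skew_thirdturns S -> has_skew_thirdturns K].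
Proof.
move=> rh SK; split.
- by move=> t [g Sg <-]; exists (frm h g); [exact: SK | exact: frm_trace].
- move=> [g [k [Sg Sk gk tg tk]]]; exists (frm h g), (frm h k); rewrite !frm_trace //.
  by split; [exact: SK | exact: SK | move/(frm_inj rh) | |].
move=> [g [k [Sg Sk gk tg tk]]]; exists (frm h g), (frm h k); rewrite !frm_trace //.
by split; [exact: SK | exact: SK | move=> e; apply: gk; apply/(frm_comm _ _ rh) | |].
Qed.

Lemma conj_class_code S K : conj_class S K -> class_code S = class_code K.
Proof.
move=> /conj_class_frm[h rh [SK KS]].
have [t1 h1 s1] := frm_invariants rh (fun g => (SK g).1).
have [t2 h2 s2] := frm_invariants (rotation_tr rh) (fun g => (KS g).1).
have tE t : `[< has_trace S t >] = `[< has_trace K t >].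
  by apply: asbool_equiv_eq; split; [exact: t1 | exact: t2].
have hE : `[< has_two_halfturns S >] = `[< has_two_halfturns K >].
  exact: asbool_equiv_eq.
have sE : `[< has_skew_thirdturns S >] = `[< has_skew_thirdturns K >].
  exact: asbool_equiv_eq.
by rewrite /class_code !tE hE sE.
Qed.

Lemma trace3 g : \tr g = g o0 o0 + g o1 o1 + g o2 o2.
Proof. by rewrite /mxtrace sum3. Qed.

Lemma dihedral_trace Z t : circle_subgroup Z ->
  has_trace (dihedral Z) t <-> t = -1 \/ exists c s : R, Z c s /\ t = 1 + 2 * c.
Proof.
move=> [_ Z1 _ _]; split=> [[g [c [s [Zcs gE]]] <-]|[->|[c [s [Zcs ->]]]]].
- case: gE => ->; rewrite trace3 ?mulmx3 !mxE /=.
    by right; exists c, s; split=> //; ring.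
  by left; ring.
- by exists (rx R); [exists 1, 0; rewrite rzm10 mul1mx; auto | rewrite trace3 !mxE /=; ring].
by exists (rzm c s); [exists c, s; auto | rewrite trace3 !mxE /=; ring].
Qed.

Lemma eq_class_code S K : (forall g, S g <-> K g) -> class_code S = class_code K.
Proof. by move=> SK; apply/conj_class_code/conj_class_refl. Qed.

Lemma O2_code : class_code (@O2 R) = 2.
Proof.
rewrite (eq_class_code (@O2P R)) /class_code.
have tx x y : \tr (rzm x y *m rx R) <> 0.
  by rewrite trace3 !mulmx3 !mxE /= => t; lra.
case: asboolP => [_|[]]; last first.
  apply/(dihedral_trace _ (circ_subgroup R)); right; exists (3 / 5), (4 / 5).
  by rewrite /circ; split; field.
case: asboolP => // -[g [k [[c [s [_ gE]]] [c' [s' [_ kE]]] gk tg tk]]].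
case: gk; case: gE tg => -> //; last by move/tx.
case: kE tk => -> //; last by move/tx.
by rewrite !rzm_mul => _ _; congr rzm; ring.
Qed.

Lemma D4_code : class_code (@Dn R 4) = 3.
Proof.
rewrite (eq_class_code (@D4P R)) /class_code.
have sub := circ4_subgroup R.
have no t : has_trace (dihedral (@circ4 R)) t -> [\/ t = -1, t = 1 | t = 3].
  move=> /(dihedral_trace _ sub)[->|[c [s [[e /eqP cs] ->]]]]; first by constructor 1.
  move: cs e; rewrite mulf_eq0 /circ => /orP[] /eqP -> e; first by constructor 2; ring.
  have /eqP : c ^+ 2 = 1 by rewrite -[RHS]e; ring.
  by rewrite sqrf_eq1 => /orP[] /eqP ->; [constructor 3 | constructor 1]; ring.
rewrite asboolF; last by move=> /no[]; lra.
rewrite asboolT; last first.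
  by apply/(dihedral_trace _ sub); right; exists 0, 1; do ?split; rewrite /circ; ring.
by rewrite asboolF // => /no[]; lra.
Qed.

Lemma D3_code : class_code (@Dn R 3) = 4.
Proof.
rewrite (eq_class_code (@D3P R)) /class_code.
have sub := circ3_subgroup R.
have no t : has_trace (dihedral (@circ3 R)) t -> [\/ t = -1, t = 3 | t = 0].
  move=> /(dihedral_trace _ sub)[->|[c [s [/circ3_cases[[-> _]|[-> _]] ->]]]].
  - by constructor 1.
  - by constructor 2; ring.
  by constructor 3; field.
do 2 (rewrite asboolF; last by move=> /no[]; lra).
rewrite asboolT //; apply/(dihedral_trace _ sub); right.
exists (- 2^-1), (Num.sqrt 3 / 2); split; last by field.
have s2 : (Num.sqrt 3 / 2 : R) ^+ 2 = 3 / 4 by rewrite exprMn sqr_sqrtr //; field.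
move: s2; set s := _ / 2 => s2; split; rewrite /circ ?s2; [by field | | by field].
by transitivity (s * (3 / 4 - s ^+ 2)); [field | rewrite s2 subrr mulr0].
Qed.

Lemma circ2_cases c s : circ2 c s -> s = 0 /\ (c = 1 \/ c = -1 :> R).
Proof.
move=> [e s0]; split=> //; apply/sign_sqr; rewrite -[RHS]e s0; ring.
Qed.

Lemma D2_code : class_code (@Dn R 2) = 5.
Proof.
rewrite (eq_class_code (@D2P R)) /class_code.
have sub := circ2_subgroup R.
have no t : has_trace (dihedral (@circ2 R)) t -> t = -1 \/ t = 3.
  move=> /(dihedral_trace _ sub)[->|[c [s [/circ2_cases[_ [->|->]] ->]]]]; first by left.
    by right; ring.
  by left; ring.
do 3 (rewrite asboolF; last by move=> /no[]; lra).
rewrite asboolT //; exists (rx R), (rzm (-1) 0); split.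
- by exists 1, 0; rewrite rzm10 mul1mx; split; [split; [exact: circ_one|] | right].
- by exists (-1), 0; split; [split; rewrite /circ; ring | left].
- by move/matrixP/(_ o0 o0); rewrite !mxE /=; lra.
- by rewrite trace3 !mxE /=; ring.
by rewrite trace3 !mxE /=; ring.
Qed.

Lemma Z2_code : class_code (@Zn R 2) = 6.
Proof.
rewrite (eq_class_code (@Z2P R)) /class_code; set K := fun g => _.
have no g : K g -> g = 1%:M \/ g = rzm (-1) 0 /\ \tr g = -1.
  move=> [c [s [/circ2_cases[-> [->|->]] ->]]]; [left | right]; first exact: rzm10.
  by split=> //; rewrite trace3 !mxE /=; ring.
have notr t : has_trace K t -> t = 3 \/ t = -1.
  by move=> [g /no[->|[_ ->]] <-]; [left; rewrite mxtrace1 | right].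
do 3 (rewrite asboolF; last by move=> /notr[]; lra).
rewrite asboolF; last first.
  have t1 : \tr (1%:M : 'M[R]_3) <> -1 by rewrite mxtrace1 => ?; lra.
  move=> [g [h [/no[->|[gE _]] /no[->|[hE _]] gh]]]; try by move=> /t1.
    by move=> _ /t1.
  by case: gh; rewrite gE.
rewrite asboolT //; exists (rzm (-1) 0).
  by exists (-1), 0; split=> //; split; rewrite /circ; ring.
by rewrite trace3 !mxE /=; ring.
Qed.

Lemma trivial_code : class_code (@trivial_grp R) = 7.
Proof.
rewrite /class_code; have no t : has_trace (@trivial_grp R) t -> t = 3.
  by move=> [g -> <-]; rewrite mxtrace1.
do 3 (rewrite asboolF; last by move=> /no; lra).
rewrite asboolF; last by move=> [g [h [-> -> []]]].
by rewrite asboolF // => /no; lra.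
Qed.

(** For e = 1 and e = -1, third-turns about two different diagonals of the cube. *)
Definition cyc (e : R) : 'M[R]_3 := \matrix_(i, j)
  match nat_of_ord i, nat_of_ord j with 0, 2 => e | 1, 0 => e | 2, 1 => 1 | _, _ => 0 end.

Lemma cyc_rotation e : e ^+ 2 = 1 -> rotation (cyc e).
Proof.
move=> e2; split; last by rewrite det33 !mxE /= -[RHS]e2; ring.
by apply: mx3P; rewrite !mulmx3 !mxE /= ?mulr0 ?mul0r ?mulr1 ?addr0 ?add0r -?expr2 ?e2 ?mulr1n.
Qed.

Lemma cyc_trace e : \tr (cyc e) = 0.
Proof. by rewrite trace3 !mxE /= !addr0. Qed.

Lemma SO3_code : class_code (@SO3 R) = 0.
Proof.
rewrite /class_code asboolT; last first.
  exists (rzm (3 / 5) (4 / 5)); first by apply: rzm_rotation; field.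
  by rewrite trace3 !mxE /=; field.
rewrite asboolT //; exists (cyc 1), (cyc (-1)); split; rewrite ?cyc_trace //.
- by apply: cyc_rotation; ring.
- by apply: cyc_rotation; ring.
by move/matrixP/(_ o0 o1); rewrite !mulmx3 !mxE /=; lra.
Qed.

Lemma cubeO_code : class_code (@cubeO R) = 1.
Proof.
have sqr_cubeO g : rotation g -> (forall v : 'cV[R]_3, (forall i, v i 0 ^+ 2 = 1) ->
    forall i, (g *m v) i 0 ^+ 2 = 1) -> cubeO g.
  by move=> rg gv; split=> // v v1 i; apply/sign_sqr/gv => j; apply/sign_sqr/v1.
rewrite /class_code asboolF; last first.
  (* The entries of [g] are 0, 1 or -1, so its trace is an integer. *)
  move=> [g cg]; have d i : [\/ g i i = 0, g i i = 1 | g i i = -1].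
    have : g i i ^+ 2 * (g i i ^+ 2 - 1) = 0.
      by transitivity (g i i ^+ 4 - g i i ^+ 2); [ring | rewrite cube_sqr // subrr].
    by move/eqP; rewrite mulf_eq0 sqrf_eq0 subr_eq0 sqrf_eq1 => /or3P[] /eqP; constructor.
  rewrite trace3; have := (d o0, d o1, d o2); move: (g o0 o0) (g o1 o1) (g o2 o2) => x y z.
  by clear=> -[[[] -> [] ->] [] ->]; lra.
rewrite asboolT; last first.
  exists (rzm 0 1); last by rewrite trace3 !mxE /= addr0 add0r.
  apply: sqr_cubeO => [|v v2 i]; first by apply: rzm_rotation; ring.
  rewrite mxE sum3; move: i; apply: ord3P; rewrite !mxE /=.
  - by rewrite -[RHS](v2 o1); ring.
  - by rewrite -[RHS](v2 o0); ring.
  by rewrite -[RHS](v2 o2); ring.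
rewrite asboolT //; exists (cyc 1); last exact: cyc_trace.
apply: sqr_cubeO => [|v v2 i]; first by apply: cyc_rotation; ring.
rewrite mxE sum3; move: i; apply: ord3P; rewrite !mxE /=.
- by rewrite -[RHS](v2 o2); ring.
- by rewrite -[RHS](v2 o0); ring.
by rewrite -[RHS](v2 o1); ring.
Qed.

End ClassInvariants.

(** * One of the seven conditions holds unless the group is trivial *)

Section Exhaustion.
Variable R : realType.
Implicit Types (a b : 'M[R]_3) (H : tensor R 4).

Lemma exhaustion H a b : in_H4 H -> sym_traceless a -> sym_traceless b ->
  cond_iso H a b \/ cond_cubic H a b \/ cond_transv H a b \/ cond_tetra H a b \/
  cond_trigo H a b \/ cond_ortho H a b \/ cond_mono H a b \/
  conj_class (symH H a b) (@trivial_grp R).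
Proof.
move=> hH sa sb.
have [[a0 b0 [k dk]]|nt] := pselect [/\ a = 0, b = 0 & exists k, d2 H = k%:M].
  have [d0|dn] := eqVneq (d2 H) 0; first by left.
  right; left; split=> //; split=> //; split; last exact/eqP.
  rewrite /dev dk mxtrace_scalar -[k *+ 3]mulr_natr scalemx1 (_ : 3^-1 * (k * 3) = k) ?subrr //.
  by field.
have [[n cn]|nc] := pselect (exists n, coaxial H a b n).
  by have [] := coaxial_cond hH sa sb nt cn; tauto.
have [[g [sg g1]]|triv] := pselect (exists g, symH H a b g /\ g <> 1%:M).
  by have [] := low_symmetry_cond hH sa sb nc sg g1; tauto.
do 7 right; apply: conj_class_refl => g; split=> [sg|->]; last exact: symH1.
by apply: contrapT => g1; apply: triv; exists g.
Qed.

End Exhaustion.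

Theorem theorem10p2 (R : realType) (E H : tensor R 4) (lam mu : R) (a b : 'M[R]_3) :
  elasticity E -> sym_traceless a -> sym_traceless b -> in_H4 H ->
  (forall i j k l, get4 E i j k l =
     lam * delta i j * delta k l + mu * (delta i k * delta j l + delta i l * delta j k)
     + delta i j * a k l + delta k l * a i j
     + delta i k * b j l + delta j l * b i k + delta i l * b j k + delta j k * b i l
     + get4 H i j k l) ->
  let FE := [:: pk E] in
  ((has_class FE (@SO3 R) <-> cond_iso H a b) /\
   (has_class FE (@cubeO R) <-> cond_cubic H a b) /\
   (has_class FE (@O2 R) <-> cond_transv H a b) /\
   (has_class FE (@Dn R 4) <-> cond_tetra H a b) /\
   (has_class FE (@Dn R 3) <-> cond_trigo H a b) /\
   (has_class FE (@Dn R 2) <-> cond_ortho H a b) /\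
   (has_class FE (@Zn R 2) <-> cond_mono H a b) /\
   (has_class FE (@trivial_grp R) <->
      ~ cond_iso H a b /\ ~ cond_cubic H a b /\ ~ cond_transv H a b /\
      ~ cond_tetra H a b /\ ~ cond_trigo H a b /\ ~ cond_ortho H a b /\
      ~ cond_mono H a b)).
Proof.
move=> _ sa sb hH dec FE.
have symE g : sym_group FE g <-> symH H a b g.
  split=> [[rg /(_ (pk E) (or_introl erefl)) /(elasticity_sym rg sa sb hH dec)[]]|[rg ga gb gH]].
    by split.
  by split=> // t /= [<-|//]; apply/(elasticity_sym rg sa sb hH dec).
have clE K : has_class FE K <-> conj_class (symH H a b) K.
  by split=> -[h [rh e]]; exists h; split=> // g; rewrite -e ?symE //; apply: iff_sym; apply: symE.
rewrite !clE; have ex := exhaustion hH sa sb.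
have c1 := @iso_class R H a b hH; have c2 := @cubic_class R H a b hH.
have c3 := @transv_class R H a b hH sa sb; have c4 := @tetra_class R H a b hH sa sb.
have c5 := @trigo_class R H a b hH sa sb; have c6 := @ortho_class R H a b hH sa sb.
have c7 := @mono_class R H a b hH sa sb.
have e1 h := etrans (conj_class_code (h : conj_class (symH H a b) _)) (SO3_code R).
have e2 h := etrans (conj_class_code (h : conj_class (symH H a b) _)) (cubeO_code R).
have e3 h := etrans (conj_class_code (h : conj_class (symH H a b) _)) (O2_code R).
have e4 h := etrans (conj_class_code (h : conj_class (symH H a b) _)) (D4_code R).
have e5 h := etrans (conj_class_code (h : conj_class (symH H a b) _)) (D3_code R).
have e6 h := etrans (conj_class_code (h : conj_class (symH H a b) _)) (D2_code R).
have e7 h := etrans (conj_class_code (h : conj_class (symH H a b) _)) (Z2_code R).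
have e8 h := etrans (conj_class_code (h : conj_class (symH H a b) _)) (trivial_code R).
clear clE symE dec FE.
(* A single number [k] is attached to the group and each class prescribes another value of it, so at
   most one class occurs. Since each condition implies its class and [ex] leaves no further case,
   the equivalences are propositional. *)
move: (class_code _) e1 e2 e3 e4 e5 e6 e7 e8 => k e1 e2 e3 e4 e5 e6 e7 e8.
by intuition (exfalso; lia).
Qed.
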